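(* Let $\Omega=(0,1)^3$, let $T>0$, and let $\lambda,\mu\in\mathbb{R}$ satisfy $\mu>0$ and $\lambda+2\mu>0$. Let $\varphi\in L^1(0,T)$, $X=(X_1,X_2,X_3)\in (L^1(0,T;L^1(\partial\Omega)))^3$, $g=(g_1,g_2,g_3)\in (L^2(\Omega))^3$ and $h=(h_1,h_2,h_3)\in (L^2(\Omega))^3$ be given. Assume that: (1) there exist $\Lambda(\varphi)\in(0,T)$ and $C(\varphi)>0$ such that either $\varphi(t)\ge C(\varphi)$ for a.e. $t\in(0,\Lambda(\varphi))$, or $\varphi(t)\le -C(\varphi)$ for a.e. $t\in(0,\Lambda(\varphi))$; (2) $T>2\max\left\{\dfrac{1}{\sqrt{\mu}},\dfrac{1}{\sqrt{\lambda+2\mu}}\right\}$. Then the Lamé inverse problem with data $(\varphi,X,g,h)$ (as defined in the context) has at most one solution $$(u,f)\in \Big(C^2([0,T];L^2(\Omega))\cap L^2(0,T;H^2(\Omega))\Big)^3\times (L^2(\Omega))^3 .$$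
   Context: Write $x=(x_1,x_2,x_3)$, and let $\mathbf n=(\mathbf n_1,\mathbf n_2,\mathbf n_3)$ be the outward unit normal vector of $\partial\Omega$. A pair $(u,f)$ with $u=(u_1,u_2,u_3)(x,t)$ and $f=(f_1,f_2,f_3)(x)$ is a solution of the Lamé inverse problem with data $I=(\varphi,X,g,h)$ if the following hold. - Lamé system with body force $\varphi(t)f(x)$: $\dfrac{\partial^2u}{\partial t^2}-\mu\Delta u-(\lambda+\mu)\nabla(\operatorname{div}u)=\varphi(t)f(x)$ for $x\in\Omega$, $t\in(0,T)$, where $\operatorname{div}u=\partial u_1/\partial x_1+\partial u_2/\partial x_2+\partial u_3/\partial x_3$. - Initial conditions: $u(x,0)=g(x)$ and $\dfrac{\partial u}{\partial t}(x,0)=h(x)$ for $x\in\Omega$. - Dirichlet boundary condition: $u(x,t)=0$ for $x\in\partial\Omega$, $t\in(0,T)$. - Surface stress (overdetermination): for $x\in\partial\Omega$, $t\in(0,T)$, $$\begin{pmatrix}\sigma_1&\tau_{12}&\tau_{13}\\ \tau_{21}&\sigma_2&\tau_{23}\\ \tau_{31}&\tau_{32}&\sigma_3\end{pmatrix}\begin{pmatrix}\mathbf n_1\\ \mathbf n_2\\ \mathbf n_3\end{pmatrix}=\begin{pmatrix}X_1\\ X_2\\ X_3\end{pmatrix},\qquad \tau_{jk}=\mu\left(\frac{\partial u_j}{\partial x_k}+\frac{\partial u_k}{\partial x_j}\right),\quad \sigma_j=\lambda\operatorname{div}(u)+2\mu\frac{\partial u_j}{\partial x_j}.$$ *)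

(* Defs.v *)
From HB Require Import structures.
From mathcomp Require Import all_boot all_order all_algebra.
From mathcomp Require Import all_classical all_reals all_analysis.
Set Implicit Arguments.
Unset Strict Implicit.
Unset Printing Implicit Defensive.
Import Order.TTheory GRing.Theory Num.Theory.
Import numFieldNormedType.Exports.
Local Open Scope classical_set_scope.
Local Open Scope ring_scope.

Notation space3 R :=
  (measurableTypeR R * measurableTypeR R * measurableTypeR R)%type.

Definition coord (R : realType) (i : 'I_3) (x : space3 R) : R :=
  [:: x.1.1; x.1.2; x.2]`_i.

Definition axis (R : realType) (i : 'I_3) : space3 R :=
  ((i == 0 :> nat)%:R, (i == 1 :> nat)%:R, (i == 2 :> nat)%:R).

Definition Omega (R : realType) : set (space3 R) :=
  [set x | forall i, 0 < coord i x < 1].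

Definition boundary (R : realType) : set (space3 R) :=
  closure (@Omega R) `\` interior (@Omega R).

Definition volume (R : realType) : {measure set (space3 R) -> \bar R} :=
  ((lebesgue_measure \x lebesgue_measure) \x lebesgue_measure)%E.

(* Area measure of the plane orthogonal to axis i at coordinate b. *)
Definition plane_area (R : realType) (b : measurableTypeR R) (i : nat) :
    {measure set (space3 R) -> \bar R} :=
  match i with
  | 0%N => ((\d_b \x lebesgue_measure) \x lebesgue_measure)%E
  | 1%N => ((lebesgue_measure \x \d_b) \x lebesgue_measure)%E
  | _ => ((lebesgue_measure \x lebesgue_measure) \x \d_b)%E
  end.

(* Sum, over the six planes carrying the faces of the cube, of the area
   measure of the plane.  It is only ever used on [boundary], where it is the
   surface measure (the plane of a face meets the other faces in null sets). *)
Definition surface (R : realType) : {measure set (space3 R) -> \bar R} :=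
  measure_add (msum (@plane_area R 0) 3) (msum (@plane_area R 1) 3).

(* Outward unit normal off the edges, which are surface-null. *)
Definition normal (R : realType) (i : 'I_3) (x : space3 R) : R :=
  if coord i x == 0 then -1 else if coord i x == 1 then 1 else 0.

(* L^p(D) is represented by functions on the whole space, of which only the
   restriction to D, up to a.e. equality, matters. *)
Definition Lp d (E : measurableType d) (R : realType)
    (mu : {measure set E -> \bar R}) (D : set E) (p : \bar R) : set (E -> R) :=
  [set v | (v \_ D : E -> R) \in Lfun mu p].

Definition Lpnorm d (E : measurableType d) (R : realType)
    (mu : {measure set E -> \bar R}) (D : set E) (p : \bar R) (v : E -> R) :
    \bar R :=
  'N[mu]_p[EFin \o (v \_ D)]%E.

Notation L2 := (Lp (@volume _) (@Omega _) 2%:E).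
Notation L2norm := (Lpnorm (@volume _) (@Omega _) 2%:E).

Definition iter_partial (R : realType) (s : seq 'I_3) (f : space3 R -> R) :
    space3 R -> R :=
  foldr (fun i g => 'D_(axis R i) g) f s.

Definition smooth (R : realType) : set (space3 R -> R) :=
  [set f | forall s : seq 'I_3, continuous (iter_partial s f) /\
    forall i x, derivable (iter_partial s f) x (axis R i)].

Definition test_function (R : realType) : set (space3 R -> R) :=
  [set f | smooth f /\ exists K : set (space3 R),
    [/\ compact K, K `<=` @Omega R & forall x, ~ K x -> f x = 0]].

Definition weak_partial (R : realType) (i : 'I_3) (v w : space3 R -> R) : Prop :=
  [/\ L2 v, L2 w & forall f, test_function f ->
    \int[@volume R]_(x in @Omega R) (v x * 'D_(axis R i) f x) =
    - \int[@volume R]_(x in @Omega R) (w x * f x)].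

(* A junk value if v has no weak partial derivative in L^2; unique up to a.e.
   equality on Omega otherwise. *)
Definition partial (R : realType) (i : 'I_3) (v : space3 R -> R) : space3 R -> R :=
  get (weak_partial i v).

Definition H1 (R : realType) : set (space3 R -> R) :=
  [set v | L2 v /\ forall i, weak_partial i v (partial i v)].

Definition H2 (R : realType) : set (space3 R -> R) :=
  [set v | H1 v /\ forall i, H1 (partial i v)].

Definition H2norm (R : realType) (v : space3 R -> R) : \bar R :=
  ((L2norm v ^+ 2 + \sum_(i < 3) L2norm (partial i v) ^+ 2
    + \sum_(i < 3) \sum_(j < 3) L2norm (partial i (partial j v)) ^+ 2)
   `^ 2^-1)%E.

(* The trace of v in H^1 is the limit in L^2(boundary) of the restrictions of
   functions, smooth up to the boundary, converging to v in H^1; the classical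
   derivatives of v_ n are its weak ones. *)
Definition is_trace (R : realType) (v w : space3 R -> R) : Prop :=
  [/\ H1 v, Lp (@surface R) (@boundary R) 2%:E w &
    exists v_ : nat -> space3 R -> R,
    [/\ forall n, smooth (v_ n),
        L2norm (v_ n \- v) @[n --> \oo] --> 0%E,
        forall i, L2norm ('D_(axis R i) (v_ n) \- partial i v)
          @[n --> \oo] --> 0%E &
        Lpnorm (@surface R) (@boundary R) 2%:E (v_ n \- w)
          @[n --> \oo] --> 0%E]].

Definition simple_curve (R : realType) (V : Type) (S : set (V -> R))
    (s : R -> V -> R) : Prop :=
  exists m (A : 'I_m -> set (measurableTypeR R)) (v : 'I_m -> V -> R),
    [/\ forall i, measurable (A i), forall i, S (v i) &
      s = fun t x => \sum_(i < m) \1_(A i) t * v i x].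

(* L^p(0,T;S), for S a space of functions with norm N: strong (Bochner)
   measurability, as a.e. limit of simple functions, and finiteness of the
   L^p norm of t |-> N (u t). *)
Definition bochner (R : realType) (V : Type) (S : set (V -> R))
    (N : (V -> R) -> \bar R) (T : R) (p : \bar R) : set (R -> V -> R) :=
  [set u | [/\ {ae @lebesgue_measure R, forall t, 0 < t < T -> S (u t)},
    exists s_ : nat -> R -> V -> R, (forall n, simple_curve S (s_ n)) /\
      {ae @lebesgue_measure R, forall t, 0 < t < T ->
        N (s_ n t \- u t) @[n --> \oo] --> 0%E} &
    ('N[@lebesgue_measure R]_p[(N \o u) \_ (`]0%R, T[)] < +oo)%E]].

(* Derivative of a curve [0,T] -> L^2, one-sided at the ends. *)
Definition is_time_derivative (R : realType) (T : R) (u v : R -> space3 R -> R) :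
    Prop :=
  forall t, t \in `[0, T] -> L2 (v t) /\
    L2norm (fun x => (u s x - u t x) / (s - t) - v t x)
      @[s --> within (`[0, T] `\ t) (nbhs t)] --> 0%E.

(* A junk value if u is not differentiable on [0,T]; unique up to a.e.
   equality on Omega, at each t in [0,T], otherwise. *)
Definition dt (R : realType) (T : R) (u : R -> space3 R -> R) : R -> space3 R -> R :=
  get (is_time_derivative T u).

Definition C0L2 (R : realType) (T : R) : set (R -> space3 R -> R) :=
  [set u | forall t, t \in `[0, T] -> L2 (u t) /\
    L2norm (u s \- u t) @[s --> within `[0, T] (nbhs t)] --> 0%E].

Definition C2L2 (R : realType) (T : R) : set (R -> space3 R -> R) :=
  [set u | [/\ C0L2 T u, is_time_derivative T u (dt T u), C0L2 T (dt T u),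
    is_time_derivative T (dt T u) (dt T (dt T u)) & C0L2 T (dt T (dt T u))]].

Definition vector_field (R : realType) := 'I_3 -> space3 R -> R.

Definition div (R : realType) (v : vector_field R) : space3 R -> R :=
  fun x => \sum_(i < 3) partial i (v i) x.

Definition laplacian (R : realType) (v : space3 R -> R) : space3 R -> R :=
  fun x => \sum_(i < 3) partial i (partial i v) x.

Definition stress (R : realType) (la mu : R) (v : vector_field R) (j k : 'I_3) :
    space3 R -> R :=
  fun x => if j == k then la * div v x + 2 * mu * partial j (v j) x
           else mu * (partial k (v j) x + partial j (v k) x).

Section lame.
Variables (R : realType) (la mu T : R).
Implicit Types (phi : R -> R) (X u : R -> vector_field R) (g h f : vector_field R).

Local Notation ae_time P :=
  {ae @lebesgue_measure R, forall t, 0 < t < T -> P t}.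
Local Notation ae_Omega P := {ae @volume R, forall x, @Omega R x -> P x}.
Local Notation ae_boundary P :=
  {ae @surface R, forall x, @boundary R x -> P x}.

Definition lame_class (u : R -> vector_field R) (f : vector_field R) : Prop :=
  forall j, [/\ C2L2 T (fun t => u t j),
    bochner (@H2 R) (@H2norm R) T 2%:E (fun t => u t j) & L2 (f j)].

(* u is in H^2 only for a.e. t, so the equation holds in L^2(Omega) for a.e. t. *)
Definition lame_system phi u f : Prop := forall j,
  ae_time (fun t => ae_Omega (fun x =>
    dt T (dt T (fun s => u s j)) t x - mu * laplacian (u t j) x
    - (la + mu) * partial j (div (u t)) x = phi t * f j x)).

Definition initial_conditions g h u : Prop := forall j,
  ae_Omega (fun x => u 0 j x = g j x) /\
  ae_Omega (fun x => dt T (fun s => u s j) 0 x = h j x).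

Definition dirichlet_condition u : Prop := forall j,
  ae_time (fun t => is_trace (u t j) (cst 0)).

Definition stress_condition X u : Prop :=
  ae_time (fun t => exists sigma : 'I_3 -> 'I_3 -> space3 R -> R,
    (forall j k, is_trace (stress la mu (u t) j k) (sigma j k)) /\
    forall j, ae_boundary (fun x =>
      \sum_(k < 3) sigma j k x * normal k x = X t j x)).

Definition lame_solution phi X g h u f : Prop :=
  [/\ lame_system phi u f, initial_conditions g h u, dirichlet_condition u &
    stress_condition X u].

End lame.

(* Main.v *)
Require Import Defs.
From HB Require Import structures.
From mathcomp Require Import all_boot all_order all_algebra.
From mathcomp Require Import all_classical all_reals all_analysis.
From mathcomp Require Import measurable_realfun ring lra.
Import Order.TTheory GRing.Theory Num.Theory.
Import numFieldNormedType.Exports.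
Local Open Scope classical_set_scope.
Local Open Scope ring_scope.

Local Notation coord := Defs.coord.

(** The difference of two solutions solves the Lame system with force
    [phi(t) (f1 - f2)], starts from rest, and vanishes on the boundary of the
    cube together with its surface stress.  Pair it with the exponentials
    [e(x) = exp(eta . x)] for real vectors [eta].  Integrating by parts twice
    leaves no boundary term, because the Dirichlet data and the stress data
    both cancel ([green_formula], [pairing_equation]).  So the pairings [D_j(t)]
    of the three components with [e] satisfy a closed linear system
    [D'' = mu |eta|^2 D + (la + mu) (eta . D) eta + phi(t) F], where [F_j] is
    the pairing of [f1_j - f2_j] with [e].  The components along [eta] and
    orthogonal to [eta] decouple it into scalar equations
    [p'' = k^2 p + phi(t) F] with [k = sqrt(la + 2 mu) |eta|] or
    [k = sqrt(mu) |eta|].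

    Multiplying such an equation by [exp(-k t)] and integrating from rest gives
    [exp(-k T) (p'(T) + k p(T)) = F int_0^T phi(t) exp(-k t) dt]
    ([oscillator_weighted]).  The sign of [phi] on [(0, L)] bounds the integral
    from below by a multiple of [exp(-k L / 2)] for large [k]
    ([exponential_moment_lower]).  Since [L < T] and [T] is large, the factor
    [exp(-k (T - L / 2))] beats [exp(-|eta|)] by a further decaying exponential,
    hence [|F_j| <= K exp(-|eta|) B], where [B] bounds the pairings at time [T]
    ([mode_bound], [system_bound]).  For [eta = (a, b, r)] with nonnegative
    entries [B] is a multiple of [exp(a + b + r)], so the pairings [F_j] stay
    bounded as [r] tends to infinity with [a] and [b] fixed.

    An integrable function on [(0, 1)] whose moments against [exp(r s)] are
    bounded for large [r] is zero, by a classical argument of Mikusinski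
    ([bounded_exponential_moments]); on the cube the same argument in the last
    variable, followed by the other two, shows that boundedness in [r] is enough
    ([expo_complete]).  Therefore [f1 = f2].  Then [F = 0], and the identity
    above used with [k] and [-k] gives [D = 0] at all times ([free_oscillator]):
    every pairing of [u1 - u2] with [e] vanishes, and [u1 = u2].

    What remains is to justify the integrations by parts.  Traces are limits of
    smooth functions, so the divergence theorem for smooth functions on the cube
    ([divergence_cube]) suffices for the boundary terms ([trace_parts]); weak
    second derivatives are compared by testing against exponentials cut off near
    the boundary ([expo_cut]). *)

(** * Square integrable functions *)

Section square_integrable.
Context {d} {E : measurableType d} {R : realType}.
Variables (mu : {measure set E -> \bar R}) (D : set E).
Hypothesis mD : measurable D.
Implicit Types v w g : E -> R.

Lemma patchM v w : (v \* w) \_ D = (v \_ D) \* (w \_ D).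
Proof. by apply/funext => x; rewrite /patch /=; case: ifP; rewrite ?mulr0. Qed.

Lemma Lp2_measurable v : Lp mu D 2%:E v -> measurable_fun D v.
Proof.
rewrite /Lp /= inE => /andP[+ _]; rewrite inE => mv.
by apply/(measurable_restrictT v mD).
Qed.

Lemma Lp2D v w : Lp mu D 2%:E v -> Lp mu D 2%:E w -> Lp mu D 2%:E (v \+ w).
Proof.
move=> Lv Lw; rewrite /Lp /=.
have -> : (v \+ w) \_ D = (v \_ D) \+ (w \_ D).
  by apply/funext => x; rewrite /patch /=; case: ifP; rewrite ?addr0.
by apply: (@Lfun_addr_closed _ _ _ mu 2%:E (lee1n 2)).2.
Qed.

Lemma Lp2Z a v : Lp mu D 2%:E v -> Lp mu D 2%:E (fun x => a * v x).
Proof.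
move=> Lv; rewrite /Lp /=.
have -> : (fun x => a * v x) \_ D = a \*o (v \_ D).
  by apply/funext => x; rewrite /patch /=; case: ifP; rewrite ?mulr0.
have -> : a \*o v \_ D = a \o* v \_ D by apply/funext => x /=; rewrite mulrC.
by apply: Lfun_scale => //; rewrite ler1n.
Qed.

Lemma Lp2B v w : Lp mu D 2%:E v -> Lp mu D 2%:E w -> Lp mu D 2%:E (v \- w).
Proof.
move=> Lv /(Lp2Z (-1)) Lw; have := Lp2D _ _ Lv Lw.
by rewrite (_ : _ \+ _ = v \- w)//; apply/funext => x /=; rewrite mulN1r.
Qed.

Lemma Lp2_sum (n : nat) (v : 'I_n -> E -> R) :
  (forall i, Lp mu D 2%:E (v i)) -> Lp mu D 2%:E (fun x => \sum_(i < n) v i x).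
Proof.
elim: n v => [|n IH] v Lv.
  have -> : (fun x => \sum_(i < 0) v i x) = cst 0.
    by apply/funext => x; rewrite big_ord0.
  rewrite /Lp /= (_ : cst 0 \_ D = 0); last first.
    by apply/funext => x; rewrite /patch; case: ifP.
  exact: (@Lfun_addr_closed _ _ _ mu 2%:E (lee1n 2)).1.
under eq_fun do rewrite big_ord_recr /=.
by apply: Lp2D; [exact: IH|exact: Lv].
Qed.

Lemma Lp2_integrableM v w : Lp mu D 2%:E v -> Lp mu D 2%:E w ->
  mu.-integrable D (fun x => (v x * w x)%:E).
Proof.
move=> Lv Lw; have := Lfun2_mul_Lfun1 Lv Lw.
move=> /Lfun1_integrable; rewrite -patchM => h.
by apply/integrable_mkcond => //; rewrite restrict_EFin.
Qed.

Lemma Lp2_hoelder v w : Lp mu D 2%:E v -> Lp mu D 2%:E w ->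
  `|\int[mu]_(x in D) (v x * w x)| <=
  fine (Lpnorm mu D 2%:E v) * fine (Lpnorm mu D 2%:E w).
Proof.
move=> Lv Lw.
have fin z : Lp mu D 2%:E z -> Lpnorm mu D 2%:E z \is a fin_num.
  rewrite /Lp /= => /sub_Lfun_finLfun; rewrite inE /= /finite_norm => zoo.
  by rewrite ge0_fin_numE// Lnorm_ge0.
have mm z : Lp mu D 2%:E z -> measurable_fun setT (z \_ D).
  by move/Lp2_measurable/(measurable_restrictT _ mD).
have iM := Lp2_integrableM _ _ Lv Lw.
apply: (le_trans (le_normr_Rintegral mD iM)).
rewrite -lee_fin EFinM (fineK (fin v Lv)) (fineK (fin w Lw)).
apply: le_trans (@hoelder _ _ _ mu (v \_ D) (w \_ D) 2 2 _ _ _ _ _) => //; last 3 first.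
- exact: mm.
- exact: mm.
- by rewrite -mulr2n -(mulr_natr 2^-1) mulVf.
rewrite Lnorm1 -patchM /Rintegral fineK; last first.
  by apply: integrable_fin_num => //; exact: (integrable_norm iM).
rewrite [leLHS]integral_mkcond le_eqVlt; apply/orP; left; apply/eqP.
by apply: eq_integral => x _; rewrite /patch /=; case: ifP; rewrite //= normr0.
Qed.

Hypothesis muD : (mu D < +oo)%E.

Lemma Lp2_bounded g (M : R) : measurable_fun D g ->
  (forall x, D x -> `|g x| <= M) -> Lp mu D 2%:E g.
Proof.
move=> mg gM; rewrite /Lp /= inE; apply/andP; split; rewrite inE /=.
  exact/(measurable_restrictT g mD).
have ig : mu.-integrable D (EFin \o (fun x => g x ^+ 2)).
  apply: measurable_bounded_integrable => //; first exact: measurable_funX.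
  exists (M ^+ 2); split; first exact: num_real.
  move=> y My x Dx /=; apply: le_trans (ltW My).
  by rewrite normrX ler_sqr ?nnegrE ?(le_trans (normr_ge0 _) (gM _ Dx))// gM.
rewrite /finite_norm unlock; apply: poweR_lty.
rewrite (_ : (\int[mu]_x _)%E = (\int[mu]_(x in D) (g x ^+ 2)%:E)%E); last first.
  rewrite [RHS]integral_mkcond; apply: eq_integral => x _.
  rewrite /patch /= ; case: ifP => _ /=; last by rewrite normr0 powR0.
  by rewrite powR_mulrn// -normrX ger0_norm// sqr_ge0.
have /integrableP[_] := ig; apply: le_lt_trans.
by apply: ge0_le_integral => //=; [move=> x _; rewrite lee_fin sqr_ge0|
  exact/measurable_EFinP/measurable_funX |
  apply/measurable_EFinP/measurableT_comp => //; exact: measurable_funX |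
  move=> x _; rewrite lee_fin ler_norm].
Qed.

Lemma Lp2_integrable v : Lp mu D 2%:E v -> mu.-integrable D (EFin \o v).
Proof.
move=> Lv; have L1 : Lp mu D 2%:E (cst 1 : E -> R).
  by apply: (Lp2_bounded _ 1) => // x _ /=; rewrite normr1.
have := Lp2_integrableM _ _ Lv L1.
by rewrite (_ : (fun _ => _) = EFin \o v)//; apply/funext => x /=; rewrite mulr1.
Qed.

(** Along an arbitrary filter, so that it applies both to the smooth
    approximations of a trace and to curves in continuous time. *)
Lemma Lp2_cvg (S : Type) (F : set_system S) {FF : Filter F} (v_ : S -> E -> R) v g :
  (\forall s \near F, Lp mu D 2%:E (v_ s)) -> Lp mu D 2%:E v -> Lp mu D 2%:E g ->
  Lpnorm mu D 2%:E (v_ s \- v) @[s --> F] --> 0%E ->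
  \int[mu]_(x in D) (v_ s x * g x) @[s --> F] --> \int[mu]_(x in D) (v x * g x).
Proof.
move=> Lvs Lv Lg cv.
have cv' : fine (Lpnorm mu D 2%:E (v_ s \- v)) * fine (Lpnorm mu D 2%:E g)
    @[s --> F] --> 0.
  rewrite -(mul0r (fine (Lpnorm mu D 2%:E g))); apply: cvgMl.
  exact: fine_cvg.
apply/subr_cvg0/norm_cvg0P.
apply: (squeeze_cvgr _ (cvg_cst 0) cv').
near=> s; rewrite normr_ge0/=.
have Ls : Lp mu D 2%:E (v_ s) by near: s.
rewrite -RintegralB//; try exact: Lp2_integrableM.
under eq_Rintegral do rewrite -mulrBl.
by apply: Lp2_hoelder => //; exact: Lp2B.
Unshelve. all: by end_near. Qed.

End square_integrable.

(** * Functions with bounded exponential moments *)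

Section Rintegral_extra.
Context {d} {E : measurableType d} {R : realType}.
Variables (mu : {measure set E -> \bar R}) (D : set E).
Hypothesis mD : measurable D.

Lemma Rintegral_dominated_cvg (f_ : nat -> E -> R) (f g : E -> R) :
  (forall n, measurable_fun D (f_ n)) ->
  (forall x, D x -> f_ n x @[n --> \oo] --> f x) ->
  mu.-integrable D (EFin \o g) ->
  (forall n x, D x -> `|f_ n x| <= g x) ->
  \int[mu]_(x in D) f_ n x @[n --> \oo] --> \int[mu]_(x in D) f x.
Proof.
move=> mf ff ig fg.
have cE : forall x, D x -> (EFin \o f_ n) x @[n --> \oo] --> (f x)%:E.
  by move=> x Dx; apply: cvg_EFin; [exact: nearW|exact: ff].
have mE n : measurable_fun D (EFin \o f_ n) by exact/measurable_EFinP.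
have bE n x : D x -> (`|(EFin \o f_ n) x| <= (EFin \o g) x)%E.
  by move=> Dx; rewrite /= lee_fin fg.
have mfE : measurable_fun D (EFin \o f) by exact: (emeasurable_fun_cvg _ _ mE cE).
have [iff _ h] := @dominated_convergence _ _ _ mu D mD _ _ (EFin \o g) mE mfE
  (aeW _ cE) ig (aeW _ (fun x n => bE n x)).
apply: fine_cvg; rewrite fineK; last exact: integrable_fin_num iff.
exact: h.
Qed.

Lemma integrable_mulr_bounded (h g : E -> R) (M : R) :
  mu.-integrable D (EFin \o h) -> measurable_fun D g ->
  (forall x, D x -> `|g x| <= M) ->
  mu.-integrable D (fun x => (h x * g x)%:E).
Proof.
move=> ih mg gM; have mh : measurable_fun D h.
  by apply/measurable_EFinP; exact: measurable_int ih.
apply: (le_integrable mD _ _ (integrableZl mD M ih)) => //.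
  by apply/measurable_EFinP; exact: measurable_funM.
move=> x Dx; rewrite /= lee_fin !normrM mulrC ler_wpM2r//.
by rewrite (le_trans (gM x Dx))// ler_norm.
Qed.

End Rintegral_extra.

Section bounded_exponential_moments.
Context {d} {E : measurableType d} {R : realType}.
Variables (mu : {measure set E -> \bar R}) (D : set E).
Hypothesis mD : measurable D.
Variables (h k : E -> R) (M : R) (r0 : nat).
Hypothesis ih : mu.-integrable D (EFin \o h).
Hypothesis mk : measurable_fun D k.
Hypothesis k1 : forall x, D x -> k x <= 1.
Hypothesis hM : forall r : nat, (r0 <= r)%N ->
  `|\int[mu]_(x in D) (h x * expR (r%:R * k x))| <= M.

Let mh : measurable_fun D h.
Proof. by apply/measurable_EFinP; exact: measurable_int ih. Qed.

(** As [m] grows, [z] tends to [0] where [k <= c] and to infinity where [c < k],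
    so [1 - exp (- z)] tends to the indicator of [c < k].  Its power series in
    [z] involves only the moments with exponents [j * m ^ 2], and the summand
    [- m] gives the moment of order [j] a weight at most [exp (- j m) / j!],
    small even after summation over [j]. *)
Let z (c : R) m x := expR ((m ^ 2)%:R * (k x - c) - m%:R).

Let mz c m : measurable_fun D (z c m).
Proof.
apply: measurableT_comp => //; apply: measurable_funB => //.
by apply: measurable_funM => //; exact: measurable_funB.
Qed.

Let z_ge0 c m x : 0 <= z c m x. Proof. exact: expR_ge0. Qed.

Let z_le c m x : 0 <= c -> D x -> z c m x <= expR (m ^ 2)%:R.
Proof.
move=> c0 Dx; rewrite ler_expR -subr_ge0.
have := k1 x Dx => kx1; have m2 : 0 <= ((m ^ 2)%:R : R) by [].
have mm : 0 <= (m%:R : R) by [].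
nra.
Qed.

Let zX c m j x : z c m x ^+ j =
  expR (- (j * m)%:R - (j * m ^ 2)%:R * c) * expR ((j * m ^ 2)%:R * k x).
Proof. by rewrite -expRM_natl -expRD; congr expR; rewrite !natrM; ring. Qed.

Let series_int c m N : 0 <= c -> (r0 <= m)%N -> (0 < m)%N ->
  `|\int[mu]_(x in D) (h x * (1 - series (exp_coeff (- z c m x)) N.+1))| <=
  M * (expR (expR (- m%:R)) - 1).
Proof.
move=> c0 rm m0.
have -> : \int[mu]_(x in D) (h x * (1 - series (exp_coeff (- z c m x)) N.+1)) =
    \sum_(1 <= j < N.+1) - ((-1) ^+ j / j`!%:R *
      expR (- (j * m)%:R - (j * m ^ 2)%:R * c)) *
      \int[mu]_(x in D) (h x * expR ((j * m ^ 2)%:R * k x)).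
  have ij (j : nat) : mu.-integrable D
      (EFin \o (fun x => h x * expR ((j * m ^ 2)%:R * k x))).
    apply: (integrable_mulr_bounded _ _ _ _ _ (expR (j * m ^ 2)%:R)) => //.
      by apply: measurableT_comp => //; apply: measurable_funM.
    move=> x Dx; rewrite ger0_norm ?expR_ge0// ler_expR.
    by rewrite ler_piMr// k1.
  elim: N => [|N IH].
    rewrite big_geq//; under eq_Rintegral do
      rewrite /series /= big_nat1 /exp_coeff /= expr0 divr1 subrr mulr0.
    by rewrite Rintegral_cst// mul0r.
  rewrite big_nat_recr//= -IH -RintegralZl// -RintegralD//; last 2 first.
  - apply: (integrable_mulr_bounded _ _ _ _ _ (1 + expR (expR (m ^ 2)%:R))) => //.
      apply: measurable_funB => //; rewrite /series /=.
      apply: measurable_sum => i; rewrite /exp_coeff /=.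
      by apply: measurable_funM => //; apply: measurable_funX; exact: measurableT_comp.
    move=> x Dx; rewrite (le_trans (ler_normB _ _))// normr1 lerD2l.
    rewrite /series /= (le_trans (ler_norm_sum _ _ _))//.
    apply: (@le_trans _ _ (series (exp_coeff (z c m x)) N.+1)).
      rewrite /series /= le_eqVlt; apply/orP; left; apply/eqP.
      apply: eq_bigr => i _; rewrite /exp_coeff /= normrM normrX normrN.
      by rewrite (ger0_norm (z_ge0 _ _ _)) ger0_norm// invr_ge0.
    apply: (@le_trans _ _ (expR (z c m x))); last by rewrite ler_expR z_le.
    apply: nondecreasing_cvgn_le; last exact: is_cvg_series_exp_coeff.
    by apply: nondecreasing_series => n _ _; exact: exp_coeff_ge0.
  - exact: (integrableZl mD _ (ij _)).
  apply: eq_Rintegral => x _; rewrite /series /= [in LHS]big_nat_recr//=.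
  rewrite /exp_coeff /= (exprNn (z c m x)) zX; ring.
rewrite (le_trans (ler_norm_sum _ _ _))//.
apply: (@le_trans _ _ (\sum_(1 <= j < N.+1) (expR (- m%:R) ^+ j / j`!%:R * M))).
  rewrite big_nat_cond [leRHS]big_nat_cond; apply: ler_sum => j /andP[/andP[j1 _] _].
  rewrite normrM normrN ler_pM// ?hM//; last first.
    rewrite (leq_trans rm)// -{1}(mul1n m) leq_mul// expnS expn1.
    by rewrite leq_pmulr.
  rewrite !normrM normrX normrN1 expr1n mul1r ger0_norm// mulrC.
  rewrite ler_wpM2r// ger0_norm ?expR_ge0// -expRM_natl ler_expR.
  by rewrite natrM mulrN gerBl mulr_ge0.
rewrite -mulr_suml mulrC ler_wpM2l//.
  by apply: le_trans (hM r0 (leqnn _)).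
rewrite lerBrDl.
apply: (@le_trans _ _ (series (exp_coeff (expR (- m%:R))) N.+1)).
  by rewrite /series /= [leRHS]big_nat_recl//= /exp_coeff /= expr0 divr1
    big_add1.
apply: nondecreasing_cvgn_le; last exact: is_cvg_series_exp_coeff.
by apply: nondecreasing_series => n _ _; apply: exp_coeff_ge0; exact: expR_ge0.
Qed.

(** Dominated convergence in the truncation order of the power series. *)
Let limit_int c m : 0 <= c -> (r0 <= m)%N -> (0 < m)%N ->
  `|\int[mu]_(x in D) (h x * (1 - expR (- z c m x)))| <=
  M * (expR (expR (- m%:R)) - 1).
Proof.
move=> c0 rm m0.
have cv : \int[mu]_(x in D) (h x * (1 - series (exp_coeff (- z c m x)) N.+1))
   @[N --> \oo] --> \int[mu]_(x in D) (h x * (1 - expR (- z c m x))).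
  apply: (Rintegral_dominated_cvg _ _ _ _ _
    (fun x => `|h x| * (1 + expR (expR (m ^ 2)%:R)))) => //.
  - move=> N; apply: measurable_funM => //.
    apply: measurable_funB => //; rewrite /series /=.
    apply: measurable_sum => i; rewrite /exp_coeff /=.
    by apply: measurable_funM => //; apply: measurable_funX; exact: measurableT_comp.
  - move=> x Dx; apply: cvgMr; apply: cvgB; first exact: cvg_cst.
    have cs : series (exp_coeff (- z c m x)) n @[n --> \oo] --> expR (- z c m x).
      exact: is_cvg_series_exp_coeff.
    by rewrite -(cvg_shiftS (series _)) in cs.
  - exact: (integrableZr mD _ (integrable_norm ih)).
  - move=> N x Dx; rewrite normrM ler_wpM2l//.
    rewrite (le_trans (ler_normB _ _))// normr1 lerD2l.
    rewrite /series /= (le_trans (ler_norm_sum _ _ _))//.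
    apply: (@le_trans _ _ (series (exp_coeff (z c m x)) N.+1)).
      rewrite /series /= le_eqVlt; apply/orP; left; apply/eqP.
      apply: eq_bigr => i _; rewrite /exp_coeff /= normrM normrX normrN.
      by rewrite (ger0_norm (z_ge0 _ _ _)) ger0_norm// invr_ge0.
    apply: (@le_trans _ _ (expR (z c m x))); last by rewrite ler_expR z_le.
    apply: nondecreasing_cvgn_le; last exact: is_cvg_series_exp_coeff.
    by apply: nondecreasing_series => n _ _; exact: exp_coeff_ge0.
have /cvg_norm cv' := cv.
rewrite -(cvg_lim _ cv')//; apply: limr_le; first exact: cvgP cv'.
by apply: nearW => N; exact: series_int.
Qed.

Let zlim c x : D x ->
  1 - expR (- z c m x) @[m --> \oo] --> ((c < k x)%R%:R : R).
Proof.
move=> Dx; apply/subr_cvg0/norm_cvg0P.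
apply: (squeeze_cvgr _ (cvg_cst 0) (@cvgn_expR R)).
have [ckx|kxc] := ltP c (k x); last first.
  apply: nearW => m; rewrite normr_ge0/= subr0 ger0_norm; last first.
    by rewrite subr_ge0 -[leRHS](@expR0 R) ler_expR oppr_le0.
  have zm : z c m x <= expR (- m%:R).
    by rewrite ler_expR gerDr mulr_ge0_le0// subr_le0.
  apply: le_trans zm; have := expR_ge1Dx (- z c m x); lra.
near=> m; rewrite normr_ge0/= addrAC subrr add0r normrN ger0_norm ?expR_ge0//.
rewrite ler_expR lerN2.
have m2 : 2 / (k x - c) <= m%:R by near: m; exact: nbhs_infty_ger.
rewrite ler_pdivrMr ?subr_gt0// in m2.
apply: le_trans (expR_ge1Dx _).
rewrite natrX; have m0 : 0 <= (m%:R : R) by [].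
nra.
Unshelve. all: by end_near. Qed.

Lemma bounded_exponential_moments_ge0 c : 0 <= c ->
  \int[mu]_(x in D `&` [set x | c < k x]) h x = 0.
Proof.
move=> c0; rewrite Rintegral_mkcondr.
have -> : \int[mu]_(x in D) (h \_ [set x | c < k x]) x =
          \int[mu]_(x in D) (h x * (c < k x)%R%:R).
  apply: eq_Rintegral => x _; rewrite /patch; have [ck|ck] := ltP c (k x).
    by rewrite mem_set ?mulr1.
  by rewrite memNset ?mulr0//=; apply/negP; rewrite -leNgt.
have cv : \int[mu]_(x in D) (h x * (1 - expR (- z c m x))) @[m --> \oo] -->
          \int[mu]_(x in D) (h x * (c < k x)%R%:R).
  apply: (Rintegral_dominated_cvg _ _ _ _ _ (fun x => `|h x|)) => //.
  - move=> m; apply: measurable_funM => //; apply: measurable_funB => //.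
    by apply: measurableT_comp => //; exact: measurableT_comp.
  - by move=> x Dx; apply: cvgMr; exact: zlim.
  - exact: (integrable_norm ih).
  - move=> m x Dx; rewrite normrM ler_piMr// ger0_norm.
      by rewrite gerBl expR_ge0.
    by rewrite subr_ge0 -[leRHS](@expR0 R) ler_expR oppr_le0.
have cv0 : M * (expR (expR (- m%:R)) - 1) @[m --> \oo] --> 0.
  rewrite -(mulr0 M) -(subrr 1); apply: cvgMr; apply: cvgB; last exact: cvg_cst.
  have : expR (expR (- m%:R)) @[m --> \oo] --> (expR 0 : R).
    have ce : {for (0 : R), continuous (@expR R)} by exact: continuous_expR.
    exact: (@continuous_cvg _ _ _ _ _ (fun m : nat => expR (- m%:R) : R) expR 0 ce (@cvgn_expR R)).
  by rewrite expR0.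
rewrite -(cvg_lim _ cv)//; apply: cvg_lim => //.
apply/norm_cvg0P; apply: (squeeze_cvgr _ (cvg_cst 0) cv0).
near=> m; rewrite normr_ge0/=; apply: limit_int => //; near: m.
- exact: nbhs_infty_ge.
- exact: nbhs_infty_gt.
Unshelve. all: by end_near. Qed.

Lemma bounded_exponential_moments c : (forall x, D x -> 0 < k x) ->
  \int[mu]_(x in D `&` [set x | c < k x]) h x = 0.
Proof.
move=> k0; have [c0|c0] := leP 0 c; first exact: bounded_exponential_moments_ge0.
have -> : D `&` [set x | c < k x] = D `&` [set x | 0 < k x].
  by apply/seteqP; split=> x /= [Dx _]; split => //;
    [exact: k0|exact: lt_trans (k0 x Dx)].
exact: bounded_exponential_moments_ge0.
Qed.

End bounded_exponential_moments.

Section pushforward_null.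
Context {d d'} {E : measurableType d} {E' : measurableType d'} {R : realType}.
Variables (mu : {measure set E -> \bar R}) (D : set E).
Hypothesis mD : measurable D.
Variables (h : E -> R) (k : E -> E') (G : set_system E').
Hypothesis ih : mu.-integrable D (EFin \o h).
Hypothesis mk : measurable_fun D k.
Hypothesis mG : @measurable _ E' = <<s G >>.
Hypothesis GI : setI_closed G.

(** The sets that the image under [k] of the signed measure [h mu] does not
    charge form a Dynkin system. *)
Lemma pushforward_null : \int[mu]_(x in D) h x = 0 ->
  (forall A, G A -> \int[mu]_(x in D `&` k @^-1` A) h x = 0) ->
  forall A, measurable A -> \int[mu]_(x in D `&` k @^-1` A) h x = 0.
Proof.
move=> hD hG A; rewrite {1}mG.
have ihI B : measurable B -> mu.-integrable (D `&` k @^-1` B) (EFin \o h).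
  by move=> mB; apply: integrableS ih => //; exact: mk.
move: A.
apply: (@dynkin_induction _ _ G (fun A => \int[mu]_(x in D `&` k @^-1` A) h x = 0)) => //.
- by rewrite preimage_setT setIT.
- move=> S mS hS; have := hD.
  rewrite -{1}(setIT D) -(@preimage_setT _ _ k) -(setUv S) preimage_setU setIUr.
  rewrite Rintegral_setU ?hS ?add0r//.
  + exact: mk.
  + by apply: mk => //; exact: measurableC.
  + by rewrite -setIUr -preimage_setU setUv preimage_setT setIT.
  + apply/disj_setPS => x /= [[_ Sx] [_ nSx]]; exact: nSx.
- move=> F mF tF hF; rewrite preimage_bigcup setI_bigcupr /Rintegral.
  rewrite integral_bigcup//.
  + rewrite eseries0// => i _ _; rewrite -[LHS]fineK.
      by rewrite [X in X%:E](hF i).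
    apply: integrable_fin_num; last exact: ihI.
    exact: mk.
  + apply/trivIsetP => i j _ _ ij; apply/seteqP; split => // x [[_ Fi] [_ Fj]].
    move/trivIsetP: tF => /(_ i j I I ij) => /seteqP[+ _].
    by move=> /(_ (k x)); apply; split.
  + by move=> i; exact: mk.
  + rewrite -setI_bigcupr -preimage_bigcup; apply: ihI.
    exact: bigcup_measurable.
Qed.

End pushforward_null.

(** * Smooth cut-offs and exponentials on the cube *)

Section smooth_one_variable.
Context {R : realType}.
Implicit Types f g : R -> R.

(** The derivatives are existential witnesses, which lets closure properties be
    proved by induction on [n] without computing iterated derivatives. *)
Fixpoint Ck (n : nat) (f : R -> R) : Prop :=
  if n is n'.+1 then exists2 g, (forall x : R, is_derive x 1 f (g x)) & Ck n' g
  else True.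

Definition Cinfty f := forall n, Ck n f.

Lemma CkS n f : Ck n.+1 f -> Ck n f.
Proof. by elim: n f => [//|n IH] f [g fg gn]; exists g => //; exact: IH. Qed.

Lemma CkD n f g : Ck n f -> Ck n g -> Ck n (fun x => f x + g x).
Proof.
elim: n f g => [//|n IH] f g [f' ff' nf'] [g' gg' ng'].
exists (fun x => f' x + g' x); last exact: IH.
by move=> x; exact: is_deriveD.
Qed.

Lemma CkM n f g : Ck n f -> Ck n g -> Ck n (fun x => f x * g x).
Proof.
elim: n f g => [//|n IH] f g nf ng; have := nf; have := ng.
move=> [g' gg' ng'] [f' ff' nf'].
exists (fun x => f x * g' x + g x * f' x).
  by move=> x; exact: is_deriveM.
by apply: CkD; apply: IH => //; exact: CkS.
Qed.

Lemma Ck_cst n (c : R) : Ck n (fun _ => c).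
Proof.
by elim: n c => [//|n IH] c; exists (fun=> 0) => // x; exact: is_derive_cst.
Qed.

Lemma Ck_affine n f (a b : R) : Ck n f -> Ck n (fun x => f (a * x + b)).
Proof.
elim: n f => [//|n IH] f [f' ff' nf'].
exists (fun x => a * f' (a * x + b)); last first.
  by apply: CkM; [exact: Ck_cst|exact: IH].
move=> x; have da : is_derive x 1 (fun y => a * y + b) a.
  have -> : (fun y => a * y + b) = (a \*: id + cst b).
    by apply/funext => y.
  by apply: is_derive_eq; rewrite addr0 /GRing.scale /= mulr1.
by rewrite mulrC; exact: (@is_derive1_comp _ f).
Qed.

Lemma CinftyM f g : Cinfty f -> Cinfty g -> Cinfty (fun x => f x * g x).
Proof. by move=> sf sg n; exact: CkM. Qed.

Lemma Cinfty_affine f a b : Cinfty f -> Cinfty (fun x => f (a * x + b)).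
Proof. by move=> sf n; exact: Ck_affine. Qed.

Lemma Cinfty_expR : Cinfty expR.
Proof. by elim=> [//|n IH]; exists expR => // x; exact: is_derive_expR. Qed.

Lemma Cinfty_derivable f (x : R) : Cinfty f -> derivable f x 1.
Proof. by move=> /(_ 1%N)[g fg _]; case: (fg x). Qed.

Lemma Cinfty_is_derive f (x : R) : Cinfty f -> is_derive x 1 f (derive1 f x).
Proof.
by move=> /Cinfty_derivable df; apply: DeriveDef => //; rewrite derive1E.
Qed.

Lemma Cinfty_continuous f : Cinfty f -> continuous f.
Proof.
move=> sf x; apply: differentiable_continuous.
by apply/derivable1_diffP; exact: Cinfty_derivable.
Qed.

Lemma Cinfty_derive1 f : Cinfty f -> Cinfty (derive1 f).
Proof.
move=> sf n; have [g fg ng] := sf n.+1.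
suff -> : derive1 f = g by [].
by apply/funext => x; rewrite derive1E; case: (fg x).
Qed.

(** The index [k] makes the family closed under differentiation up to linear
    combinations; [flat 0] is the usual smooth function that is flat at [0]. *)
Definition flat k (x : R) : R := if 0 < x then x^-1 ^+ k * expR (- x^-1) else 0.

Lemma flat_ge0 k x : 0 <= flat k x.
Proof. by rewrite /flat; case: ifP => // x0; rewrite mulr_ge0 ?expR_ge0// exprn_ge0// invr_ge0 ltW. Qed.

(** From [y ^ (k + 1) / (k + 1)! <= exp y] at [y = 1 / x]; applied to [k + 1], it
    gives the derivative [0] of [flat k] at the origin. *)
Lemma flat_le k x : 0 <= x -> flat k x <= k.+1`!%:R * x.
Proof.
move=> x0; rewrite /flat; case: ifP => [{}x0|_]; last by rewrite mulr_ge0.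
have y0 : 0 < x^-1 by rewrite invr_gt0.
have := @expR_ge1Dxn _ x^-1 k (ltW y0).
rewrite expRN ler_pdivrMr ?expR_gt0// => h.
have : x^-1 ^+ k.+1 / k.+1`!%:R <= expR x^-1 by apply: le_trans h; rewrite lerDr.
rewrite ler_pdivrMr; last by rewrite ltr0n fact_gt0.
rewrite exprSr ler_pdivrMr// => /le_trans; apply.
by rewrite -mulrA mulrC.
Qed.

Lemma is_derive_flat k (x : R) :
  is_derive x 1 (flat k) (flat k.+2 x - k%:R * flat k.+1 x).
Proof.
have [x0|x0|->] := ltgtP x 0.
- rewrite /flat ltNge (ltW x0)/= mulr0 subr0.
  apply: (near_eq_is_derive _ (is_derive_cst 0 x 1)).
  near=> y; rewrite ifN// -leNgt ltW//.
  by near: y; exact: lt_nbhsl.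
- have nf : \forall y \near x, y^-1 ^+ k * expR (- y^-1) = flat k y.
    by near=> y; rewrite /flat ifT//; near: y; exact: lt_nbhsr.
  apply: (near_eq_is_derive nf); rewrite /flat x0.
  have xn0 : x != 0 by rewrite gt_eqF.
  have dV : is_derive x 1 (fun y : R => y^-1) (- x ^- 2).
    apply: is_derive_eq; first exact: (@is_deriveV _ id).
    by rewrite /GRing.scale /= mulr1.
  have dE : is_derive x 1 (fun y : R => expR (- y^-1)) (expR (- x^-1) * x ^- 2).
    have dN : is_derive x 1 (fun y : R => - y^-1) (x ^- 2).
      by apply: (is_derive_eq (is_deriveN dV)); rewrite opprK.
    exact: (@is_derive1_comp _ expR (fun y => - y^-1)).
  have dX : is_derive x 1 (fun y : R => y^-1 ^+ k)
      (k%:R * x^-1 ^+ k.-1 * (- x ^- 2)).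
    have -> : (fun y : R => y^-1 ^+ k) = (fun y : R => y^-1) ^+ k.
      by apply/funext => y; rewrite exprfctE.
    exact: is_deriveX.
  apply: (is_derive_eq (is_deriveM dX dE)).
  rewrite /GRing.scale /=; case: k {dX nf} => [|k]; first by field.
  by rewrite succnK !exprS; field.
- have -> : flat k.+2 0 - k%:R * flat k.+1 0 = 0.
    by rewrite /flat ltxx mulr0 subrr.
  have c0 : (fun h : R => h^-1 *: ((flat k \o shift 0) (h *: (1 : R)) - flat k 0)) h
      @[h --> 0^'] --> (0 : R).
    have cl : (k.+2`!%:R * `|h|) @[h --> (0:R)^'] --> (0 : R).
      have cn : `|h| @[h --> (0:R)^'] --> (0 : R).
        by apply/norm_cvg0P; exact: nbhs_dnbhs.
      by rewrite -[X in _ --> X](mulr0 k.+2`!%:R); apply: cvgMr.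
    apply/norm_cvg0P; apply: (squeeze_cvgr _ (cvg_cst 0) cl).
    near=> h; rewrite normr_ge0/= addr0 /GRing.scale /= mulr1.
    rewrite {2}/flat ltxx subr0 normrM (ger0_norm (flat_ge0 _ _)).
    have [h0|h0] := ltP 0 h; last first.
      by rewrite {1}/flat ltNge h0 /= mulr0 mulr_ge0.
    have -> : `|h^-1| * flat k h = flat k.+1 h.
      by rewrite /flat h0 exprS mulrA ger0_norm// invr_ge0 ltW.
    by rewrite (gtr0_norm h0) flat_le// ltW.
  apply: DeriveDef; first by apply/cvg_ex; exists 0.
  exact: cvg_lim c0.
Unshelve. all: by end_near. Qed.

Lemma Cinfty_flat k : Cinfty (flat k).
Proof.
move=> n; elim: n k => [//|n IH] k.
exists (fun x => flat k.+2 x - k%:R * flat k.+1 x); first exact: is_derive_flat.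
have -> : (fun x => flat k.+2 x - k%:R * flat k.+1 x) =
    (fun x => flat k.+2 x + (- k%:R) * flat k.+1 x).
  by apply/funext => x; rewrite mulNr.
by apply: CkD => //; apply: CkM => //; exact: Ck_cst.
Qed.

Lemma flat0_le1 x : flat 0 x <= 1.
Proof.
rewrite /flat; case: ifP => // x0.
by rewrite expr0 mul1r -[leRHS](@expR0 R) ler_expR oppr_le0 invr_ge0 ltW.
Qed.

(** The factors vanish for [x <= 1 / n] and for [1 - 1 / n <= x] respectively. *)
Definition cutoff (n : nat) (x : R) : R :=
  flat 0 (n%:R * x + -1) * flat 0 (- n%:R * x + (n%:R - 1)).

Lemma Cinfty_cutoff n : Cinfty (cutoff n).
Proof. by apply: CinftyM; apply: Cinfty_affine; exact: Cinfty_flat. Qed.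

Lemma cutoff_ge0 n x : 0 <= cutoff n x.
Proof. by rewrite mulr_ge0// flat_ge0. Qed.

Lemma cutoff_le1 n x : cutoff n x <= 1.
Proof. by rewrite -[leRHS]mulr1 ler_pM ?flat_ge0 ?flat0_le1. Qed.

Lemma cutoff_supp n x : (0 < n)%N -> cutoff n x != 0 ->
  n%:R^-1 <= x <= 1 - n%:R^-1.
Proof.
move=> n0; rewrite /cutoff mulf_eq0 negb_or /flat => /andP[].
case: ifPn => [h1 _|]; last by rewrite eqxx.
case: ifPn => [h2 _|]; last by rewrite eqxx.
have n0' : 0 < (n%:R : R) by rewrite ltr0n.
have nV : n%:R * n%:R^-1 = 1 :> R by rewrite divff// gt_eqF.
apply/andP; split; rewrite -(ler_pM2l n0') ?mulrBr ?mulr1 nV; lra.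
Qed.

Lemma cutoff_cvg x : 0 < x < 1 -> cutoff n x @[n --> \oo] --> (1 : R).
Proof.
move=> /andP[x0 x1]; rewrite -[X in _ --> X](mulr1 1).
have key (y : R) : 0 < y -> flat 0 (n%:R * y + -1) @[n --> \oo] --> (1 : R).
  move=> y0.
  have c0 : y^-1 * (4 * harmonic n) @[n --> \oo] --> (0 : R).
    rewrite -(mulr0 y^-1) -(mulr0 4); apply: cvgMr; apply: cvgMr.
    exact: cvg_harmonic.
  apply/subr_cvg0/norm_cvg0P; apply: (squeeze_cvgr _ (cvg_cst 0) c0).
  near=> n; rewrite normr_ge0/= distrC ger0_norm ?subr_ge0 ?flat0_le1//.
  (* For [n y >= 3] and [n >= 1], [n y - 1 >= y (n + 1) / 4]; and
     [1 - exp (- 1 / z) <= 1 / z]. *)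
  have n3 : 3 / y <= n%:R by near: n; exact: nbhs_infty_ger.
  rewrite ler_pdivrMr// in n3.
  have n1 : 1 <= (n%:R : R).
    by rewrite ler1n; near: n; exact: nbhs_infty_gt.
  rewrite /flat ifT; last by lra.
  have := expR_ge1Dx (- (n%:R * y + -1)^-1); rewrite expr0 mul1r => h.
  apply: (@le_trans _ _ (n%:R * y + -1)^-1).
    by rewrite lerBlDr -lerBlDl.
  have p1 : 0 < n%:R * y + -1 by lra.
  have -> : y^-1 * (4 / n.+1%:R) = (y * n.+1%:R / 4)^-1.
    rewrite -natr1; field; rewrite (gt_eqF y0)/=.
    by rewrite gt_eqF// addr_gt0// (lt_le_trans ltr01).
  rewrite -natr1 lef_pV2 ?posrE//; nra.
apply: cvgM; first exact: key.
have := key (1 - x); rewrite subr_gt0 => /(_ x1).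
apply: cvg_trans; apply: near_eq_cvg; apply: nearW => n.
by congr (flat 0 _); ring.
Unshelve. all: by end_near. Qed.

End smooth_one_variable.

Section tensor_functions.
Context {R : realType}.
Implicit Types (th : 'I_3 -> R -> R) (x : space3 R).

Lemma coord_line i j (s : R) x :
  coord i (s *: axis R j + x) = s * (i == j)%:R + coord i x.
Proof.
case: x => [[x0 x1] x2].
by case: i => [[|[|[|//]]] ?]; case: j => [[|[|[|//]]] ?];
   rewrite /coord /axis /=.
Qed.

Lemma coord_continuous i : continuous (@coord R i).
Proof.
have c1 : continuous (fun x : space3 R => x.1.1).
  by move=> x; apply: (@continuous_comp _ _ _ fst fst); exact: cvg_fst.
have c2 : continuous (fun x : space3 R => x.1.2).
  by move=> x; apply: (@continuous_comp _ _ _ fst snd); [exact: cvg_fst|exact: cvg_snd].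
have c3 : continuous (fun x : space3 R => x.2) by move=> x; exact: cvg_snd.
by case: i => [[|[|[|//]]] ?].
Qed.

Lemma is_derive_line (f : space3 R -> R) x v (df : R) :
  is_derive (0 : R) (1 : R) (fun s : R => f (s *: v + x)) df <->
  is_derive x v f df.
Proof.
have e : (fun h : R => h^-1 *: (((fun s : R => f (s *: v + x)) \o shift 0) (h *: 1) -
                       f (0 *: v + x))) =
         (fun h : R => h^-1 *: ((f \o shift x) (h *: v) - f x)).
  by apply/funext => h /=; rewrite addr0 scale0r add0r /GRing.scale /= mulr1.
split => -[].
  by rewrite /derivable /derive e => h1 h2; exact: DeriveDef.
by move=> h1 h2; apply: DeriveDef; rewrite /derivable /derive e.
Qed.

(** Products of functions of one variable are stable under partial derivatives,
    which act on one factor; smoothness and supports are checked factor by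
    factor. *)
Definition tens th x : R := \prod_(i < 3) th i (coord i x).

Definition dtens (j : 'I_3) th : 'I_3 -> R -> R :=
  fun i => if i == j then derive1 (th i) else th i.

Lemma Cinfty_dtens j th : (forall i, Cinfty (th i)) -> forall i, Cinfty (dtens j th i).
Proof. by move=> sth i; rewrite /dtens; case: ifP => // _; exact: Cinfty_derive1. Qed.

Lemma is_derive_tens j th x : Cinfty (th j) ->
  is_derive x (axis R j) (tens th) (tens (dtens j th) x).
Proof.
move=> sth; apply/is_derive_line.
have -> : (fun s : R => tens th (s *: axis R j + x)) =
    (\prod_(i < 3 | i != j) th i (coord i x)) \*:
      (fun s : R => th j (s + coord j x)).
  apply/funext => s /=; rewrite /tens (bigD1 j)//= coord_line eqxx mulr1 mulrC.
  congr (_ * _); apply: eq_bigr => i /negbTE ij.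
  by rewrite coord_line ij mulr0 add0r.
have -> : tens (dtens j th) x = (\prod_(i < 3 | i != j) th i (coord i x)) *:
   derive1 (th j) (0 + coord j x).
  rewrite /tens (bigD1 j)//= /dtens eqxx add0r mulrC; congr (_ * _).
  by apply: eq_bigr => i /negbTE ->.
apply: is_deriveZ.
have ds : is_derive (0 : R) (1 : R) (fun s : R => s + coord j x) (1 : R).
  have -> : (fun s : R => s + coord j x) = id + cst (coord j x) by apply/funext.
  by apply: is_derive_eq; rewrite addr0.
have := @is_derive1_comp _ (th j) (fun s => s + coord j x) 0 _ _
  (Cinfty_is_derive (th j) _ sth) ds.
by rewrite mulr1.
Qed.

Lemma tens_continuous th : (forall i, Cinfty (th i)) -> continuous (tens th).
Proof.
move=> sth x; rewrite /tens.
have -> : (fun x : space3 R => \prod_(i < 3) th i (coord i x)) =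
  (fun x => th ord0 (coord ord0 x) * (th (lift ord0 ord0) (coord (lift ord0 ord0) x)
    * th (lift ord0 (lift ord0 ord0)) (coord (lift ord0 (lift ord0 ord0)) x))).
  by apply/funext => y; rewrite !big_ord_recl big_ord0 mulr1.
have cth i : continuous (fun x => th i (coord i x)).
  by move=> y; apply: continuous_comp;
    [exact: coord_continuous|exact: Cinfty_continuous].
by apply: cvgM; [exact: cth|apply: cvgM; exact: cth].
Qed.

Lemma iter_partial_tens th s : (forall i, Cinfty (th i)) ->
  exists2 th', (forall i, Cinfty (th' i)) & iter_partial s (tens th) = tens th'.
Proof.
move=> sth; elim: s => [|j s [th' sth' IH]]; first by exists th.
exists (dtens j th'); first exact: Cinfty_dtens.
by apply/funext => x; rewrite /= IH; have [] := is_derive_tens j th' x (sth' j).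
Qed.

Lemma smooth_tens th : (forall i, Cinfty (th i)) -> smooth (tens th).
Proof.
move=> sth s; have [th' sth' ->] := iter_partial_tens th s sth.
by split; [exact: tens_continuous|move=> i x; have [] := is_derive_tens i th' x (sth' i)].
Qed.

Lemma compact_cube (a b : R) :
  compact [set x : space3 R | forall i, a <= coord i x <= b].
Proof.
have -> : [set x : space3 R | forall i, a <= coord i x <= b] =
    (`[a, b] `*` `[a, b]) `*` `[a, b].
  apply/seteqP; split => [[[x0 x1] x2] /= h|[[x0 x1] x2] /=].
    rewrite !in_itv /=; split; first split.
    - exact: (h ord0).
    - exact: (h (lift ord0 ord0)).
    - exact: (h (lift ord0 (lift ord0 ord0))).
  rewrite !in_itv /= => -[[h0 h1] h2].
  by case=> [[|[|[|//]]] ?].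
by apply: compact_setX; [apply: compact_setX|]; exact: segment_compact.
Qed.

Lemma test_function_tens th (e : R) : 0 < e -> (forall i, Cinfty (th i)) ->
  (forall i s, th i s != 0 -> e <= s <= 1 - e) -> test_function (tens th).
Proof.
move=> e0 sth the; split; first exact: smooth_tens.
exists [set x : space3 R | forall i, e <= coord i x <= 1 - e]; split.
- exact: compact_cube.
- move=> x /= h i; have /andP[h1 h2] := h i.
  by rewrite (lt_le_trans e0 h1)/= (le_lt_trans h2)// ltrBlDr ltrDl.
- move=> x /= /existsNP[i hi]; apply/eqP; rewrite prodf_seq_eq0.
  apply/hasP; exists i; first by rewrite mem_index_enum.
  by apply/negPn/negP => /the /hi.
Qed.

Definition expo (eta : 'I_3 -> R) := tens (fun i s => expR (eta i * s)).

Lemma Cinfty_expRZ (a : R) : Cinfty (fun s => expR (a * s)).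
Proof.
have := Cinfty_affine expR a 0 Cinfty_expR.
by under eq_fun do rewrite addr0.
Qed.

Lemma smooth_expo eta : smooth (expo eta).
Proof. by apply: smooth_tens => i; exact: Cinfty_expRZ. Qed.

Lemma derive_expo eta j x : 'D_(axis R j) (expo eta) x = eta j * expo eta x.
Proof.
have [_ ->] := is_derive_tens j (fun i s => expR (eta i * s)) x
  (Cinfty_expRZ (eta j)).
rewrite /expo /tens (bigD1 j)//= [in RHS](bigD1 j)//= mulrA; congr (_ * _).
  rewrite /dtens eqxx derive1E.
  have dl : is_derive (coord j x) 1 (fun s => eta j * s) (eta j).
    have -> : (fun s => eta j * s) = eta j \*: id by [].
    by apply: is_derive_eq; rewrite /GRing.scale /= mulr1.
  by have [_ ->] := @is_derive1_comp _ expR (fun s => eta j * s) (coord j x) _ _ _ dl; rewrite mulrC.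
by apply: eq_bigr => i /negbTE ij; rewrite /dtens ij.
Qed.

(** A test function that approximates [expo eta], which does not vanish at the
    boundary, from inside the cube. *)
Definition expo_cut (eta : 'I_3 -> R) n :=
  tens (fun i s => expR (eta i * s) * cutoff n s).

Lemma Cinfty_expo_cut (eta : 'I_3 -> R) n i :
  Cinfty (fun s => expR (eta i * s) * cutoff n s).
Proof. by apply: CinftyM; [exact: Cinfty_expRZ|exact: Cinfty_cutoff]. Qed.

Lemma expo_cutE eta n x :
  expo_cut eta n x = expo eta x * \prod_(i < 3) cutoff n (coord i x).
Proof. by rewrite /expo_cut /expo /tens big_split. Qed.

Lemma test_function_expo_cut eta n : (0 < n)%N -> test_function (expo_cut eta n).
Proof.
move=> n0; apply: (test_function_tens _ n%:R^-1).
- by rewrite invr_gt0 ltr0n.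
- exact: Cinfty_expo_cut.
- by move=> i s; rewrite mulf_eq0 negb_or => /andP[_]; exact: cutoff_supp.
Qed.

Lemma derive_expo_cut eta n j :
  'D_(axis R j) (expo_cut eta n) =
  tens (dtens j (fun i s => expR (eta i * s) * cutoff n s)).
Proof. by apply/funext => x; have [] := is_derive_tens j (fun i s => expR (eta i * s) * cutoff n s) x (Cinfty_expo_cut eta n j). Qed.

Lemma test_function_derive_expo_cut eta n j : (0 < n)%N ->
  test_function ('D_(axis R j) (expo_cut eta n)).
Proof.
move=> n0; have [sm [K [cK KO K0]]] := test_function_expo_cut eta n n0.
split; first by rewrite derive_expo_cut; apply: smooth_tens; apply: Cinfty_dtens; exact: Cinfty_expo_cut.
exists K; split => // x nKx.
have cl : closed K by apply: compact_closed => //; exact: norm_hausdorff.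
have nx : \forall y \near x, (fun=> 0) y = expo_cut eta n y.
  have : nbhs x (~` K) by apply: open_nbhs_nbhs; split => //; exact: closed_openC.
  by apply: filterS => y nKy; rewrite K0.
rewrite -(near_eq_derive _ nx); exact: derive_cst.
Qed.

(** The two derivatives act on factors of a product. *)
Lemma derive_expo_cutC eta n j k :
  'D_(axis R j) ('D_(axis R k) (expo_cut eta n)) =
  'D_(axis R k) ('D_(axis R j) (expo_cut eta n)).
Proof.
pose th := fun (i : 'I_3) (s : R) => expR (eta i * s) * cutoff n s.
have s1 i : Cinfty (th i) by exact: Cinfty_expo_cut.
have dd a b : 'D_(axis R a) ('D_(axis R b) (expo_cut eta n)) = tens (dtens a (dtens b th)).
  rewrite (derive_expo_cut eta n b); apply/funext => x.
  by have [] := is_derive_tens a (dtens b th) x (Cinfty_dtens b th s1 a).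
apply: etrans (dd j k) _; apply: etrans _ (esym (dd k j)); apply/funext => x.
by apply: eq_bigr => i _; rewrite /dtens; case: eqP; case: eqP.
Qed.

End tensor_functions.

(** * Borel sets and iterated integrals in three dimensions *)

Section borel_product.

(** The product sigma-algebra is generated by rectangles; by density of the
    rationals, an open set is a countable union of rectangles whose second side
    is a ball of rational centre and radius [1 / (n + 1)]. *)
Lemma measurable_open_prod d (T : measurableType d) (U : topologicalType)
    (R : realType) (f : T -> U) :
  (forall O, open O -> measurable (f @^-1` O)) ->
  forall O : set (U * R), open O ->
  measurable [set p : T * measurableTypeR R | O (f p.1, p.2)].
Proof.
move=> mf O oO.
pose e (n : nat) : R := n.+1%:R^-1.
pose A (q : rat) (n : nat) : set U :=
  interior [set u | forall y, `|ratr q - y| < e n -> O (u, y)].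
have -> : [set p : T * measurableTypeR R | O (f p.1, p.2)] =
    \bigcup_(q : rat) \bigcup_(n : nat)
      ((f @^-1` A q n) `*` [set y : measurableTypeR R | `|ratr q - y| < e n]).
  apply/seteqP; split => [[t y] /= Oty|[t y] [q _ [n _ /= [Aty]]]]; last first.
    by move/(_ y) : (interior_subset Aty); exact.
  have [[P Q] [/= nP nQ] PQ] := oO _ Oty.
  have [r /= r0 rQ] := nQ.
  have [n rn] : exists n, e n < r / 2.
    have [n _ /(_ n (leqnn n)) hn] := near_infty_natSinv_lt (PosNum (divr_gt0 r0 (ltr0Sn R 1))).
    by exists n.
  have en : 0 < e n by rewrite invr_gt0 ltr0n.
  have yy : y - e n < y + e n by lra.
  have [q] := rat_in_itvoo yy.
  rewrite in_itv /= => /andP[q1 q2]; exists q => //; exists n => //; split => /=.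
    apply: filterS nP => u Pu z; rewrite ltr_norml => /andP[z1 z2].
    apply: (PQ (u, z)); split => //=; apply: rQ => /=.
    rewrite /ball_ /= ltr_norml; apply/andP; split; lra.
  by rewrite ltr_norml; apply/andP; split; lra.
apply: bigcupT_measurable_rat => q; apply: bigcupT_measurable => n.
apply: measurableX.
  by apply: mf; exact: open_interior.
have -> : [set y : measurableTypeR R | `|ratr q - y| < e n] =
   `]ratr q - e n, ratr q + e n[%classic.
  by apply/seteqP; split => y /=; rewrite in_itv /= ltr_norml => /andP[h1 h2];
     apply/andP; split; lra.
exact: measurable_itv.
Qed.

Context {R : realType}.

Lemma open_measurable3 (O : set (space3 R)) : open O -> measurable O.
Proof.
move=> oO.
have m1 (O1 : set R) : open O1 -> measurable ((id : measurableTypeR R -> R) @^-1` O1).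
  exact: open_measurable.
have m2 := @measurable_open_prod _ _ _ R _ m1.
have h2 (O2 : set (R * R)) : open O2 ->
    measurable ((id : (measurableTypeR R * measurableTypeR R)%type -> R * R) @^-1` O2).
  move=> oO2; have := m2 O2 oO2; congr measurable.
  by apply/seteqP; split => -[x y].
have := @measurable_open_prod _ _ _ R _ h2 O oO; congr measurable.
by apply/seteqP; split => -[x y].
Qed.

Lemma continuous_measurable3 (f : space3 R -> R) : continuous f -> measurable_fun setT f.
Proof.
move=> /continuousP cf; apply: (measurability _ (RGenOpens.measurableE R)).
move=> _ [_ [a [b ->] <-]]; rewrite setTI.
by apply: open_measurable3; apply: cf; exact: interval_open.
Qed.

End borel_product.

Section product_sigma_finite.
Context {d1 d2} {T1 : measurableType d1} {T2 : measurableType d2} {R : realType}.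
Variables (m1 : {sigma_finite_measure set T1 -> \bar R})
          (m2 : {sigma_finite_measure set T2 -> \bar R}).

(** A name to which sigma-finiteness can be attached, so that a product measure
    can be a factor of another one. *)
Definition product_measure : set (T1 * T2) -> \bar R := (m1 \x m2)%E.

HB.instance Definition _ := Measure.on product_measure.

Lemma product_measure_sigma_finite : sigma_finite setT product_measure.
Proof.
have /sigma_finiteP[F [TF ndF Fb]] := sigma_finiteT m1.
have /sigma_finiteP[G [TG ndG Gb]] := sigma_finiteT m2.
exists (fun n => F n `*` G n) => [|n]; last first.
  have [mF Ffin] := Fb n; have [mG Gfin] := Gb n.
  split; first exact: measurableX.
  by rewrite [ltLHS]product_measure1E// lte_mul_pinfty// ge0_fin_numE.
apply/seteqP; split => // -[x y] _.
have [n _ Fx] : (\bigcup_n F n) x by rewrite -TF.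
have [k _ Gy] : (\bigcup_n G n) y by rewrite -TG.
exists (maxn n k) => //; split => /=.
- by move: x Fx; apply/subsetPset/ndF; exact: leq_maxl.
- by move: y Gy; apply/subsetPset/ndG; exact: leq_maxr.
Qed.

HB.instance Definition _ := @Measure_isSigmaFinite.Build _ _ _ product_measure
  product_measure_sigma_finite.

End product_sigma_finite.

Section fubini3.
Context {R : realType}.
Local Notation RM := (measurableTypeR R).
Local Notation leb := (@lebesgue_measure R).
Local Notation area := (product_measure leb leb).
Local Open Scope ereal_scope.

Lemma tonelli3 (m1 m2 m3 : {sigma_finite_measure set RM -> \bar R})
    (f : space3 R -> \bar R) :
  measurable_fun setT f -> (forall x, 0 <= f x) ->
  \int[(m1 \x m2) \x m3]_x f x =
  \int[m1]_x \int[m2]_y \int[m3]_z f (x, y, z).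
Proof.
move=> mf f0.
have mF := @measurable_fun_fubini_tonelli_F _ _ _ _ _ m3 f mf f0.
have F0 x : 0 <= fubini_F m3 f x by exact: integral_ge0.
transitivity (\int[product_measure m1 m2]_p fubini_F m3 f p).
  exact: (@fubini_tonelli1 _ _ _ _ _ (product_measure m1 m2) m3 f mf f0).
exact: (@fubini_tonelli1 _ _ _ _ _ m1 m2 (fubini_F m3 f) mF F0).
Qed.

(** Treats the three axes uniformly: with [s] variable it runs along a line
    parallel to axis [i], with [s] fixed it parametrizes a plane orthogonal to
    it. *)
Definition ins (i : 'I_3) (s : RM) (p : (RM * RM)%type) : space3 R :=
  match val i with
  | 0%N => (s, p.1, p.2)
  | 1%N => (p.1, s, p.2)
  | _ => (p.1, p.2, s)
  end.

Lemma measurable_pack d (T : measurableType d) (a b c : T -> RM) :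
  measurable_fun setT a -> measurable_fun setT b -> measurable_fun setT c ->
  measurable_fun setT (fun t => (a t, b t, c t) : space3 R).
Proof.
move=> ma mb mc; apply/measurable_fun_pairP; split => //=.
by apply/measurable_fun_pairP; split.
Qed.

Lemma measurable_ins i :
  measurable_fun setT (fun q : (RM * RM) * RM => ins i q.2 q.1).
Proof.
have m1 : measurable_fun setT (fun q : (RM * RM) * RM => q.1.1).
  exact: (measurableT_comp measurable_fst measurable_fst).
have m2 : measurable_fun setT (fun q : (RM * RM) * RM => q.1.2).
  exact: (measurableT_comp measurable_snd measurable_fst).
have m3 : measurable_fun setT (fun q : (RM * RM) * RM => q.2) by exact: measurable_snd.
by case: i => [[|[|[|//]]] ?]; exact: measurable_pack.
Qed.

Lemma measurable_insl i (s : RM) :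
  measurable_fun setT (fun p : RM * RM => ins i s p).
Proof.
exact: (measurableT_comp (measurable_ins i) (@measurable_pair2 _ _ _ _ s)).
Qed.

Lemma tonelli_ins i (f : space3 R -> \bar R) :
  measurable_fun setT f -> (forall x, 0 <= f x) ->
  \int[@volume R]_x f x = \int[area]_p \int[leb]_s f (ins i s p).
Proof.
move=> mf f0.
case: i => [[|[|[|//]]] ?]; rewrite /ins [val _]/=.
- pose g (q : RM * (RM * RM)) := f (q.1, q.2.1, q.2.2).
  have mg : measurable_fun setT g.
    apply: measurableT_comp => //; apply: measurable_pack => //.
    - exact: (measurableT_comp measurable_fst measurable_snd).
    - exact: (measurableT_comp measurable_snd measurable_snd).
  have g0 q : 0 <= g q by exact: f0.
  transitivity (\int[leb]_x \int[area]_p g (x, p)).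
    apply: etrans (tonelli3 leb leb leb f mf f0) _; apply: eq_integral => x _.
    have mgx : measurable_fun setT (fun p => g (x, p)).
      exact: (measurableT_comp mg (@measurable_pair1 _ _ _ _ x)).
    by apply/esym; exact: (@fubini_tonelli1 _ _ _ _ _ leb leb (fun p => g (x, p))).
  exact: (@fubini_tonelli _ _ _ _ _ leb area g mg g0).
- pose g (q : (RM * RM) * RM) := f (q.1.1, q.2, q.1.2).
  have mg : measurable_fun setT g.
    apply: measurableT_comp => //; apply: measurable_pack => //.
    - exact: (measurableT_comp measurable_fst measurable_fst).
    - exact: (measurableT_comp measurable_snd measurable_fst).
  have g0 q : 0 <= g q by exact: f0.
  have mG := @measurable_fun_fubini_tonelli_F _ _ _ _ _ leb g mg g0.
  have G0 p : 0 <= fubini_F leb g p by exact: integral_ge0.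
  apply: etrans (tonelli3 leb leb leb f mf f0) _.
  apply: etrans _ (esym (@fubini_tonelli1 _ _ _ _ _ leb leb (fubini_F leb g) mG G0)).
  apply: eq_integral => x _.
  have mfx : measurable_fun setT (fun p : RM * RM => f (x, p.1, p.2)).
    by apply: measurableT_comp => //; exact: measurable_pack.
  exact: (@fubini_tonelli _ _ _ _ _ leb leb (fun p => f (x, p.1, p.2)) mfx (fun=> f0 _)).
- apply: etrans (@fubini_tonelli1 _ _ _ _ _ area leb f mf f0) _.
  by apply: eq_integral => -[x y].
Qed.

Lemma integral_volume_ins i (f : space3 R -> \bar R) :
  (@volume R).-integrable setT f ->
  (\int[@volume R]_x f x = \int[area]_p \int[leb]_s f (ins i s p)).
Proof.
move=> intf; have mf := measurable_int _ intf.
have mp := measurable_funepos mf.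
have mn := measurable_funeneg mf.
pose g (q : (RM * RM) * RM) := f (ins i q.2 q.1).
have mg : measurable_fun setT g by exact: (measurableT_comp mf (measurable_ins i)).
have mgp := measurable_funepos mg.
have mgn := measurable_funeneg mg.
have ig : (area \x leb).-integrable setT g.
  apply/(@integrable12ltyP _ _ _ _ _ area leb g mg).
  have := tonelli_ins i (abse \o f) (measurableT_comp (@abse_measurable R setT) mf) (fun=> abse_ge0 _).
  by move=> <-; case/integrableP : intf.
pose phi (q : (RM * RM) * RM) : space3 R := ins i q.2 q.1.
have tonelli_phi (h : space3 R -> \bar R) : measurable_fun setT h ->
    (forall x, 0 <= h x) ->
    \int[@volume R]_x h x = \int[area \x leb]_q (h \o phi) q.
  move=> mh h0; have mhp := measurableT_comp mh (measurable_ins i).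
  have t2 := @fubini_tonelli1 _ _ _ _ _ area leb _ mhp (fun q => h0 (phi q)).
  by apply: etrans (tonelli_ins i h mh h0) _; apply: etrans _ (esym t2).
have ep := tonelli_phi f^\+ mp (fun x => funepos_ge0 f x).
have en := tonelli_phi f^\- mn (fun x => funeneg_ge0 f x).
have e : \int[@volume R]_x f x = \int[area \x leb]_q g q.
  rewrite integralE ep en -(funepos_comp f phi) -(funeneg_comp f phi).
  by apply/esym; exact: integralE.
apply: etrans e _; apply/esym.
exact: (@integral12_prod_meas1 _ _ _ _ _ area leb g ig).
Qed.

Lemma tonelli_plane i (b : RM) (f : space3 R -> \bar R) :
  measurable_fun setT f -> (forall x, 0 <= f x) ->
  \int[plane_area b (val i)]_x f x = \int[area]_p f (ins i b p).
Proof.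
move=> mf f0.
have mfb := measurableT_comp mf (measurable_insl i b).
have fb0 p : 0 <= f (ins i b p) by exact: f0.
apply: etrans _ (esym (@fubini_tonelli1 _ _ _ _ _ leb leb _ mfb fb0)).
have mF := @measurable_fun_fubini_tonelli_F _ _ _ _ _ leb f mf f0.
have F0 p : 0 <= fubini_F leb f p by exact: integral_ge0.
case: i mfb fb0 => [[|[|[|//]]] ?] mfb fb0.
- apply: etrans (tonelli3 \d_b leb leb f mf f0) _.
  have mFF := @measurable_fun_fubini_tonelli_F _ _ _ _ _ leb _ mF F0.
  by apply: etrans (integral_dirac _ measurableT mFF) _; rewrite diracT mul1e.
- apply: etrans (tonelli3 leb \d_b leb f mf f0) _; apply: eq_integral => x _.
  have mFx : measurable_fun setT (fun y => fubini_F leb f (x, y)).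
    exact: (measurableT_comp mF (@measurable_pair1 _ _ _ _ x)).
  by apply: etrans (integral_dirac _ measurableT mFx) _; rewrite diracT mul1e.
- apply: etrans (tonelli3 leb leb \d_b f mf f0) _; apply: eq_integral => x _.
  apply: eq_integral => y _.
  have mFx : measurable_fun setT (fun z => f (x, y, z)).
    exact: (measurableT_comp mf (@measurable_pair1 _ _ _ _ (x, y))).
  by apply: etrans (integral_dirac _ measurableT mFx) _; rewrite diracT mul1e.
Qed.

Lemma plane_areaE i (b : RM) (A : set (space3 R)) : measurable A ->
  plane_area b (val i) A = area (ins i b @^-1` A).
Proof.
move=> mA.
have mi : measurable (ins i b @^-1` A).
  by rewrite -[X in measurable X]setTI; exact: measurable_insl.
have mE : measurable_fun setT (EFin \o \1_A : space3 R -> \bar R).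
  by apply/measurable_EFinP; exact: measurable_indic.
have E0 (x : space3 R) : 0 <= (EFin \o \1_A : space3 R -> \bar R) x by rewrite /= lee_fin.
have := tonelli_plane i b _ mE E0.
rewrite integral_indic// setIT => ->.
have -> : (fun p => (\1_A (ins i b p))%:E) = (fun p => (\1_(ins i b @^-1` A) p)%:E :> \bar R).
  by [].
by rewrite integral_indic// setIT.
Qed.

Lemma integral_plane i (b : RM) (f : space3 R -> \bar R) :
  measurable_fun setT f -> area.-integrable setT (fun p => f (ins i b p)) ->
  (plane_area b (val i)).-integrable setT f /\
  \int[plane_area b (val i)]_x f x = \int[area]_p f (ins i b p).
Proof.
move=> mf intf; have mi := measurable_insl i b; split.
  apply/integrableP; split => //.
  rewrite tonelli_plane//; last exact: measurableT_comp.
  by case/integrableP : intf.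
have mp := measurable_funepos mf.
have mn := measurable_funeneg mf.
rewrite [LHS]integralE [RHS]integralE.
rewrite (tonelli_plane i b f^\+ mp (fun x => funepos_ge0 f x)).
rewrite (tonelli_plane i b f^\- mn (fun x => funeneg_ge0 f x)).
by rewrite (funepos_comp f (ins i b)) (funeneg_comp f (ins i b)).
Qed.

End fubini3.

(** * The divergence theorem on the cube *)

Local Notation RM R := (measurableTypeR R).
Local Notation area R := (product_measure (@lebesgue_measure R) (@lebesgue_measure R)).

Section cube_geometry.
Context {R : realType}.
Implicit Types (p : RM R * RM R) (s b : R) (x : space3 R).

Definition square : set (RM R * RM R) := `]0, 1[ `*` `]0, 1[.

Lemma squareP p : square p <-> (0 < p.1 < 1) /\ (0 < p.2 < 1).
Proof. by rewrite /square /= !in_itv. Qed.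

Lemma measurable_square : measurable square.
Proof. by apply: measurableX; exact: measurable_itv. Qed.

Lemma area_itvX (I J : interval R) : area R ([set` I] `*` [set` J]) =
  (lebesgue_measure [set` I] * lebesgue_measure [set` J])%E.
Proof. exact: product_measure1E. Qed.

Lemma coord_ins i s p : coord i (ins i s p) = s.
Proof. by case: i => [[|[|[|//]]] ?]. Qed.

Lemma coord_insP i j s p : j != i ->
  coord j (ins i s p) = p.1 \/ coord j (ins i s p) = p.2.
Proof.
by case: i => [[|[|[|//]]] ?]; case: j => [[|[|[|//]]] ?] //=; rewrite ?eqE//= => _;
  rewrite /coord /ins /=; by [left | right].
Qed.

Lemma all_coord_ins (Q : R -> Prop) i s p :
  (forall j, Q (coord j (ins i s p))) <-> [/\ Q s, Q p.1 & Q p.2].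
Proof.
pose o0 : 'I_3 := ord0; pose o1 : 'I_3 := lift ord0 ord0.
pose o2 : 'I_3 := lift ord0 (lift ord0 ord0).
split => [h|[Qs Q1 Q2] j].
  have := h o0; have := h o1; have := h o2; clear h.
  by case: i => [[|[|[|//]]] ?]; rewrite /coord /ins /=; split.
by case: i => [[|[|[|//]]] ?]; case: j => [[|[|[|//]]] ?]; rewrite /coord /ins /=.
Qed.

Lemma Omega_ins i s p : @Omega R (ins i s p) <-> 0 < s < 1 /\ square p.
Proof.
rewrite squareP /Omega /=.
have := all_coord_ins (fun y => 0 < y < 1) i s p => h.
by split => [/h[]|[? []]] //; move=> ? ?; apply/h.
Qed.

Lemma ins_line i s t p : s *: axis R i + ins i t p = ins i (s + t) p.
Proof.
by case: i => [[|[|[|//]]] ?]; rewrite /axis /ins /=; congr (_, _, _);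
  rewrite /= /GRing.scale /= ?mulr1n ?mulr0n ?mulr1 ?mulr0 ?add0r.
Qed.

Lemma ins_continuous i p : continuous (fun s => ins i s p).
Proof.
have pairc (U V : topologicalType) (f : R -> U) (g : R -> V) :
    continuous f -> continuous g -> continuous (fun s => (f s, g s)).
  by move=> cf cg s; apply: cvg_pair; [exact: cf|exact: cg].
have cc (U : topologicalType) (c : U) : continuous (fun _ : R => c).
  by move=> s; exact: cvg_cst.
have ci : continuous (fun s : R => s) by move=> s; exact: cvg_id.
by case: i => [[|[|[|//]]] ?]; rewrite /ins /=; apply: (@pairc) => //; apply: (@pairc).
Qed.

Lemma open_Omega : open (@Omega R).
Proof.
pose slab i := coord i @^-1` (`]0, 1[%classic : set R) : set (space3 R).
have oslab i : open (slab i).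
  by apply: open_comp; [move=> x _; exact: coord_continuous|exact: interval_open].
have -> : @Omega R = slab ord0 `&` slab (lift ord0 ord0) `&`
    slab (lift ord0 (lift ord0 ord0)).
  apply/seteqP; split => x; rewrite /slab /=.
    by move=> Ox; split; [split|]; rewrite in_itv; exact: Ox.
  rewrite !in_itv => -[[x0 x1] x2].
  by case=> [[|[|[|//]]] ?].
by apply: openI => //; exact: openI.
Qed.

Lemma boundary_cube x : @boundary R x -> forall i, 0 <= coord i x <= 1.
Proof.
move=> [cx _]; suff : closed [set x : space3 R | forall i, 0 <= coord i x <= 1].
  move=> /closure_id e.
  have : closure [set x : space3 R | forall i, 0 <= coord i x <= 1] x.
    apply: closure_subset cx => y /= Oy i.
    by have /andP[/ltW -> /ltW ->] := Oy i.
  by rewrite -e.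
by apply: compact_closed; [exact: norm_hausdorff|exact: compact_cube].
Qed.

Lemma boundary_ins i b p : b = 0 \/ b = 1 -> square p -> @boundary R (ins i b p).
Proof.
move=> b01 sp; split; last first.
  move=> /interior_subset /Omega_ins[+ _].
  by case: b01 => ->; rewrite ltxx ?andbF.
move=> B nB.
have := ins_continuous i p b B nB; rewrite nbhs_filterE => -[e /= e0 eB].
(* A point of the open cube at distance less than [e] from the face. *)
pose t := if b == 0 then Num.min (e / 2) (1/2) else 1 - Num.min (e / 2) (1/2).
have [m0 m1 me] : [/\ 0 < Num.min (e / 2) (1/2), Num.min (e / 2) (1/2) < 1 &
     Num.min (e / 2) (1/2) < e].
  rewrite lt_min !gt_min divr_gt0//=; split.
  - lra.
  - by apply/orP; right; lra.
  - by apply/orP; left; lra.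
exists (ins i t p); split.
  apply/Omega_ins; split => //; rewrite /t; case: ifP => _; lra.
apply: eB; rewrite /ball_ /= /t; case: b01 => ->.
  by rewrite eqxx sub0r normrN gtr0_norm.
by rewrite oner_eq0 opprB addrCA subrr addr0 gtr0_norm.
Qed.

Lemma measurable_Omega : measurable (@Omega R).
Proof. by apply: open_measurable3; exact: open_Omega. Qed.

Lemma measurable_boundary : measurable (@boundary R).
Proof.
apply: measurableD; last by apply: open_measurable3; exact: open_interior.
rewrite -[X in measurable X]setCK; apply: measurableC.
by apply: open_measurable3; apply: closed_openC; exact: closed_closure.
Qed.

Lemma volume_Omega : (@volume R (@Omega R) < +oo)%E.
Proof.
have -> : @Omega R = square `*` `]0, 1[.
  apply/seteqP; split => [[p s]|[p s] [sp /=]].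
    by move=> /(Omega_ins ord_max s p)[s01 sp]; split => //=; rewrite in_itv.
  by rewrite in_itv /= => s01; apply/(Omega_ins ord_max s p).
rewrite [X in (X < _)%E](_ : _ = (area R square * lebesgue_measure `]0%R, 1%R[)%E).
  rewrite area_itvX lebesgue_measure_itv /= lte01 sube0 !mul1e.
  by rewrite ltry.
by apply: product_measure1E; [exact: measurable_square|exact: measurable_itv].
Qed.

Lemma continuous_bounded_cube (f : space3 R -> R) : continuous f ->
  exists M : R, forall x, (forall i, 0 <= coord i x <= 1) -> `|f x| <= M.
Proof.
move=> cf.
have := @continuous_compact _ _ f _ (continuous_subspaceT cf) (compact_cube 0 1).
move=> /compact_bounded[M [Mr hM]]; exists (M + 1) => x x01.
by apply: (hM (M + 1)); [rewrite ltrDl|exists x].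
Qed.

End cube_geometry.

Section integral_msum.
Context {d} {T : measurableType d} {R : realType}.
Local Open Scope ereal_scope.

Lemma integral_msum (m_ : nat -> {measure set T -> \bar R}) N (f : T -> \bar R) :
  measurable_fun setT f ->
  (forall k : 'I_N, (m_ k).-integrable setT f) ->
  (msum m_ N).-integrable setT f /\
  \int[msum m_ N]_x f x = \sum_(k < N) \int[m_ k]_x f x.
Proof.
move=> mf fi; split.
  apply/integrableP; split => //.
  rewrite ge0_integral_measure_sum//; last exact: measurableT_comp.
  by apply: lte_sum_pinfty => k _; case/integrableP : (fi k).
rewrite integralE !ge0_integral_measure_sum//; last 2 first.
- exact: measurable_funeneg.
- exact: measurable_funepos.
rewrite -fin_num_sumeN -?big_split.
  by apply: eq_bigr => k _; rewrite [RHS]integralE.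
move=> k _; apply: integrable_fin_num => //.
exact: integrable_funeneg (fi k).
Qed.

End integral_msum.

Section surface_measure.
Context {R : realType}.
Implicit Types (p : RM R * RM R) (s b : R) (x : space3 R).

Let b01 := [set b : R | b = 0 \/ b = 1].

Lemma surface_integral (f : space3 R -> \bar R) : measurable_fun setT f ->
  (forall b i, b01 b -> (area R).-integrable setT (fun p => f (ins i b p))) ->
  (@surface R).-integrable setT f /\
  (\int[@surface R]_x f x = \sum_(i < 3) \int[area R]_p f (ins i 0%R p)
                        + \sum_(i < 3) \int[area R]_p f (ins i 1%R p))%E.
Proof.
move=> mf fi.
have half b : b01 b -> (msum (@plane_area R b) 3).-integrable setT f /\
   (\int[msum (@plane_area R b) 3]_x f x =
     \sum_(i < 3) \int[area R]_p f (ins i b p))%E.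
  move=> hb; have [] := @integral_msum _ _ _ (@plane_area R b) 3 f mf.
    by move=> k; have [] := integral_plane k b f mf (fi b k hb).
  move=> h1 ->; split=> //; apply: eq_bigr => k _.
  by have [_ ->] := integral_plane k b f mf (fi b k hb).
have [i0 e0] := half 0 (or_introl erefl).
have [i1 e1] := half 1 (or_intror erefl).
split.
  apply/integrableP; split => //.
  rewrite ge0_integral_measure_add//; last exact: measurableT_comp.
  have [_ l0] := integrableP _ _ _ i0; have [_ l1] := integrableP _ _ _ i1.
  exact: lte_add_pinfty l0 l1.
by rewrite (integral_measure_add measurableT i0 i1) e0 e1.
Qed.

Lemma surface_boundary : (@surface R (@boundary R) < +oo)%E.
Proof.
rewrite [X in (X < _)%E](measure_addE _ _ _).
have half b : (msum (@plane_area R b) 3 (@boundary R) < +oo)%E.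
  rewrite /msum; apply: lte_sum_pinfty => i _.
  rewrite plane_areaE; last exact: measurable_boundary.
  apply: (@le_lt_trans _ _ (area R (`[0, 1] `*` `[0, 1])%classic)).
    apply: le_measure; rewrite ?inE.
    - rewrite -[X in measurable X]setTI; apply: measurable_insl => //.
      exact: measurable_boundary.
    - by apply: measurableX; exact: measurable_itv.
    - move=> p /= /boundary_cube.
      have /= h := all_coord_ins (fun y => 0 <= y <= 1) i b p.
      by move=> /h[_ h1 h2]; rewrite !in_itv.
  rewrite area_itvX lebesgue_measure_itv /= lte01 sube0 !mul1e.
  by rewrite ltry.
exact: (lte_add_pinfty (half 0) (half 1)).
Qed.

(** Off the edges, a point of a face has a single non-zero normal component, and
    the faces can be integrated separately. *)
Lemma ae_area_noedge : {ae area R, forall p,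
  [/\ p.1 != 0, p.1 != 1, p.2 != 0 & p.2 != 1]}.
Proof.
have n1 (c : R) : {ae area R, forall p, p.1 != c}.
  exists ([set c] `*` setT); split.
  - by apply: measurableX.
  - have e := @product_measure1E _ _ _ _ _ (@lebesgue_measure R) (@lebesgue_measure R)
      [set c] setT (measurable_set1 c) measurableT.
    by apply: etrans e _; apply: etrans (congr1 (fun y => y * _)%E (lebesgue_measure_set1 c)) _;
      rewrite mul0e.
  - by move=> p /= /negP; rewrite negbK => /eqP.
have n2 (c : R) : {ae area R, forall p, p.2 != c}.
  exists (setT `*` [set c]); split.
  - by apply: measurableX.
  - have e := @product_measure1E _ _ _ _ _ (@lebesgue_measure R) (@lebesgue_measure R)
      setT [set c] measurableT (measurable_set1 c).
    by apply: etrans e _; apply: etrans (congr1 (fun y => _ * y)%E (lebesgue_measure_set1 c)) _;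
      rewrite mule0.
  - by move=> p /= /negP; rewrite negbK => /eqP.
near=> p; split; near: p; [exact: n1|exact: n1|exact: n2|exact: n2].
Unshelve. all: by end_near. Qed.

Lemma measurable_normal i : measurable_fun setT (@normal R i).
Proof.
have mc : measurable_fun setT (@Defs.coord R i).
  by apply: continuous_measurable3; exact: coord_continuous.
rewrite /normal; apply: measurable_fun_ifT => //.
  exact: (measurable_fun_eqr mc).
apply: measurable_fun_ifT => //; exact: (measurable_fun_eqr mc).
Qed.

Lemma normal_le1 i x : `|@normal R i x| <= 1.
Proof.
by rewrite /normal; case: ifP => _; rewrite ?normrN1//; case: ifP => _;
  rewrite ?normr1// normr0.
Qed.

Lemma integrable_square (f : RM R * RM R -> R) (M : R) :
  measurable_fun setT f -> (forall p, square p -> `|f p| <= M) ->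
  (area R).-integrable square (EFin \o f).
Proof.
move=> mf fM; apply: measurable_bounded_integrable.
- exact: measurable_square.
- rewrite [X in (X < _)%E]area_itvX lebesgue_measure_itv /= lte01 sube0 !mul1e.
  by rewrite ltry.
- exact: measurable_funTS.
- exists M; split; first exact: num_real.
  by move=> y My p sp; apply: le_trans (fM p sp) (ltW My).
Qed.

Lemma measurable_face (F : space3 R -> R) i b : continuous F ->
  measurable_fun setT (fun p => F (ins i b p)).
Proof.
by move=> /continuous_measurable3 mF; exact: (measurableT_comp mF (measurable_insl i b)).
Qed.

Lemma square_cube i b p : 0 <= b <= 1 -> square p ->
  forall j, 0 <= Defs.coord j (ins i b p) <= 1.
Proof.
move=> hb /squareP[/andP[h1 h2] /andP[h3 h4]].
have h := all_coord_ins (fun y => 0 <= y <= 1) i b p; apply/h; split => //.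
- by rewrite !ltW.
- by rewrite !ltW.
Qed.

(** Only the two faces orthogonal to axis [i] see the component [i] of the
    normal, with opposite signs. *)
Lemma boundary_flux i (F : space3 R -> R) : continuous F ->
  (@surface R).-integrable (@boundary R) (fun x => (F x * normal i x)%:E) /\
  \int[@surface R]_(x in @boundary R) (F x * normal i x) =
  \int[area R]_(p in square) (F (ins i 1 p) - F (ins i 0 p)).
Proof.
move=> cF; have [M FM] := continuous_bounded_cube F cF.
have M0 : 0 <= M.
  have := @boundary_ins R ord0 0 (1/2, 1/2) (or_introl erefl).
  case; first by apply/squareP => /=; split; lra.
  by move=> _ _; have := FM (ins ord0 0 (1/2,1/2)); move=> h; apply: le_trans (h _) => //;
     apply: square_cube => //; [lra|apply/squareP => /=; split; lra].
pose fr := (fun x => F x * normal i x) \_ (@boundary R).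
have mF := continuous_measurable3 F cF.
have mfr : measurable_fun setT fr.
  apply/(measurable_restrictT _ measurable_boundary).
  apply: measurable_funTS; apply: measurable_funM => //.
  exact: measurable_normal.
pose f := EFin \o fr : space3 R -> \bar R.
have mf : measurable_fun setT f by apply/measurable_EFinP.
pose sq1 := (`[0, 1] `*` `[0, 1])%classic : set (RM R * RM R).
have msq1 : measurable sq1 by apply: measurableX; exact: measurable_itv.
have fi b j : b01 b -> (area R).-integrable setT (fun p => f (ins j b p)).
  move=> hb.
  have e : (fun p => f (ins j b p)) = (EFin \o (fun p => fr (ins j b p))) \_ sq1.
    apply/funext => p; rewrite /patch; case: ifPn => //.
    rewrite notin_setE => np; rewrite /f /fr /patch /= memNset// => /boundary_cube h.
    apply: np; have h' := all_coord_ins (fun y => 0 <= y <= 1) j b p.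
    by have /h'[_ h1 h2] := h; rewrite /sq1 /= !in_itv.
  rewrite e; apply/(integrable_mkcond _ msq1).
  apply: measurable_bounded_integrable => //.
  - rewrite [X in (X < _)%E]area_itvX lebesgue_measure_itv /= lte01 sube0 !mul1e.
    by rewrite ltry.
  - apply: measurable_funTS.
    exact: (measurableT_comp mfr (measurable_insl j b)).
  - exists M; split; first exact: num_real.
    move=> y My p _ /=; apply: le_trans (ltW My).
    rewrite /fr /patch; case: ifPn => [|_]; last by rewrite normr0.
    rewrite inE => /boundary_cube /FM h.
    by rewrite normrM -[leRHS]mulr1 ler_pM// normal_le1.
pose h (b : R) (j : 'I_3) := (fun p : RM R * RM R => (if j == i then (if b == 0 then -1 else 1) * F (ins i b p)
   else 0)) \_ square.
have mh b j : measurable_fun setT (h b j).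
  apply/(measurable_restrictT _ measurable_square); apply: measurable_funTS.
  case: (j == i) => //; apply: (measurable_funM (f := cst (if b == 0 then -1 else 1))) => //.
  exact: measurable_face.
have fh b j : b01 b ->
  (\int[area R]_p f (ins j b p) = \int[area R]_p (h b j p)%:E)%E.
  move=> hb; apply: ae_eq_integral => //.
  - exact: (measurableT_comp mf (measurable_insl j b)).
  - exact/measurable_EFinP.
  - apply: filterS ae_area_noedge => p [p10 p11 p20 p21] _.
    rewrite /f /fr /h /patch /=; have [sp|sp] := pselect (square p).
      rewrite (mem_set sp) mem_set; last exact: boundary_ins.
      congr (_%:E); have [<-|ji] := eqVneq j i.
        rewrite /normal coord_ins mulrC.
        by case: hb => ->; rewrite ?eqxx// oner_eq0.
      have ij : i != j by rewrite eq_sym.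
      by rewrite /normal; have [->|->] := @coord_insP R j i b p ij;
        rewrite ?(negbTE p10) ?(negbTE p11) ?(negbTE p20) ?(negbTE p21) mulr0.
    rewrite (memNset sp) memNset// => /boundary_cube bc; apply: sp.
    have h' := all_coord_ins (fun y => 0 <= y <= 1) j b p.
    have /h'[_ /andP[h1 h2] /andP[h3 h4]] := bc.
    by apply/squareP; rewrite !lt_neqAle eq_sym p10 h1 p11 h2 eq_sym p20 h3 p21 h4.
have [intf ef] := surface_integral f mf fi.
split.
  by apply/(integrable_mkcond _ measurable_boundary); rewrite restrict_EFin.
have sumh b : b01 b -> (\sum_(j < 3) \int[area R]_p f (ins j b p) =
   (\int[area R]_(p in square) ((if b == 0 then -1 else 1) * F (ins i b p)))%:E)%E.
  move=> hb; rewrite (bigD1 i)//= big1 ?adde0; last first.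
    move=> j /negbTE ji; rewrite (fh b j hb) /h ji.
    by apply: integral0_eq => p _; rewrite /patch; case: ifP.
  rewrite (fh b i hb) /h eqxx /Rintegral fineK.
    by rewrite [RHS]integral_mkcond; apply: eq_integral => p _; rewrite restrict_EFin.
  apply: integrable_fin_num; first exact: measurable_square.
  apply: (integrable_square _ M).
    apply: (measurable_funM (f := cst (if b == 0 then -1 else 1))) => //.
    exact: measurable_face.
  move=> p sp; rewrite normrM; have -> : `|(if b == 0 then -1 else 1 : R)| = 1.
    by case: ifP => _; rewrite ?normrN1 ?normr1.
  rewrite mul1r; apply: FM; apply: square_cube => //.
  by case: hb => ->; rewrite ?ler01 lexx.
rewrite [LHS]Rintegral_mkcond -/fr /Rintegral -/f ef (sumh 0 (or_introl erefl)) (sumh 1 (or_intror erefl)).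
rewrite eqxx oner_eq0 -EFinD /= addrC.
have iF b : b01 b -> (area R).-integrable square (EFin \o (fun p => F (ins i b p))).
  move=> hb; apply: (integrable_square _ M); first exact: measurable_face.
  move=> p sp; apply: FM; apply: square_cube => //.
  by case: hb => ->; rewrite ?ler01 lexx.
rewrite [RHS]RintegralB//; [|exact: measurable_square|exact: (iF 1 (or_intror erefl))|exact: (iF 0 (or_introl erefl))].
congr (_ + _); first by apply: eq_Rintegral => p _; rewrite mul1r.
have e0 := @RintegralZl _ _ _ (area R) square _ (-1) measurable_square (iF 0 (or_introl erefl)).
rewrite mulN1r in e0; exact: e0.
Qed.

(** The fundamental theorem of calculus on each line parallel to axis [i]. *)
Lemma volume_flux i (W : space3 R -> R) : continuous W ->
  continuous ('D_(axis R i) W) -> (forall x, derivable W x (axis R i)) ->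
  \int[@volume R]_(x in @Omega R) ('D_(axis R i) W x) =
  \int[area R]_(p in square) (W (ins i 1 p) - W (ins i 0 p)).
Proof.
move=> cW cD dW; set D := 'D_(axis R i) W.
have mD := continuous_measurable3 D cD.
have [M DM] := continuous_bounded_cube D cD.
have iD : (@volume R).-integrable (@Omega R) (EFin \o D).
  apply: measurable_bounded_integrable.
  - exact: measurable_Omega.
  - exact: volume_Omega.
  - exact: measurable_funTS.
  - exists M; split; first exact: num_real.
    move=> y My x Ox /=; apply: le_trans (ltW My); apply: DM => j.
    by have /andP[/ltW -> /ltW ->] := Ox j.
have iD' : (@volume R).-integrable setT ((EFin \o D) \_ (@Omega R)).
  by apply/(integrable_mkcond _ measurable_Omega).
rewrite /Rintegral [in LHS]integral_mkcond (integral_volume_ins i _ iD').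
congr fine; rewrite [RHS]integral_mkcond; apply: eq_integral => p _.
rewrite [RHS]patchE; case: ifPn; rewrite ?inE ?notin_setE => sp; last first.
  apply: integral0_eq => s _; rewrite patchE memNset//.
  by move=> /Omega_ins[_].
have -> : (fun s : RM R => ((EFin \o D) \_ (@Omega R)) (ins i s p)) =
    (fun s : RM R => (D (ins i s p))%:E) \_ `]0, 1[.
  apply/funext => s; rewrite !patchE; congr (if _ then _ else _).
  apply/idP/idP; rewrite !inE /= in_itv /=; first by move=> /Omega_ins[].
  by move=> s01; apply/Omega_ins.
rewrite -integral_mkcond.
have cDs : continuous (fun s : R => D (ins i s p)).
  by move=> s; exact: (@continuous_comp _ _ _ (fun s => ins i s p) D s (ins_continuous i p s) (cD _)).
have dWs (s : R) : is_derive s 1 (fun t : R => W (ins i t p)) (D (ins i s p)).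
  have : is_derive (ins i s p) (axis R i) W (D (ins i s p)) by exact: DeriveDef.
  move=> /is_derive_line; rewrite -(subrr s) => dU.
  have dsh : is_derive s 1 (fun t : R => t - s) 1.
    have -> : (fun t : R => t - s) = id + cst (- s) by apply/funext.
    apply: (is_derive_eq (is_deriveD (is_derive_id s 1) (is_derive_cst (- s) s 1))).
    by rewrite addr0.
  have := @is_derive1_comp _ _ (fun t => t - s) s _ _ dU dsh.
  rewrite mulr1; congr (is_derive _ _ _ _).
  by apply/funext => t /=; rewrite ins_line subrK.
rewrite -(integral_itv_bndoo true false); last first.
  by apply/measurable_EFinP; apply: measurable_funTS; exact: continuous_measurable_fun.
rewrite (@continuous_FTC2 _ (fun s => D (ins i s p)) (fun s => W (ins i s p)))//.
- exact: continuous_subspaceT.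
- have cWs : continuous (fun s : R => W (ins i s p)).
    by move=> s; exact: (@continuous_comp _ _ _ (fun s => ins i s p) W s (ins_continuous i p s) (cW _)).
  split; first by move=> s _; case: (dWs s).
  + apply: cvg_at_right_filter; exact: cWs.
  + apply: cvg_at_left_filter; exact: cWs.
- by move=> s _; rewrite derive1E; case: (dWs s).
Qed.

Theorem divergence_cube i (W : space3 R -> R) : continuous W ->
  continuous ('D_(axis R i) W) -> (forall x, derivable W x (axis R i)) ->
  \int[@volume R]_(x in @Omega R) ('D_(axis R i) W x) =
  \int[@surface R]_(x in @boundary R) (W x * normal i x).
Proof.
by move=> cW cD dW; rewrite volume_flux//; have [_ ->] := boundary_flux i W cW.
Qed.

End surface_measure.

(** * Pairings and traces *)

Section pairing.
Context {R : realType}.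
Implicit Types (v w g : space3 R -> R).

Definition ip v g : R := \int[@volume R]_(x in @Omega R) (v x * g x).

Let mO := @measurable_Omega R.
Let vO := @volume_Omega R.

Lemma ip_integrable v g : L2 v -> L2 g ->
  (@volume R).-integrable (@Omega R) (fun x => (v x * g x)%:E).
Proof. exact: Lp2_integrableM. Qed.

Lemma ipD v w g : L2 v -> L2 w -> L2 g ->
  ip (fun x => v x + w x) g = ip v g + ip w g.
Proof.
move=> Lv Lw Lg; rewrite /ip -RintegralD//; try exact: ip_integrable.
by apply: eq_Rintegral => x _; rewrite mulrDl.
Qed.

Lemma ipZ (a : R) v g : L2 v -> L2 g -> ip (fun x => a * v x) g = a * ip v g.
Proof.
move=> Lv Lg; rewrite /ip -RintegralZl//; try exact: ip_integrable.
by apply: eq_Rintegral => x _; rewrite mulrA.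
Qed.

Lemma ipZr (a : R) v g : L2 v -> L2 g -> ip v (fun x => a * g x) = a * ip v g.
Proof.
move=> Lv Lg; rewrite /ip -RintegralZl//; try exact: ip_integrable.
by apply: eq_Rintegral => x _; rewrite mulrCA.
Qed.

Lemma L2_sum n (v : 'I_n -> space3 R -> R) : (forall i, L2 (v i)) ->
  L2 (fun x => \sum_(i < n) v i x).
Proof. exact: Lp2_sum. Qed.

Lemma ip_sum n (v : 'I_n -> space3 R -> R) g : (forall i, L2 (v i)) -> L2 g ->
  ip (fun x => \sum_(i < n) v i x) g = \sum_(i < n) ip (v i) g.
Proof.
move=> + Lg; elim: n v => [|n IH] v Lv.
  rewrite big_ord0 /ip; under eq_Rintegral do rewrite big_ord0 mul0r.
  by rewrite Rintegral_cst// mul0r.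
rewrite big_ord_recr /= -IH// -ipD//; last exact: L2_sum.
by apply: eq_Rintegral => x _; rewrite big_ord_recr.
Qed.

Lemma ip_ae v w g : L2 v -> L2 w -> L2 g ->
  {ae @volume R, forall x, @Omega R x -> v x = w x} -> ip v g = ip w g.
Proof.
move=> Lv Lw Lg vw; rewrite /ip /Rintegral; congr fine; apply: ae_eq_integral => //.
- by have /integrableP[] := ip_integrable v g Lv Lg.
- by have /integrableP[] := ip_integrable w g Lw Lg.
- by apply: filterS vw => x h Ox; rewrite h.
Qed.

Lemma smoothP v : smooth v -> [/\ continuous v,
  (forall i, continuous ('D_(axis R i) v)) & forall i x, derivable v x (axis R i)].
Proof.
by move=> sv; split; [case: (sv [::])|move=> i; case: (sv [:: i])|case: (sv [::])].
Qed.

Lemma continuous_L2 v : continuous v -> L2 v.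
Proof.
move=> cv; have [M vM] := continuous_bounded_cube v cv.
apply: (Lp2_bounded _ _ mO vO _ M).
  by apply: measurable_funTS; exact: continuous_measurable3.
by move=> x Ox; apply: vM => i; have /andP[/ltW -> /ltW ->] := Ox i.
Qed.

Lemma continuous_L2_boundary v : continuous v ->
  Lp (@surface R) (@boundary R) 2%:E v.
Proof.
move=> cv; have [M vM] := continuous_bounded_cube v cv.
apply: (Lp2_bounded _ _ measurable_boundary surface_boundary _ M).
  by apply: measurable_funTS; exact: continuous_measurable3.
by move=> x /boundary_cube; exact: vM.
Qed.

Lemma continuous_normal_L2_boundary v i : continuous v ->
  Lp (@surface R) (@boundary R) 2%:E (fun x => v x * normal i x).
Proof.
move=> cv; have [M vM] := continuous_bounded_cube v cv.
apply: (Lp2_bounded _ _ measurable_boundary surface_boundary _ M).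
  apply: measurable_funTS; apply: measurable_funM; first exact: continuous_measurable3.
  exact: measurable_normal.
move=> x /boundary_cube /vM h; rewrite normrM -[leRHS]mulr1.
by rewrite ler_pM// normal_le1.
Qed.

(** The divergence theorem applied to [v_n g], for the smooth [v_n] that define
    the trace; the three convergences in the definition of the trace are exactly
    what the three integrals need. *)
Lemma trace_parts v w g i : is_trace v w -> smooth g ->
  ip (partial i v) g + ip v ('D_(axis R i) g) =
  \int[@surface R]_(x in @boundary R) (w x * (g x * normal i x)).
Proof.
move=> [[Lv H1v] Lw [v_ [sv vv dvv wv]]] sg.
have [cg cdg dg] := smoothP g sg.
have [_ Lpv _] := H1v i.
have key n : ip ('D_(axis R i) (v_ n)) g + ip (v_ n) ('D_(axis R i) g) =
    \int[@surface R]_(x in @boundary R) (v_ n x * (g x * normal i x)).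
  have [cv cdv dv] := smoothP (v_ n) (sv n).
  have cW : continuous (fun x => v_ n x * g x).
    by move=> x; apply: cvgM; [exact: cv|exact: cg].
  have DW : 'D_(axis R i) (fun x => v_ n x * g x) =
     (fun x => 'D_(axis R i) (v_ n) x * g x + v_ n x * 'D_(axis R i) g x).
    apply/funext => x; apply: etrans (deriveM (dv i x) (dg i x)) _.
    by rewrite addrC mulrC; congr (_ + _); rewrite mulrC.
  have cDW : continuous ('D_(axis R i) (fun x => v_ n x * g x)).
    rewrite DW => x; apply: cvgD.
      by apply: cvgM; [exact: cdv|exact: cg].
    by apply: cvgM; [exact: cv|exact: cdg].
  have dW x : derivable (fun x => v_ n x * g x) x (axis R i).
    by apply: derivableM.
  have := divergence_cube i _ cW cDW dW; rewrite DW RintegralD//; last 2 first.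
  - exact: (ip_integrable _ _ (continuous_L2 _ (cdv i)) (continuous_L2 _ cg)).
  - exact: (ip_integrable _ _ (continuous_L2 _ cv) (continuous_L2 _ (cdg i))).
  by move=> ->; apply: eq_Rintegral => x _; rewrite mulrA.
have Lvn n : L2 (v_ n) by apply: continuous_L2; case: (smoothP _ (sv n)).
have Ldvn n : L2 ('D_(axis R i) (v_ n)).
  by apply: continuous_L2; case: (smoothP _ (sv n)).
have c1 : ip ('D_(axis R i) (v_ n)) g @[n --> \oo] --> ip (partial i v) g.
  exact: (Lp2_cvg _ _ mO _ _ _ _ _ (nearW _ Ldvn) Lpv (continuous_L2 g cg) (dvv i)).
have c2 : ip (v_ n) ('D_(axis R i) g) @[n --> \oo] --> ip v ('D_(axis R i) g).
  exact: (Lp2_cvg _ _ mO _ _ _ _ _ (nearW _ Lvn) Lv (continuous_L2 _ (cdg i)) vv).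
have c3 : \int[@surface R]_(x in @boundary R) (v_ n x * (g x * normal i x))
    @[n --> \oo] --> \int[@surface R]_(x in @boundary R) (w x * (g x * normal i x)).
  apply: (Lp2_cvg _ _ measurable_boundary) => //.
    by apply: nearW => n; apply: continuous_L2_boundary; case: (smoothP _ (sv n)).
  exact: continuous_normal_L2_boundary.
rewrite -(cvg_lim _ c3)//; apply/esym/cvg_lim => //.
by under eq_cvg do rewrite -key; exact: cvgD c1 c2.
Qed.

End pairing.

(** * Green's formula for the Lame operator *)

Section weak_derivatives.
Context {R : realType}.
Implicit Types (v w g : space3 R -> R).

Lemma test_function_L2 g : test_function g -> L2 g.
Proof. by move=> [sg _]; apply: continuous_L2; case: (smoothP g sg). Qed.

Lemma weak_partialE i v w g : weak_partial i v w -> test_function g ->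
  ip w g = - ip v ('D_(axis R i) g).
Proof. by move=> [_ _ h] /h; rewrite /ip => ->; rewrite opprK. Qed.

Lemma partialP i v w : weak_partial i v w -> weak_partial i v (partial i v).
Proof. by move=> h; apply: getPex; exists w. Qed.

Lemma weak_partial_sum n i (v w : 'I_n -> space3 R -> R) :
  (forall k, weak_partial i (v k) (w k)) ->
  weak_partial i (fun x => \sum_(k < n) v k x) (fun x => \sum_(k < n) w k x).
Proof.
move=> h; have Lv k : L2 (v k) by case: (h k).
have Lw k : L2 (w k) by case: (h k).
split; [exact: L2_sum|exact: L2_sum|move=> g tg].
have Lg := test_function_L2 g tg.
have Ldg : L2 ('D_(axis R i) g).
  by case: tg => sg _; apply: continuous_L2; case: (smoothP g sg).
rewrite -!/(ip _ _) !ip_sum// -sumrN; apply: eq_bigr => k _.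
by rewrite (weak_partialE _ _ _ _ (h k) tg) opprK.
Qed.

(** Carries identities tested against compactly supported functions over to the
    exponentials, which are not compactly supported. *)
Lemma expo_cut_cvg v eta : L2 v ->
  ip v (expo_cut eta n) @[n --> \oo] --> ip v (expo eta).
Proof.
move=> Lv; have se := smooth_expo eta; have [ce _ _] := smoothP _ se.
have Le := continuous_L2 _ ce.
have iM := ip_integrable v (expo eta) Lv Le.
have mv := Lp2_measurable _ _ measurable_Omega _ Lv.
have sc n : continuous (expo_cut eta n).
  by have [] := smoothP _ (smooth_tens _ (Cinfty_expo_cut eta n)).
rewrite /ip; apply: (Rintegral_dominated_cvg _ _ measurable_Omega _ _
  (fun x => `|v x * expo eta x|)).
- move=> n; apply: measurable_funM => //; apply: measurable_funTS.
  exact: continuous_measurable3.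
- move=> x Ox; have c1 : \prod_(i < 3) cutoff n (coord i x) @[n --> \oo] --> (1 : R).
    under eq_cvg do rewrite !big_ord_recl big_ord0 mulr1.
    have <- : 1 * (1 * 1) = 1 :> R by rewrite !mulr1.
    by apply: cvgM; [|apply: cvgM]; exact: cutoff_cvg.
  have -> : v x * expo eta x = v x * (expo eta x * 1) by rewrite mulr1.
  by apply: cvgMr; under eq_cvg do rewrite expo_cutE; exact: cvgMr.
- exact: (integrable_norm iM).
- move=> n x Ox; rewrite expo_cutE mulrA normrM ler_piMr//.
  rewrite ger0_norm ?prodr_ge0// => [|i _]; last exact: cutoff_ge0.
  by rewrite prodr_ile1// => i _; rewrite cutoff_ge0 cutoff_le1.
Qed.

End weak_derivatives.

Lemma sum_delta {R : realType} (j : 'I_3) (F : 'I_3 -> R) :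
  \sum_(k < 3) (j == k)%:R * F k = F j.
Proof.
rewrite (bigD1 j)//= eqxx mul1r big1 ?addr0// => k /negbTE.
by rewrite eq_sym => ->; rewrite mul0r.
Qed.

(** The identity [div stress = mu laplacian u + (la + mu) grad div u], where
    [A i j k] stands for the derivative of [u_j] in directions [i] and [k]. *)
Lemma stress_algebra {R : realType} (la mu : R) (A : 'I_3 -> 'I_3 -> 'I_3 -> R) j :
  (forall i k l, A i k l = A l k i) ->
  \sum_(k < 3) (la * (j == k)%:R * (\sum_(i < 3) A i i k) + mu * (A k j k + A j k k))
  = mu * \sum_(i < 3) A i j i + (la + mu) * \sum_(i < 3) A i i j.
Proof.
move=> A_sym; rewrite big_split /= -mulr_sumr big_split /=.
under [X in X + _]eq_bigr do rewrite -mulrA.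
rewrite -mulr_sumr sum_delta.
have -> : \sum_(k < 3) A j k k = \sum_(k < 3) A k k j.
  by apply: eq_bigr => k _; rewrite A_sym.
ring.
Qed.

(** The same identity for the symbols: each derivative is replaced by the
    component of [eta] in its direction. *)
Lemma stress_expo_algebra {R : realType} (la mu : R) (eta U : 'I_3 -> R) j :
  \sum_(k < 3) eta k * (la * (j == k)%:R * (\sum_(i < 3) eta i * U i)
     + mu * (eta k * U j + eta j * U k)) =
  mu * (\sum_(k < 3) eta k ^+ 2) * U j + (la + mu) * eta j * (\sum_(k < 3) eta k * U k).
Proof.
transitivity (\sum_(k < 3) (j == k)%:R * (eta k * (la * \sum_(i < 3) eta i * U i)) +
   \sum_(k < 3) (mu * U j * eta k ^+ 2 + mu * eta j * (eta k * U k))).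
  by rewrite -big_split; apply: eq_bigr => k _ /=; ring.
by rewrite sum_delta big_split /= -!mulr_sumr; ring.
Qed.

Section green_formula.
Context {R : realType}.
Variables (la mu : R) (u : vector_field R) (sigma : 'I_3 -> 'I_3 -> space3 R -> R).
Hypothesis H2u : forall j, H2 (u j).
Hypothesis u0 : forall j, is_trace (u j) (cst 0).
Hypothesis Su : forall j k, is_trace (stress la mu u j k) (sigma j k).
Variable eta : 'I_3 -> R.

Let e := expo eta.
Let U j := ip (u j) e.

Let Lu j : L2 (u j). Proof. by have [[]] := H2u j. Qed.
Let wu j i : weak_partial i (u j) (partial i (u j)).
Proof. by have [[_ h] _] := H2u j; exact: h. Qed.
Let Ldu j i : L2 (partial i (u j)). Proof. by have [_ h _] := wu j i. Qed.
Let wdu j i k : weak_partial k (partial i (u j)) (partial k (partial i (u j))).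
Proof. by have [_ /(_ i) [_ h]] := H2u j; exact: h. Qed.
Let Lddu j i k : L2 (partial k (partial i (u j))).
Proof. by have [_ h _] := wdu j i k. Qed.

Let Ldiv : L2 (div u). Proof. exact: L2_sum. Qed.

Let wdiv j : weak_partial j (div u) (partial j (div u)).
Proof.
apply: (partialP _ _ (fun x => \sum_(i < 3) partial j (partial i (u i)) x)).
exact: weak_partial_sum.
Qed.

Let Llap j : L2 (laplacian (u j)). Proof. exact: L2_sum. Qed.

Definition lame_operator j x := mu * laplacian (u j) x + (la + mu) * partial j (div u) x.

Lemma L2_lame_operator j : L2 (lame_operator j).
Proof.
apply: Lp2D; apply: Lp2Z; first exact: Llap.
by have [_ h _] := wdiv j.
Qed.

Let stressE j k : stress la mu u j k = (fun x => la * (j == k)%:R * div u x +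
  mu * (partial k (u j) x + partial j (u k) x)).
Proof.
apply/funext => x; rewrite /stress; case: eqVneq => [->|_].
  by rewrite mulr1 mulrDr -mulrA mulr2n mulrDl mul1r.
by rewrite mulr0 mul0r add0r.
Qed.

Let ip_stress j k g : L2 g -> ip (stress la mu u j k) g =
  la * (j == k)%:R * ip (div u) g + mu * (ip (partial k (u j)) g + ip (partial j (u k)) g).
Proof.
move=> Lg; rewrite stressE ipD//; last 2 first.
- exact: Lp2Z.
- by apply: Lp2Z; apply: Lp2D.
by rewrite ipZ// ipZ ?ipD//; exact: Lp2D.
Qed.

Let ip_div g : L2 g -> ip (div u) g = \sum_(i < 3) ip (partial i (u i)) g.
Proof. by move=> Lg; rewrite /div ip_sum. Qed.

(** Against a test function all second derivatives of [u] can be written with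
    one derivative on each factor; they commute because those of the test
    function do. *)
Let div_stress_test j n : (0 < n)%N ->
  \sum_(k < 3) ip (partial k (stress la mu u j k)) (expo_cut eta n) =
  ip (lame_operator j) (expo_cut eta n).
Proof.
move=> n0; set g := expo_cut eta n.
have tg : test_function g by exact: test_function_expo_cut.
have tdg k : test_function ('D_(axis R k) g) by exact: test_function_derive_expo_cut.
have Lg := test_function_L2 g tg.
have Ldg k := test_function_L2 _ (tdg k).
have ws k : weak_partial k (stress la mu u j k) (partial k (stress la mu u j k)).
  by have [[_ h] _ _] := Su j k; exact: h.
pose A (i j k : 'I_3) := ip (partial i (u j)) ('D_(axis R k) g).
have A_sym i k l : A i k l = A l k i.
  apply: etrans (weak_partialE _ _ _ _ (wu k i) (tdg l)) _.
  apply: etrans _ (esym (weak_partialE _ _ _ _ (wu k l) (tdg i))).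
  exact: (congr1 (fun q => - ip (u k) q) (derive_expo_cutC eta n i l)).
have e1 : ip (partial j (div u)) g = - \sum_(i < 3) A i i j.
  apply: etrans (weak_partialE _ _ _ _ (wdiv j) tg) _; congr (- _).
  exact: ip_div.
have e2 : ip (laplacian (u j)) g = - \sum_(i < 3) A i j i.
  rewrite -sumrN; apply: etrans (ip_sum _ _ _ _ Lg) _; first by move=> i.
  by apply: eq_bigr => i _; exact: (weak_partialE _ _ _ _ (wdu j i i) tg).
have Lpd : L2 (partial j (div u)) by have [] := wdiv j.
have -> : ip (lame_operator j) g =
   - (mu * \sum_(i < 3) A i j i + (la + mu) * \sum_(i < 3) A i i j).
  apply: etrans (ipD _ _ _ _ _ Lg) _; [exact: Lp2Z|exact: Lp2Z|].
  by rewrite (ipZ mu _ _ (Llap j) Lg) (ipZ _ _ _ Lpd Lg) e1 e2 !mulrN -opprD.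
have -> : \sum_(k < 3) ip (partial k (stress la mu u j k)) g =
   - \sum_(k < 3) (la * (j == k)%:R * (\sum_(i < 3) A i i k) + mu * (A k j k + A j k k)).
  rewrite -sumrN; apply: eq_bigr => k _.
  apply: etrans (weak_partialE _ _ _ _ (ws k) tg) _; congr (- _).
  apply: etrans (ip_stress _ _ _ (Ldg k)) _; congr (_ * _ + _).
  exact: ip_div.
by congr (- _); exact: stress_algebra.
Qed.

Let sme := smooth_expo eta.
Let Le : L2 e. Proof. by apply: continuous_L2; case: (smoothP _ sme). Qed.

Let div_stress j : \sum_(k < 3) ip (partial k (stress la mu u j k)) e =
  ip (lame_operator j) e.
Proof.
have Ls k : L2 (partial k (stress la mu u j k)).
  by have [[_ h] _ _] := Su j k; have [] := h k.
have c1 := expo_cut_cvg _ eta (L2_lame_operator j).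
have c2 : ip (fun x => \sum_(k < 3) partial k (stress la mu u j k) x) (expo_cut eta n)
    @[n --> \oo] --> ip (fun x => \sum_(k < 3) partial k (stress la mu u j k) x) e.
  by apply: expo_cut_cvg; exact: L2_sum.
rewrite -ip_sum// -(cvg_lim _ c1)//; apply/esym/cvg_lim => //.
apply: cvg_trans c2; apply: near_eq_cvg; near=> n.
have n0 : (0 < n)%N by near: n; exact: nbhs_infty_gt.
by rewrite ip_sum ?div_stress_test//; apply: test_function_L2; exact: test_function_expo_cut.
Unshelve. all: by end_near. Qed.

Let ip_derive v k : L2 v -> ip v ('D_(axis R k) e) = eta k * ip v e.
Proof.
move=> Lv; rewrite -(ipZr (eta k) _ _ Lv Le).
by apply: eq_Rintegral => x _; rewrite derive_expo.
Qed.

(** No boundary term, since [u] has trace zero. *)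
Let ip_du j k : ip (partial k (u j)) e = - (eta k * U j).
Proof.
have := trace_parts _ _ _ k (u0 j) sme; rewrite ip_derive// => h.
apply/eqP; rewrite -addr_eq0 h; apply/eqP.
under eq_Rintegral do rewrite mul0r.
by rewrite Rintegral_cst ?mul0r//; exact: measurable_boundary.
Qed.

(** The first integration by parts moves the divergence off the stress and
    leaves the surface load; the second one moves the derivatives off [u], whose
    trace is zero.  Only the symbol of the operator at [eta] remains. *)
Theorem green_formula j : ip (lame_operator j) e =
  mu * (\sum_(k < 3) eta k ^+ 2) * U j
  + (la + mu) * eta j * (\sum_(k < 3) eta k * U k)
  + \int[@surface R]_(x in @boundary R)
      ((\sum_(k < 3) sigma j k x * normal k x) * e x).
Proof.
have [ce _ _] := smoothP _ sme.
have Lsig k : Lp (@surface R) (@boundary R) 2%:E (sigma j k) by have [] := Su j k.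
have Ls k : L2 (stress la mu u j k) by have [[]] := Su j k.
have -> : \int[@surface R]_(x in @boundary R)
      ((\sum_(k < 3) sigma j k x * normal k x) * e x) =
   \sum_(k < 3) \int[@surface R]_(x in @boundary R) (sigma j k x * (e x * normal k x)).
  have ib k : (@surface R).-integrable (@boundary R)
     (EFin \o (fun x => sigma j k x * (e x * normal k x))).
    apply: (Lp2_integrableM _ _ measurable_boundary _ _ (Lsig k)).
    exact: continuous_normal_L2_boundary.
  rewrite !big_ord_recl big_ord0 addr0 -RintegralD//; [|exact: measurable_boundary].
  rewrite -RintegralD//; [|exact: measurable_boundary|].
    apply: eq_Rintegral => x _; rewrite !big_ord_recl big_ord0; ring.
  exact: (integrableD measurable_boundary (ib _) (ib _)).
rewrite -div_stress.
have -> : \sum_(k < 3) ip (partial k (stress la mu u j k)) e =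
  \sum_(k < 3) (\int[@surface R]_(x in @boundary R) (sigma j k x * (e x * normal k x))
    - eta k * ip (stress la mu u j k) e).
  apply: eq_bigr => k _; rewrite -(trace_parts _ _ _ k (Su j k) sme) ip_derive//.
  by rewrite addrK.
rewrite big_split /= addrC; congr (_ + _).
rewrite -stress_expo_algebra; apply: eq_bigr => k _.
rewrite -mulrN; congr (_ * _).
have -> : ip (stress la mu u j k) e =
    la * (j == k)%:R * (\sum_(i < 3) - (eta i * U i)) + mu * (- (eta k * U j) - eta j * U k).
  rewrite -(ip_du j k) -(ip_du k j); apply: etrans (ip_stress _ _ _ Le) _.
  congr (_ * _ + _); apply: etrans (ip_div _ Le) _.
  by apply: eq_bigr => i _; exact: ip_du.
rewrite sumrN; ring.
Qed.

End green_formula.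

(** * Forced oscillators started at rest *)

(** Makes the closure properties of filters available for statements that hold
    almost everywhere in time. *)
#[global] Instance ae_lebesgue_filter (R : realType) :
  Filter (nbhs (almost_everywhere (@lebesgue_measure R))).
Proof. exact: (ae_filter_ringOfSetsType (@lebesgue_measure R)). Qed.

Section forced_oscillator.
Context {R : realType}.
Local Notation leb := (@lebesgue_measure R).

Lemma continuous_expRN (k : R) : continuous (fun t : R => expR (- (k * t))).
Proof.
move=> t; apply: (@continuous_comp _ _ _ (fun t : R => - (k * t)) expR).
  by apply: cvgN; apply: cvgMr; exact: cvg_id.
exact: continuous_expR.
Qed.

(** The derivatives [p1] and [p2] are given as functions on the closed interval,
    because their continuity up to the end points is used, and [p] is only
    differentiated inside. *)
Definition rest_trajectory (T : R) (p p1 p2 : R -> R) : Prop :=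
  [/\ {within `[0, T], continuous p} /\ {within `[0, T], continuous p1},
      {within `[0, T], continuous p2},
      (forall t : R, 0 < t < T -> is_derive t 1 p (p1 t)),
      (forall t : R, 0 < t < T -> is_derive t 1 p1 (p2 t)) & p 0 = 0 /\ p1 0 = 0].

(** The derivative of [exp (- k t) (p' + k p)] is [exp (- k t) (p'' - k^2 p)]. *)
Lemma oscillator_weighted (T k F : R) (phi p p1 p2 : R -> R) :
  rest_trajectory T p p1 p2 -> measurable_fun `]0, T[ phi ->
  {ae leb, forall t, 0 < t < T -> p2 t = k ^+ 2 * p t + phi t * F} ->
  forall s, 0 < s <= T ->
  expR (- (k * s)) * (p1 s + k * p s) =
  \int[leb]_(t in `]0, s[) (F * (phi t * expR (- (k * t)))).
Proof.
move=> [[cp cp1] cp2 dp dp1 [p00 p10]] mphi ode s /andP[s0 sT].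
pose W t := expR (- (k * t)) * (p1 t + k * p t).
pose w t := expR (- (k * t)) * (p2 t - k ^+ 2 * p t).
have sub : `[0, s] `<=` `[0, T].
  by move=> t /=; rewrite !in_itv /= => /andP[-> /le_trans]; apply.
have cle (f : R -> R) : {within `[0, T], continuous f} -> {within `[0, s], continuous f}.
  exact: continuous_subspaceW.
have inT t : 0 < t < s -> 0 < t < T.
  by move=> /andP[-> ts]/=; exact: lt_le_trans sT.
have dE (t : R) : is_derive t 1 (fun t : R => expR (- (k * t))) (- k * expR (- (k * t))).
  have dl : is_derive t 1 (fun t : R => - (k * t)) (- k).
    have -> : (fun t : R => - (k * t)) = (- k) \*: id by apply/funext => y /=; rewrite /GRing.scale /= mulNr.
    by apply: is_derive_eq; rewrite /GRing.scale /= mulr1.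
  by rewrite (mulrC (- k)); exact: (@is_derive1_comp _ expR (fun t => - (k * t)) t _ _ _ dl).
have cE : continuous (fun t : R => expR (- (k * t))).
  exact: continuous_expRN.
have cW : {within `[0, s], continuous W}.
  move=> t; apply: cvgM; first exact: (continuous_subspaceT cE).
  by apply: cvgD; [exact: (cle _ cp1)|apply: cvgMr; exact: (cle _ cp)].
have cw : {within `[0, s], continuous w}.
  move=> t; apply: cvgM; first exact: (continuous_subspaceT cE).
  by apply: cvgB; [exact: (cle _ cp2)|apply: cvgMr; exact: (cle _ cp)].
have dW (t : R) : 0 < t < s -> is_derive t 1 W (w t).
  move=> /inT ts; have d0 := dp t ts; have d1 := dp1 t ts.
  have d2 := is_deriveD d1 (is_deriveZ k d0).
  have d3 := is_deriveM (dE t) d2.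
  apply: (is_derive_eq d3); rewrite /w /GRing.scale /= fctE /= /GRing.scale /=; ring.
have ftc : (\int[leb]_(t in `[0%R, s]) (w t)%:E = (W s)%:E - (W 0)%:E)%E.
  apply: continuous_FTC2 => //.
    have [_ W0 Ws] := (continuous_within_itvP W s0).1 cW.
    split; [|exact: W0|exact: Ws].
    by move=> t; rewrite in_itv /= => ts; case: (dW t ts).
  by move=> t; rewrite in_itv /= => ts; rewrite derive1E; case: (dW t ts).
have mw : measurable_fun `]0, s[ w.
  have h : measurable_fun `[0, s] w.
    exact: subspace_continuous_measurable_fun.
  by apply: measurable_funS h => //; apply: subset_itvW.
rewrite -[LHS]/(W s) /Rintegral.
have -> : (\int[leb]_(t in `]0%R, s[) (F * (phi t * expR (- (k * t))))%:E =
    \int[leb]_(t in `]0%R, s[) (w t)%:E)%E.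
  apply: ae_eq_integral => //.
  - apply/measurable_EFinP; apply: measurable_funM => //; apply: measurable_funM.
      by apply: measurable_funS mphi => //; move=> t /=; rewrite !in_itv /= => /inT.
    by apply: measurable_funTS; exact: continuous_measurable_fun.
  - exact/measurable_EFinP.
  - apply: filterS ode => t h; rewrite /= in_itv /= => /inT /h e.
    by congr (_%:E); rewrite /w e; ring.
rewrite -(integral_itv_bndoo true false); last exact/measurable_EFinP.
by rewrite ftc -EFinB /= /W p00 p10 mulr0 addr0 mulr0 subr0.
Qed.

(** With [k] and [- k], the weighted identity makes both [p' + k p] and
    [p' - k p] vanish. *)
Lemma free_oscillator (T k : R) (p p1 p2 : R -> R) : k != 0 ->
  rest_trajectory T p p1 p2 ->
  {ae leb, forall t, 0 < t < T -> p2 t = k ^+ 2 * p t} ->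
  forall s, 0 < s <= T -> p s = 0.
Proof.
move=> k0 rp ode s sT.
have key (l : R) : l ^+ 2 = k ^+ 2 -> p1 s + l * p s = 0.
  move=> lk; have := @oscillator_weighted T l 0 (cst 0) p p1 p2 rp
    (measurable_cst _) _ s sT.
  rewrite lk; have h : {ae leb, forall t, 0 < t < T -> p2 t = k ^+ 2 * p t + cst 0 t * 0}.
    by apply: filterS ode => t h /h ->; rewrite mulr0 addr0.
  move=> /(_ h); under eq_Rintegral do rewrite mul0r.
  rewrite Rintegral_cst// mul0r => /eqP.
  by rewrite mulf_eq0 gt_eqF ?expR_gt0//= => /eqP.
have h1 := key k erefl; have h2 := key (- k) (sqrrN k).
have : (2 * k) * p s = 0 by nra.
by move=> /eqP; rewrite mulf_eq0 mulf_eq0 pnatr_eq0 (negbTE k0) /= => /eqP.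
Qed.

(** The part over [(0, L / 2)] is at least [C L / 2] times [exp (- k L / 2)]; the
    part beyond [L], of unknown sign, is at most [exp (- k L)] times the
    integral of [|phi|], which takes at most half of that for large [k]. *)
Lemma exponential_moment_lower (T L C : R) (phi : R -> R) :
  0 < L < T -> 0 < C -> leb.-integrable `]0, T[ (EFin \o phi) ->
  {ae leb, forall t, 0 < t < L -> C <= phi t} ->
  exists k0 : R, 0 < k0 /\ forall k, k0 <= k ->
    C * L / 4 * expR (- (k * (L / 2))) <=
    \int[leb]_(t in `]0, T[) (phi t * expR (- (k * t))).
Proof.
move=> /andP[L0 LT] C0 iphi phiC.
pose N := \int[leb]_(t in `]0, T[) `|phi t|.
have N0 : 0 <= N by apply: Rintegral_ge0.
exists (8 * N / (C * L ^+ 2) + 1); split.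
  by rewrite ltr_wpDl// divr_ge0 ?mulr_ge0// ltW// ?exprn_gt0.
move=> k kk0.
have k_gt0 : 0 < k.
  by apply: lt_le_trans kk0; rewrite ltr_wpDl// divr_ge0 ?mulr_ge0// ltW// ?exprn_gt0.
have mphi : measurable_fun `]0, T[ phi.
  by apply/measurable_EFinP; exact: measurable_int iphi.
have mT : measurable (`]0, T[%classic : set (measurableTypeR R)) by exact: measurable_itv.
have cE : continuous (fun t : R => expR (- (k * t))).
  exact: continuous_expRN.
have mE : measurable_fun setT (fun t : R => expR (- (k * t))).
  exact: continuous_measurable_fun.
have iphiE : leb.-integrable `]0, T[ (fun t => (phi t * expR (- (k * t)))%:E).
  apply: (integrable_mulr_bounded _ _ mT _ _ 1 iphi); first exact: measurable_funTS.
  move=> t /=; rewrite in_itv /= => /andP[t0 _]; rewrite ger0_norm ?expR_ge0//.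
  by rewrite -[leRHS](@expR0 R) ler_expR oppr_le0 mulr_ge0// ltW.
(* The subtracted term compensates a negative [phi] beyond [L]. *)
pose low t := C * expR (- (k * (L / 2))) * \1_(`]0, L / 2[) t
              - expR (- (k * L)) * `|phi t|.
have iind : leb.-integrable `]0, T[ (EFin \o (\1_(`]0, L / 2[%classic) : R -> R)).
  apply: (@measurable_bounded_integrable _ _ _ leb _ _ mT).
  - have h : (leb (`]0%R, T[%classic : set R) < +oo)%E.
      by rewrite lebesgue_measure_itv /= lte_fin (lt_trans L0 LT) -EFinB ltry.
    exact: h.
  - by apply: measurable_funTS; exact: measurable_indic.
  - exists 1; split; first exact: num_real.
    move=> y y1 t _ /=; apply: le_trans (ltW y1).
    by rewrite indicE normr_nat; case: (_ \in _).
have ilow1 := integrableZl mT (C * expR (- (k * (L / 2)))) iind.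
have ilow2 := integrableZl mT (expR (- (k * L))) (integrable_norm iphi).
have ilow : leb.-integrable `]0, T[ (EFin \o low).
  exact: (integrableB mT ilow1 ilow2).
have low_le : {ae leb, forall t, `]0, T[%classic t -> low t <= phi t * expR (- (k * t))}.
  apply: filterS phiC => t h; rewrite /= in_itv /= => /andP[t0 tT].
  rewrite /low indicE; have [tL2|tL2] := ltP t (L / 2).
    rewrite mem_set; last by rewrite /= in_itv /= t0.
    have tL : t < L by lra.
    have phit := h (introT andP (conj t0 tL)).
    apply: (@le_trans _ _ (C * expR (- (k * (L / 2))))).
      by rewrite mulr1 gerBl mulr_ge0 ?expR_ge0.
    apply: ler_pM; [exact: ltW|exact: expR_ge0|exact: phit|].
    by rewrite ler_expR lerN2 ler_wpM2l// ltW.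
  rewrite memNset; last by rewrite /= in_itv /= t0 /= => ?; lra.
  rewrite mulr0 sub0r; have [tL|tL] := ltP t L.
    have phit := h (introT andP (conj t0 tL)).
    apply: (@le_trans _ _ 0); first by rewrite oppr_le0 mulr_ge0 ?expR_ge0.
    by rewrite mulr_ge0 ?expR_ge0//; lra.
  rewrite lerNl -mulNr; apply: (@le_trans _ _ (`|phi t| * expR (- (k * t)))).
    by rewrite ler_wpM2r ?expR_ge0// -normrN ler_norm.
  by rewrite mulrC ler_wpM2r// ler_expR lerN2 ler_wpM2l// ltW.
have int_le : \int[leb]_(t in `]0, T[) low t <=
    \int[leb]_(t in `]0, T[) (phi t * expR (- (k * t))).
  have idif := integrableB mT iphiE ilow.
  rewrite -subr_ge0 -RintegralB//.
  have -> : \int[leb]_(t in `]0, T[) (phi t * expR (- (k * t)) - low t) =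
      \int[leb]_(t in `]0, T[) `|phi t * expR (- (k * t)) - low t|.
    rewrite /Rintegral; congr fine; have mdif := measurable_int _ idif.
    apply: ae_eq_integral => //.
      exact: (measurableT_comp (@abse_measurable R setT) mdif).
    apply: filterS low_le => t h tT; congr (_%:E).
    by rewrite ger0_norm// subr_ge0 h.
  by apply: Rintegral_ge0.
apply: le_trans int_le.
have -> : \int[leb]_(t in `]0, T[) low t =
    C * expR (- (k * (L / 2))) * (L / 2) - expR (- (k * L)) * N.
  rewrite RintegralB// RintegralZl// RintegralZl//; last exact: (integrable_norm iphi).
  congr (_ * _ - _); rewrite /Rintegral integral_indic//.
  rewrite setIidl; last first.
    by apply: subset_itvl; rewrite bnd_simp; lra.
  have e : leb (`]0%R, L / 2[%classic : set R) = (L / 2)%:E.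
    by rewrite lebesgue_measure_itv /= lte_fin divr_gt0// -EFinB subr0.
  exact: (congr1 fine e).
have -> : expR (- (k * L)) = expR (- (k * (L / 2))) * expR (- (k * (L / 2))).
  by rewrite -expRD; congr expR; field.
set e := expR (- (k * (L / 2))).
have e0 : 0 < e by exact: expR_gt0.
have eN : e * N <= C * L / 4.
  have x0 : 0 <= k * (L / 2) by rewrite mulr_ge0// ltW// divr_gt0.
  have := expR_ge1Dx (k * (L / 2)) => h.
  have ee : e * expR (k * (L / 2)) = 1 by rewrite /e mulrC expRxMexpNx_1.
  have Nle : N <= C * L / 4 * expR (k * (L / 2)).
    apply: (@le_trans _ _ (C * L / 4 * (k * (L / 2)))); last first.
      by rewrite ler_wpM2l ?divr_ge0 ?mulr_ge0 ?ltW//; lra.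
    have : 8 * N / (C * L ^+ 2) <= k by apply: le_trans kk0; rewrite lerDl.
    rewrite ler_pdivrMr ?mulr_gt0 ?exprn_gt0// => h8.
    have -> : C * L / 4 * (k * (L / 2)) = k * (C * L ^+ 2) / 8 by field.
    by rewrite ler_pdivlMr// mulrC.
  rewrite -(ler_pM2r (expR_gt0 (k * (L / 2)))) mulrAC ee mul1r//.
have := ltW e0; nra.
Qed.

(** The weighted identity at time [T], divided by the lower bound of the
    exponential moment of [phi]. *)
Lemma forcing_bound (T L C : R) (phi : R -> R) :
  0 < L < T -> 0 < C -> leb.-integrable `]0, T[ (EFin \o phi) ->
  {ae leb, forall t, 0 < t < L -> C <= phi t} \/
  {ae leb, forall t, 0 < t < L -> phi t <= - C} ->
  exists K k0 : R, [/\ 0 <= K, 0 < k0 & forall k F p p1 p2 B, k0 <= k ->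
    rest_trajectory T p p1 p2 ->
    {ae leb, forall t, 0 < t < T -> p2 t = k ^+ 2 * p t + phi t * F} ->
    `|p T| <= B -> `|p1 T| <= B ->
    `|F| <= K * (1 + k) * expR (- (k * (T - L / 2))) * B].
Proof.
move=> LT C0 iphi phiC; have /andP[L0 LT'] := LT.
have T0 : 0 < T by exact: lt_trans LT'.
have mT : measurable (`]0, T[%classic : set (measurableTypeR R)) by exact: measurable_itv.
have [k0 [k0_gt0 hk0]] : exists k0 : R, 0 < k0 /\ forall k, k0 <= k ->
    C * L / 4 * expR (- (k * (L / 2))) <=
    `|\int[leb]_(t in `]0, T[) (phi t * expR (- (k * t)))|.
  case: phiC => [phiC|phiC].
    have [k0 [k0_gt0 h]] := exponential_moment_lower T L C phi LT C0 iphi phiC.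
    by exists k0; split => // k kk0; apply: le_trans (h k kk0) (ler_norm _).
  have iphiN : leb.-integrable `]0, T[ (EFin \o (fun t => - phi t)).
    exact: (integrableN iphi).
  have phiCN : {ae leb, forall t, 0 < t < L -> C <= - phi t}.
    by apply: filterS phiC => t h tL; rewrite lerNr h.
  have [k0 [k0_gt0 h]] := exponential_moment_lower T L C _ LT C0 iphiN phiCN.
  exists k0; split => // k kk0; apply: le_trans (h k kk0) _.
  apply: le_trans (ler_norm _) _; rewrite -normrN le_eqVlt; apply/orP; left; apply/eqP.
  congr `|_|; rewrite -mulN1r -RintegralZl//.
    by apply: eq_Rintegral => t _; ring.
  apply: (integrable_mulr_bounded _ _ mT _ _ 1 iphiN).
    apply: measurable_funTS; apply: continuous_measurable_fun.
    exact: continuous_expRN.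
  move=> t /=; rewrite in_itv /= => /andP[t0 _]; rewrite ger0_norm ?expR_ge0//.
  rewrite -[leRHS](@expR0 R) ler_expR oppr_le0 mulr_ge0// ltW//.
  exact: lt_le_trans k0_gt0 kk0.
exists (C * L / 4)^-1, k0; split=> //.
  by rewrite invr_ge0 divr_ge0// mulr_ge0// ltW.
move=> k F p p1 p2 B kk0 rp ode pT p1T.
have mphi : measurable_fun `]0, T[ phi.
  by apply/measurable_EFinP; exact: measurable_int iphi.
have TT : 0 < T <= T by rewrite T0 lexx.
have k_gt0 : 0 < k by exact: lt_le_trans k0_gt0 kk0.
have := oscillator_weighted T k F phi p p1 p2 rp mphi ode T TT.
rewrite RintegralZl//; last first.
  apply: (integrable_mulr_bounded _ _ mT _ _ 1 iphi).
    apply: measurable_funTS; apply: continuous_measurable_fun.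
    exact: continuous_expRN.
  move=> t /=; rewrite in_itv /= => /andP[t0 _]; rewrite ger0_norm ?expR_ge0//.
  by rewrite -[leRHS](@expR0 R) ler_expR oppr_le0 mulr_ge0// ltW.
set I := \int[leb]_(t in _) _ => /(congr1 Num.norm).
rewrite !normrM (ger0_norm (expR_ge0 _)) => eF.
have lI := hk0 k kk0; rewrite -/I in lI.
have c0 : 0 < C * L / 4 by rewrite divr_gt0// mulr_gt0.
have -> : expR (- (k * (T - L / 2))) = expR (- (k * T)) / expR (- (k * (L / 2))).
  by rewrite -expRN -expRD; congr expR; ring.
have e0 := expR_gt0 (- (k * (L / 2))).
move: (expR (- (k * (L / 2)))) (C * L / 4) lI e0 c0 => e c lI e0 c0.
have key : `|F| * (c * e) <= expR (- (k * T)) * ((1 + k) * B).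
  apply: (@le_trans _ _ (`|F| * `|I|)); first by rewrite ler_wpM2l.
  rewrite -eF ler_wpM2l ?expR_ge0//.
  apply: le_trans (ler_normD _ _) _; rewrite normrM (gtr0_norm k_gt0).
  by rewrite mulrDl mul1r lerD// ler_wpM2l// ltW.
rewrite -(ler_pM2r (mulr_gt0 c0 e0)); apply: le_trans key _.
rewrite le_eqVlt; apply/orP; left; apply/eqP.
by field; rewrite !gt_eqF.
Qed.

End forced_oscillator.

(** * Completeness of the exponentials *)

Section moments_determine.
Context {d} {E : measurableType d} {R : realType}.
Variables (mu : {measure set E -> \bar R}).

(** The image of the signed measure [h mu] under [k] does not charge half-lines,
    which generate the Borel sets. *)
Lemma bounded_moments_null (D : set E) (h k : E -> R) (M : R) (r0 : nat) :
  measurable D -> mu.-integrable D (EFin \o h) -> measurable_fun D k ->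
  (forall x, D x -> 0 < k x < 1) ->
  (forall r : nat, (r0 <= r)%N ->
    `|\int[mu]_(x in D) (h x * expR (r%:R * k x))| <= M) ->
  forall A : set (measurableTypeR R), measurable A ->
  \int[mu]_(x in D `&` k @^-1` A) h x = 0.
Proof.
move=> mD ih mk k01 hM.
have k1 x : D x -> k x <= 1 by move=> /k01 /andP[_ /ltW].
have k0 x : D x -> 0 < k x by move=> /k01 /andP[].
have ray c := bounded_exponential_moments mu D mD h k M r0 ih mk k1 hM c k0.
apply: (pushforward_null mu D mD h k _ ih mk (RGenOInfty.measurableE R)).
- move=> _ _ [a ->] [b ->]; exists (Num.max a b).
  apply/seteqP; split => x; rewrite /= !in_itv /= !andbT gt_max.
    by move=> [-> ->].
  by move=> /andP[].
- rewrite -[X in \int[mu]_(x in X) _](_ : D `&` [set x | 0 < k x] = D) ?ray//.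
  by apply/setIidl => x Dx; exact: k0.
- move=> _ [a ->]; rewrite -[RHS](ray a); congr Rintegral.
  by apply/seteqP; split => x [Dx] /=; rewrite in_itv /= andbT.
Qed.

End moments_determine.

Section exponential_completeness.
Context {R : realType}.
Local Notation RM := (measurableTypeR R).
Implicit Types w : space3 R -> R.

Definition freq (a b c : R) : 'I_3 -> R := fun i => [:: a; b; c]`_i.

Lemma expo_freq a b c x :
  expo (freq a b c) x = expR (a * x.1.1) * expR (b * x.1.2) * expR (c * x.2).
Proof. by rewrite /expo /tens !big_ord_recl big_ord0 mulr1 mulrA. Qed.

(** For fixed [a] and [b], the bound in [r] shows that the restriction of [w] to
    the points with third coordinate in any given Borel set has zero pairing
    with [exp (a x1 + b x2)].
    The moments in the second coordinate, then in the first, are therefore zero,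
    a fortiori bounded, and [w] has integral zero over every box. *)
Lemma expo_complete w : L2 w ->
  (forall a b : nat, exists M r0, forall r : nat, (r0 <= r)%N ->
     `|ip w (expo (freq a%:R b%:R r%:R))| <= M) ->
  {ae @volume R, forall x, @Omega R x -> w x = 0}.
Proof.
move=> Lw wM.
have mO := @measurable_Omega R.
have iw : (@volume R).-integrable (@Omega R) (EFin \o w).
  exact: (Lp2_integrable _ _ mO (@volume_Omega R)).
have mc i : measurable_fun setT (coord i : space3 R -> R).
  by apply: continuous_measurable3; exact: coord_continuous.
pose x1 (x : space3 R) : RM := x.1.1; pose x2 (x : space3 R) : RM := x.1.2.
pose x3 (x : space3 R) : RM := x.2.
have m1 : measurable_fun setT x1 by exact: (mc ord0).
have m2 : measurable_fun setT x2 by exact: (mc (lift ord0 ord0)).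
have m3 : measurable_fun setT x3 by exact: (mc (lift ord0 (lift ord0 ord0))).
have O1 x : @Omega R x -> 0 < x1 x < 1 by move=> /(_ ord0).
have O2 x : @Omega R x -> 0 < x2 x < 1 by move=> /(_ (lift ord0 ord0)).
have O3 x : @Omega R x -> 0 < x3 x < 1 by move=> /(_ (lift ord0 (lift ord0 ord0))).
have ie (g : space3 R -> R) (D : set (space3 R)) (k : space3 R -> R) (n : nat) :
    measurable D -> D `<=` @Omega R -> measurable_fun setT k ->
    (forall x, @Omega R x -> 0 < k x < 1) ->
    (@volume R).-integrable D (EFin \o g) ->
    (@volume R).-integrable D (EFin \o (fun x => g x * expR (n%:R * k x))).
  move=> mD DO mk k01 ig; apply: (integrable_mulr_bounded _ _ mD _ _ (expR n%:R)) => //.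
    apply: measurable_funTS; apply: measurableT_comp => //.
    exact: measurable_funM.
  move=> x /DO /k01 /andP[_ /ltW kx]; rewrite ger0_norm ?expR_ge0// ler_expR.
  by rewrite ler_piMr.
have mI D (k : space3 R -> RM) C : measurable_fun setT k -> measurable D ->
    measurable C -> measurable (D `&` k @^-1` C).
  move=> mk mD mC; apply: measurableI => //.
  by rewrite -[X in measurable X]setTI; exact: mk.
have s3 (a b : nat) (C : set RM) : measurable C ->
    \int[@volume R]_(x in @Omega R `&` x3 @^-1` C)
      (w x * expR (a%:R * x1 x) * expR (b%:R * x2 x)) = 0.
  have [M [r0 hM]] := wM a b.
  apply: (bounded_moments_null _ _ _ _ M r0) => //.
  - by apply: (ie _ _ _ _) => //; apply: (ie _ _ _ _).
  - exact: measurable_funTS.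
  move=> r rr; have := hM r rr; rewrite /ip; congr (`|_| <= _).
  by apply: eq_Rintegral => x _; rewrite expo_freq !mulrA.
have s2 (a : nat) (B C : set RM) : measurable B -> measurable C ->
    \int[@volume R]_(x in (@Omega R `&` x3 @^-1` C) `&` x2 @^-1` B)
      (w x * expR (a%:R * x1 x)) = 0.
  move=> mB mC; apply: (bounded_moments_null _ _ _ _ 0 0%N) => //.
  - exact: mI.
  - apply: (ie _ _ _ _) => //; [exact: mI|by apply: integrableS iw => //; exact: mI].
  - exact: measurable_funTS.
  - by move=> x [/O2].
  - by move=> r _; rewrite (s3 a r C mC) normr0.
have s1 (A B C : set RM) : measurable A -> measurable B -> measurable C ->
    \int[@volume R]_(x in ((@Omega R `&` x3 @^-1` C) `&` x2 @^-1` B) `&` x1 @^-1` A)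
      w x = 0.
  move=> mA mB mC; apply: (bounded_moments_null _ _ _ _ 0 0%N) => //.
  - by apply: (mI _ _ _) => //; exact: mI.
  - by apply: integrableS iw => //; [apply: (mI _ _ _) => //; exact: mI|move=> x [[]]].
  - exact: measurable_funTS.
  - by move=> x [[/O1]].
  - by move=> r _; rewrite (s2 r B C mB mC) normr0.
have s12 (P : set (RM * RM)) (C : set RM) : measurable P -> measurable C ->
    \int[@volume R]_(x in (@Omega R `&` x3 @^-1` C) `&` fst @^-1` P) w x = 0.
  move=> + mC; move: P.
  apply: (pushforward_null _ _ _ _ _ _ _ _ (measurable_prod_measurableType RM RM)).
  - exact: mI.
  - by apply: integrableS iw => //; exact: mI.
  - exact: measurable_funTS.
  - move=> _ _ [A1 mA1 [B1 mB1 <-]] [A2 mA2 [B2 mB2 <-]].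
    exists (A1 `&` A2); first exact: measurableI.
    by exists (B1 `&` B2); [exact: measurableI|rewrite setXI].
  - by have := s1 setT setT C measurableT measurableT mC; rewrite !preimage_setT !setIT.
  - move=> _ [A mA [B mB <-]]; rewrite -[RHS](s1 A B C mA mB mC); congr Rintegral.
    by apply/seteqP; split => x /=; tauto.
have s123 (Q : set (space3 R)) : measurable Q ->
    \int[@volume R]_(x in @Omega R `&` id @^-1` Q) w x = 0.
  move: Q; apply: (pushforward_null _ _ _ _ _ _ _ _
    (measurable_prod_measurableType (RM * RM)%type RM)) => //.
  - move=> _ _ [A1 mA1 [B1 mB1 <-]] [A2 mA2 [B2 mB2 <-]].
    exists (A1 `&` A2); first exact: measurableI.
    by exists (B1 `&` B2); [exact: measurableI|rewrite setXI].
  - by have := s12 setT setT measurableT measurableT; rewrite !preimage_setT !setIT.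
  - move=> _ [A mA [B mB <-]]; rewrite -[RHS](s12 A B mA mB); congr Rintegral.
    by apply/seteqP; split => x /=; tauto.
have h : ae_eq (@volume R) (@Omega R) (EFin \o w) (cst 0%E); last first.
  by apply: filterS h => x h Ox; have [] := h Ox.
apply: (integral_ae_eq mO) => // Q QO mQ.
rewrite integral0 -[LHS]fineK.
  have := s123 Q mQ; rewrite /Rintegral preimage_id setIidr// => ->.
  by [].
by apply: integrable_fin_num => //; exact: integrableS iw.
Qed.

End exponential_completeness.

(** * Pairings of solutions as functions of time *)

Section pairing_in_time.
Context {R : realType}.
Variables (T : R) (g : space3 R -> R).
Hypothesis Lg : L2 g.
Implicit Types u v : R -> space3 R -> R.

Let mO := @measurable_Omega R.

Lemma C0L2_L2 u t : C0L2 T u -> 0 <= t <= T -> L2 (u t).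
Proof. by move=> /(_ t) h tT; have [] := h _; rewrite ?in_itv. Qed.

Lemma C0L2_ip_continuous u : C0L2 T u ->
  {within `[0, T], continuous (fun t => ip (u t) g)}.
Proof.
move=> cu; apply/subspace_continuousP => t /= tT.
have [Lut ct] := cu t tT.
apply: (Lp2_cvg _ _ mO) => //.
near=> s; have sT : `[0, T]%classic s by near: s; exact: withinT.
by have [] := cu s sT.
Unshelve. all: by end_near. Qed.

Lemma is_derive_ip u v : C0L2 T u -> is_time_derivative T u v ->
  forall t, 0 < t < T -> is_derive t 1 (fun s => ip (u s) g) (ip (v t) g).
Proof.
move=> cu duv t /andP[t0 tT].
have tI : t \in `[0, T] by rewrite in_itv /= !ltW.
have [Lv cv] := duv t tI.
have Lu s : s \in `[0, T] -> L2 (u s) by move=> sI; have [] := cu s sI.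
have Lq s : s \in `[0, T] -> L2 (fun x => (u s x - u t x) / (s - t)).
  move=> sI; have -> : (fun x => (u s x - u t x) / (s - t)) =
      (fun x => (s - t)^-1 * (u s \- u t) x) by apply/funext => x; rewrite mulrC.
  by apply: Lp2Z; apply: Lp2B; exact: Lu.
have c1 : ip (fun x => (u s x - u t x) / (s - t)) g
   @[s --> within (`[0, T] `\ t) (nbhs t)] --> ip (v t) g.
  apply: (Lp2_cvg _ _ mO) => //.
  near=> s; have [sT _] : (`[0, T] `\ t) s by near: s; exact: withinT.
  exact: Lq.
have c2 : (ip (u s) g - ip (u t) g) / (s - t)
   @[s --> within (`[0, T] `\ t) (nbhs t)] --> ip (v t) g.
  apply: cvg_trans c1; apply: near_eq_cvg; near=> s.
  have [sT _] : (`[0, T] `\ t) s by near: s; exact: withinT.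
  have Lsu := Lu s sT; have Ltu := Lu t tI.
  rewrite mulrC -[X in _ * (_ - X)]mul1r.
  have -> : (fun x => (u s x - u t x) / (s - t)) =
     (fun x => (s - t)^-1 * (u s x + (-1) * u t x)).
    by apply/funext => x; rewrite mulN1r mulrC.
  rewrite ipZ ?ipD ?ipZ ?mulN1r ?mul1r//.
  - exact: Lp2Z.
  - by apply: Lp2D => //; exact: Lp2Z.
have c3 : (fun h : R => h + t) h @[h --> 0^'] --> within (`[0, T] `\ t) (nbhs t).
  move=> A nA0; have nA : \forall s \near t, (`[0, T] `\ t) s -> A s by exact: nA0.
  have nI : \forall s \near t, s \in `[0, T].
    by near=> s; rewrite in_itv /=; apply/andP; split; apply: ltW; near: s;
      [exact: lt_nbhsr|exact: lt_nbhsl].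
  have nAI : nbhs t [set s | ((`[0, T] `\ t) s -> A s) /\ s \in `[0, T]].
    by apply: filterI; [exact: nA|exact: nI].
  have ct : (fun h : R => h + t) h @[h --> (0:R)] --> (t : R).
    have -> : nbhs t = nbhs (0 + t) by rewrite add0r.
    by apply: cvgD; [exact: cvg_id|exact: cvg_cst].
  have nh : \forall h \near (0 : R), ((`[0, T] `\ t) (h + t) -> A (h + t)) /\ h + t \in `[0, T].
    exact: (ct _ nAI).
  have nh' : \forall h \near (0 : R), h != 0 -> A (h + t).
    apply: filterS nh => h [hA hI] h0; apply: hA; split => //= e.
    by move/eqP: h0; apply; apply: (addIr t); rewrite add0r.
  exact: nh'.
have c4 := cvg_comp _ _ c3 c2.
have c5 : (fun h : R => h^-1 *: (((fun s => ip (u s) g) \o shift t) (h *: (1:R)) - ip (u t) g)) h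
    @[h --> 0^'] --> ip (v t) g.
  apply: cvg_trans c4; apply: near_eq_cvg; apply: nearW => h /=.
  by rewrite addrK /GRing.scale /= mulr1 mulrC.
by apply: DeriveDef; [apply/cvg_ex; exists (ip (v t) g)|exact: cvg_lim c5].
Unshelve. all: by end_near. Qed.

End pairing_in_time.

Section solution_at_a_time.
Context {R : realType}.
Variables (la mu T : R) (phi : R -> R) (X : R -> vector_field R).

(** The conditions at a fixed time, isolated because each of them holds only for
    almost every time. *)
Definition solves_at (u : R -> vector_field R) (f : vector_field R) t : Prop :=
  [/\ forall j, H2 (u t j), forall j, is_trace (u t j) (cst 0),
   exists sigma : 'I_3 -> 'I_3 -> space3 R -> R,
    (forall j k, is_trace (stress la mu (u t) j k) (sigma j k)) /\
    forall j, {ae @surface R, forall x, @boundary R x ->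
      \sum_(k < 3) sigma j k x * normal k x = X t j x} &
   forall j, {ae @volume R, forall x, @Omega R x ->
     dt T (dt T (fun s => u s j)) t x - mu * laplacian (u t j) x
     - (la + mu) * partial j (div (u t)) x = phi t * f j x}].

Lemma ae_forall_ord n (Q : 'I_n -> R -> Prop) :
  (forall j, {ae @lebesgue_measure R, forall t, Q j t}) ->
  {ae @lebesgue_measure R, forall t, forall j, Q j t}.
Proof.
by move=> h; apply: filter_forall => j; exact: h.
Qed.

Lemma ae_solves_at g h u f : lame_class T u f -> lame_solution la mu T phi X g h u f ->
  {ae @lebesgue_measure R, forall t, 0 < t < T -> solves_at u f t}.
Proof.
move=> cu [sys _ dir str].
have H2u := ae_forall_ord _ _ (fun j => let: And3 _ b _ := cu j in let: And3 a _ _ := b in a).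
have syst := ae_forall_ord _ _ sys.
have dirt := ae_forall_ord _ _ dir.
apply: filterS2 (filterI H2u syst) (filterI dirt str) => t [h1 h2] [h3 h4] tT.
split; [by move=> j; exact: h1|by move=> j; exact: h3|exact: h4|by move=> j; exact: h2].
Qed.

(** The surface integrals in Green's formula depend only on the prescribed load,
    which is common to the two solutions. *)
Lemma pairing_equation (u1 u2 : R -> vector_field R) (f1 f2 : vector_field R) t eta j :
  solves_at u1 f1 t -> solves_at u2 f2 t ->
  (forall j, L2 (f1 j)) -> (forall j, L2 (f2 j)) ->
  (forall j, L2 (dt T (dt T (fun s => u1 s j)) t)) ->
  (forall j, L2 (dt T (dt T (fun s => u2 s j)) t)) ->
  let e := expo eta in
  let D k := ip (u1 t k) e - ip (u2 t k) e in
  ip (dt T (dt T (fun s => u1 s j)) t) e - ip (dt T (dt T (fun s => u2 s j)) t) e =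
  mu * (\sum_(k < 3) eta k ^+ 2) * D j
  + (la + mu) * eta j * (\sum_(k < 3) eta k * D k)
  + phi t * (ip (f1 j) e - ip (f2 j) e).
Proof.
move=> [H1 tr1 [s1 [ts1 X1]] eq1] [H2' tr2 [s2 [ts2 X2]] eq2] Lf1 Lf2 Ld1 Ld2 e D.
have ce : continuous e by have [] := smoothP _ (smooth_expo eta).
have Le : L2 e by exact: continuous_L2.
have one u f s : (forall j, H2 (u t j)) -> (forall j, is_trace (u t j) (cst 0)) ->
    (forall j k, is_trace (stress la mu (u t) j k) (s j k)) ->
    {ae @volume R, forall x, @Omega R x ->
     dt T (dt T (fun s => u s j)) t x - mu * laplacian (u t j) x
     - (la + mu) * partial j (div (u t)) x = phi t * f j x} ->
    L2 (f j) -> L2 (dt T (dt T (fun s => u s j)) t) ->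
    ip (dt T (dt T (fun s => u s j)) t) e =
     mu * (\sum_(k < 3) eta k ^+ 2) * ip (u t j) e
     + (la + mu) * eta j * (\sum_(k < 3) eta k * ip (u t k) e)
     + \int[@surface R]_(x in @boundary R) ((\sum_(k < 3) s j k x * normal k x) * e x)
     + phi t * ip (f j) e.
  move=> Hu tru tsu equ Lf Ldu.
  rewrite -(green_formula la mu (u t) s Hu tru tsu eta j).
  have Lop := L2_lame_operator la mu (u t) Hu j.
  rewrite -(ipZ (phi t) _ _ Lf Le) -ipD//; last exact: Lp2Z.
  apply: ip_ae => //; first by apply: Lp2D => //; exact: Lp2Z.
  by apply: filterS equ => x h /h <-; rewrite /lame_operator; ring.
have E1 := one u1 f1 s1 H1 tr1 ts1 (eq1 j) (Lf1 j) (Ld1 j).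
have E2 := one u2 f2 s2 H2' tr2 ts2 (eq2 j) (Lf2 j) (Ld2 j).
apply: etrans (congr2 (fun a b => a - b) E1 E2) _.
have -> : \int[@surface R]_(x in @boundary R) ((\sum_(k < 3) s1 j k x * normal k x) * e x) =
   \int[@surface R]_(x in @boundary R) ((\sum_(k < 3) s2 j k x * normal k x) * e x).
  have ms (s : 'I_3 -> 'I_3 -> space3 R -> R) u :
      (forall j k, is_trace (stress la mu (u t) j k) (s j k)) ->
      measurable_fun (@boundary R)
       (EFin \o (fun x => (\sum_(k < 3) s j k x * normal k x) * e x)).
    move=> ts; apply/measurable_EFinP; apply: measurable_funM; last first.
      by apply: measurable_funTS; exact: continuous_measurable3.
    apply: measurable_sum => k; apply: measurable_funM.
      have [_ Ls _] := ts j k.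
      exact: (Lp2_measurable _ _ measurable_boundary _ Ls).
    by apply: measurable_funTS; exact: measurable_normal.
  rewrite /Rintegral; congr fine; apply: ae_eq_integral.
  - exact: measurable_boundary.
  - exact: (ms _ u1).
  - exact: (ms _ u2).
  - by apply: filterS2 (X1 j) (X2 j) => x h1 h2 bx; rewrite h1// h2.
have -> : \sum_(k < 3) eta k * D k =
    \sum_(k < 3) eta k * ip (u1 t k) e - \sum_(k < 3) eta k * ip (u2 t k) e.
  by rewrite -sumrB; apply: eq_bigr => k _; rewrite mulrBr.
rewrite /D; ring.
Qed.

End solution_at_a_time.

(** * Longitudinal and transversal modes *)

Section modal_decomposition.
Context {R : realType}.
Local Notation leb := (@lebesgue_measure R).
Implicit Types (D : 'I_3 -> R -> R).

Definition comb (a : 'I_3 -> R) D : R -> R := fun t => \sum_(k < 3) a k * D k t.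

Lemma rest_trajectory_comb T a D D1 D2 :
  (forall k, rest_trajectory T (D k) (D1 k) (D2 k)) ->
  rest_trajectory T (comb a D) (comb a D1) (comb a D2).
Proof.
move=> h; have E (V : 'I_3 -> R -> R) : comb a V = fun t =>
    a ord0 * V ord0 t + (a (lift ord0 ord0) * V (lift ord0 ord0) t +
    a (lift ord0 (lift ord0 ord0)) * V (lift ord0 (lift ord0 ord0)) t).
  by apply/funext => t; rewrite /comb !big_ord_recl big_ord0 addr0.
have C (V : 'I_3 -> R -> R) : (forall k, {within `[0, T], continuous (V k)}) ->
    {within `[0, T], continuous (comb a V)}.
  move=> cV; rewrite E => t.
  apply: cvgD; first by apply: cvgMr; exact: cV.
  by apply: cvgD; apply: cvgMr; exact: cV.
have dd (V V' : 'I_3 -> R -> R) (t : R) : (forall k, is_derive t 1 (V k) (V' k t)) ->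
    is_derive t 1 (comb a V) (comb a V' t).
  move=> dV; rewrite (E V) (E V').
  exact: (is_deriveD (is_deriveZ _ (dV _))
    (is_deriveD (is_deriveZ _ (dV _)) (is_deriveZ _ (dV _)))).
split.
- by split; apply: C => k; have [[]] := h k.
- by apply: C => k; have [] := h k.
- by move=> t tT; apply: dd => k; have [_ _ d _ _] := h k; exact: d.
- by move=> t tT; apply: dd => k; have [_ _ _ d _] := h k; exact: d.
- by split; rewrite /comb big1// => k _; have [_ _ _ _ [h0 h1]] := h k;
    rewrite ?h0 ?h1 mulr0.
Qed.

Section system.
Variables (la mu T : R) (phi : R -> R).
Hypotheses (mu_gt0 : 0 < mu) (lamu_gt0 : 0 < la + 2 * mu).
Variables (eta : 'I_3 -> R).
Let N2 := \sum_(k < 3) eta k ^+ 2.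
Hypothesis N2_gt0 : 0 < N2.
Let N := Num.sqrt N2.
Variables (D D1 D2 : 'I_3 -> R -> R) (F : 'I_3 -> R).
Hypothesis DR : forall k, rest_trajectory T (D k) (D1 k) (D2 k).
Hypothesis ode : {ae leb, forall t, 0 < t < T -> forall j,
  D2 j t = mu * N2 * D j t + (la + mu) * eta j * (\sum_(k < 3) eta k * D k t)
    + phi t * F j}.

Let N_gt0 : 0 < N. Proof. by rewrite sqrtr_gt0. Qed.
Let NN : N ^+ 2 = N2. Proof. by rewrite sqr_sqrtr// ltW. Qed.

Let y k := eta k / N.
Let etaE k : eta k = N * y k.
Proof. by rewrite /y mulrCA divff ?mulr1// gt_eqF. Qed.

Let sum_yy : \sum_(k < 3) y k * y k = 1.
Proof.
have -> : \sum_(k < 3) y k * y k = N2 / N ^+ 2.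
  rewrite /N2 mulr_suml; apply: eq_bigr => k _; rewrite /y; field.
  by rewrite gt_eqF.
by rewrite NN divff// gt_eqF.
Qed.

Lemma direction_le1 k : `|eta k / N| <= 1.
Proof.
rewrite -/(y k); have yy : y k ^+ 2 <= 1.
  rewrite -sum_yy (bigD1 k)//= expr2 lerDl sumr_ge0// => i _.
  by rewrite -expr2 sqr_ge0.
by rewrite -(@ler_pXn2r _ 2)// ?nnegrE// expr1n real_normK// num_real.
Qed.

(** The coefficients of the component [j] of the projection onto the orthogonal
    complement of [eta]; they span the shear waves of speed [sqrt mu], whereas
    [longitudinal] gives the pressure waves of speed [sqrt (la + 2 mu)]. *)
Definition transversal j : 'I_3 -> R := fun k => (j == k)%:R - eta j / N * (eta k / N).
Definition longitudinal : 'I_3 -> R := fun k => eta k / N.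

Lemma mode_split (v : 'I_3 -> R) j : v j =
  \sum_(k < 3) transversal j k * v k + eta j / N * \sum_(k < 3) longitudinal k * v k.
Proof.
rewrite -[eta j / N]/(y j) mulr_sumr -big_split /=.
rewrite -[LHS](sum_delta j v); apply: eq_bigr => k _.
by rewrite /transversal /longitudinal -/(y j) -/(y k); ring.
Qed.

(** The hypothesis on [a] says that it is an eigenvector, with eigenvalue [c], of
    the symmetric matrix of the system divided by [N ^ 2]. *)
Let mode_ode (a : 'I_3 -> R) (c : R) : 0 < c ->
  (forall v : 'I_3 -> R, (la + mu) * (\sum_(k < 3) a k * y k) * (\sum_(k < 3) y k * v k) =
     (c - mu) * \sum_(k < 3) a k * v k) ->
  {ae leb, forall t, 0 < t < T -> comb a D2 t =
     (Num.sqrt c * N) ^+ 2 * comb a D t + phi t * \sum_(k < 3) a k * F k}.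
Proof.
move=> c0 av; apply: filterS ode => t h /h {}h.
have hv := av (fun k => D k t).
rewrite exprMn sqr_sqrtr ?(ltW c0)// NN /comb.
transitivity (\sum_(j < 3) (mu * N2 * (a j * D j t) +
    N2 * (la + mu) * (\sum_(k < 3) y k * D k t) * (a j * y j) + phi t * (a j * F j))).
  apply: eq_bigr => j _; rewrite h.
  have -> : \sum_(k < 3) eta k * D k t = N * \sum_(k < 3) y k * D k t.
    by rewrite mulr_sumr; apply: eq_bigr => k _; rewrite mulrA -(etaE k).
  by rewrite {1}(etaE j) -NN; ring.
rewrite !big_split /= -!mulr_sumr; congr (_ + _).
have -> : c * N2 * \sum_(k < 3) a k * D k t =
   mu * N2 * \sum_(k < 3) a k * D k t + N2 * ((c - mu) * \sum_(k < 3) a k * D k t) by ring.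
by rewrite -hv; ring.
Qed.

Lemma longitudinal_ode : {ae leb, forall t, 0 < t < T -> comb longitudinal D2 t =
   (Num.sqrt (la + 2 * mu) * N) ^+ 2 * comb longitudinal D t
   + phi t * \sum_(k < 3) longitudinal k * F k}.
Proof. by apply: mode_ode => // v; rewrite sum_yy; ring. Qed.

Lemma transversal_ode j : {ae leb, forall t, 0 < t < T -> comb (transversal j) D2 t =
   (Num.sqrt mu * N) ^+ 2 * comb (transversal j) D t
   + phi t * \sum_(k < 3) transversal j k * F k}.
Proof.
apply: mode_ode => // v.
have -> : \sum_(k < 3) transversal j k * y k = 0.
  have := mode_split y j; rewrite -[X in _ = _ + _ * X]/(\sum_(k < 3) y k * y k).
  by rewrite sum_yy mulr1 -[eta j / N]/(y j) => /eqP; rewrite eq_sym -subr_eq0 addrK => /eqP.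
by rewrite subrr mulr0 !mul0r.
Qed.

Lemma system_free : (forall k, F k = 0) -> forall t j, 0 < t <= T -> D j t = 0.
Proof.
move=> F0 t j tT.
have free a c : 0 < c -> {ae leb, forall t, 0 < t < T -> comb a D2 t =
     (Num.sqrt c * N) ^+ 2 * comb a D t + phi t * \sum_(k < 3) a k * F k} ->
   comb a D t = 0.
  move=> c0 o; have rp := rest_trajectory_comb T a _ _ _ DR.
  apply: (free_oscillator T (Num.sqrt c * N) _ _ _ _ rp _ t tT).
    by rewrite mulf_neq0// gt_eqF// sqrtr_gt0.
  apply: filterS o => s h /h ->; rewrite big1 ?mulr0 ?addr0// => k _.
  by rewrite F0 mulr0.
rewrite (mode_split (fun k => D k t) j).
have e1 := free _ _ mu_gt0 (transversal_ode j).
have e2 := free _ _ lamu_gt0 longitudinal_ode.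
rewrite -[X in X + _]/(comb (transversal j) D t) e1.
by rewrite -[X in _ + _ * X]/(comb longitudinal D t) e2 mulr0 addr0.
Qed.

Lemma comb_le (a : 'I_3 -> R) (V : 'I_3 -> R -> R) B t : (forall k, `|a k| <= 2) ->
  (forall k, `|V k t| <= B) -> `|comb a V t| <= 6 * B.
Proof.
move=> a2 VB; apply: le_trans (ler_norm_sum _ _ _) _.
apply: (@le_trans _ _ (\sum_(k < 3) 2 * B)).
  by apply: ler_sum => k _; rewrite normrM ler_pM.
by rewrite sumr_const card_ord -mulr_natr; lra.
Qed.

Lemma longitudinal_le k : `|longitudinal k| <= 2.
Proof. by apply: le_trans (direction_le1 k) _; lra. Qed.

Lemma transversal_le j k : `|transversal j k| <= 2.
Proof.
apply: le_trans (ler_normB _ _) _.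
have := ler_pM (normr_ge0 _) (normr_ge0 _) (direction_le1 j) (direction_le1 k).
rewrite -normrM /y mul1r => h; apply: (@le_trans _ _ (1 + 1)); last lra.
by apply: lerD => //; rewrite normr_nat; case: (j == k).
Qed.

End system.
End modal_decomposition.

Section modal_bounds.
Context {R : realType}.
Local Notation leb := (@lebesgue_measure R).
Variables (la mu T L C : R) (phi : R -> R).
Hypotheses (mu_gt0 : 0 < mu) (lamu_gt0 : 0 < la + 2 * mu).
Hypotheses (LT : 0 < L < T) (C0 : 0 < C).
Hypothesis iphi : leb.-integrable `]0, T[ (EFin \o phi).
Hypothesis phiC : {ae leb, forall t, 0 < t < L -> C <= phi t} \/
  {ae leb, forall t, 0 < t < L -> phi t <= - C}.
Hypothesis T_large : 2 * Num.max (Num.sqrt mu)^-1 (Num.sqrt (la + 2 * mu))^-1 < T.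

(** Here the length of the time interval enters.  With [k = s N] and
    [de = s (T - L / 2) - 1], [exp (- k (T - L / 2)) = exp (- N) exp (- de N)];
    as [L < T] and [2 < s T], [de] is positive, and [exp (- de N)] absorbs the
    factor [1 + k]. *)
Lemma mode_bound (c : R) : 0 < c -> 2 * (Num.sqrt c)^-1 < T ->
  exists K N0 : R, 0 <= K /\ forall N F p p1 p2 B, N0 <= N ->
    rest_trajectory T p p1 p2 ->
    {ae leb, forall t, 0 < t < T -> p2 t = (Num.sqrt c * N) ^+ 2 * p t + phi t * F} ->
    `|p T| <= B -> `|p1 T| <= B -> `|F| <= K * expR (- N) * B.
Proof.
move=> c0 cT; have s0 : 0 < Num.sqrt c by rewrite sqrtr_gt0.
move: (Num.sqrt c) s0 cT => s s0 cT.
have [K [k0 [K0 k00 hK]]] := forcing_bound T L C phi LT C0 iphi phiC.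
pose de := s * (T - L / 2) - 1.
have de0 : 0 < de.
  have : 2 < s * T by rewrite mulrC -ltr_pdivrMr.
  have /andP[L0 LT'] := LT; rewrite /de; nra.
exists (K * (1 + s / de)), (k0 / s); split.
  by rewrite mulr_ge0// addr_ge0// divr_ge0// ltW.
move=> N F p p1 p2 B N0 rp o pB p1B.
have kk : k0 <= s * N by rewrite mulrC -ler_pdivrMr.
have N_gt0 : 0 < N by apply: lt_le_trans N0; rewrite divr_gt0.
have B0 : 0 <= B by apply: le_trans pB.
apply: le_trans (hK _ _ _ _ _ _ kk rp o pB p1B) _.
rewrite ler_wpM2r// -!mulrA ler_wpM2l//.
have -> : expR (- (s * (N * (T - L / 2)))) = expR (- (de * N)) * expR (- N).
  by rewrite -expRD; congr expR; rewrite /de; ring.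
rewrite mulrA ler_wpM2r ?expR_ge0// mulrDl mul1r lerD//.
  by rewrite -[leRHS](@expR0 R) ler_expR oppr_le0 mulr_ge0// ltW.
rewrite ler_pdivlMr//.
have h : de * N * expR (- (de * N)) <= 1.
  have := expR_ge1Dx (de * N) => h1.
  by rewrite expRN ler_pdivrMr ?expR_gt0// mul1r; lra.
have -> : s * N * expR (- (de * N)) * de = s * (de * N * expR (- (de * N))) by ring.
by rewrite -[leRHS]mulr1 ler_wpM2l// ltW.
Qed.

(** The coefficients of the modes are at most [2] in absolute value, and there
    are three components: hence the constant [6]. *)
Lemma system_bound : exists K N0 : R, 0 <= K /\
  forall (eta : 'I_3 -> R) (D D1 D2 : 'I_3 -> R -> R) (F : 'I_3 -> R) (B : R),
  let N2 := \sum_(k < 3) eta k ^+ 2 in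
  0 < N2 -> N0 <= Num.sqrt N2 ->
  (forall k, rest_trajectory T (D k) (D1 k) (D2 k)) ->
  {ae leb, forall t, 0 < t < T -> forall j,
    D2 j t = mu * N2 * D j t + (la + mu) * eta j * (\sum_(k < 3) eta k * D k t)
      + phi t * F j} ->
  (forall k, `|D k T| <= B) -> (forall k, `|D1 k T| <= B) ->
  forall j, `|F j| <= K * expR (- Num.sqrt N2) * B.
Proof.
have Tm : 2 * (Num.sqrt mu)^-1 < T.
  by apply: le_lt_trans T_large; rewrite ler_wpM2l// le_max lexx.
have Tl : 2 * (Num.sqrt (la + 2 * mu))^-1 < T.
  by apply: le_lt_trans T_large; rewrite ler_wpM2l// le_max lexx orbT.
have [Km [Nm [Km0 hm]]] := mode_bound mu mu_gt0 Tm.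
have [Kl [Nl [Kl0 hl]]] := mode_bound (la + 2 * mu) lamu_gt0 Tl.
exists (6 * (Km + Kl)), (Num.max Nm Nl); split; first by rewrite mulr_ge0// addr_ge0.
move=> eta D D1 D2 F B N2 N2_gt0; rewrite ge_max => /andP[Nm_le Nl_le] DR ode DB D1B j.
set N := Num.sqrt N2 in Nm_le Nl_le *.
have tl := transversal_le eta N2_gt0 j; have ll := longitudinal_le eta N2_gt0.
have ht := hm N _ _ _ _ (6 * B) Nm_le (rest_trajectory_comb T (transversal eta j) _ _ _ DR)
  (transversal_ode la mu T phi mu_gt0 eta N2_gt0 D D2 F ode j)
  (comb_le _ _ _ _ tl DB) (comb_le _ _ _ _ tl D1B).
have hh := hl N _ _ _ _ (6 * B) Nl_le (rest_trajectory_comb T (longitudinal eta) _ _ _ DR)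
  (longitudinal_ode la mu T phi lamu_gt0 eta N2_gt0 D D2 F ode)
  (comb_le _ _ _ _ ll DB) (comb_le _ _ _ _ ll D1B).
rewrite (mode_split eta F j); apply: le_trans (ler_normD _ _) _.
have -> : 6 * (Km + Kl) * expR (- N) * B =
   Km * expR (- N) * (6 * B) + Kl * expR (- N) * (6 * B) by ring.
apply: lerD; first exact: ht.
rewrite normrM; apply: le_trans hh; rewrite -[leRHS]mul1r ler_wpM2r//.
exact: direction_le1.
Qed.

End modal_bounds.

(** * Uniqueness *)

Section pairings_of_solutions.
Context {R : realType}.
Local Notation leb := (@lebesgue_measure R).
Implicit Types (v w : space3 R -> R) (u : R -> space3 R -> R).

Definition L1norm v : R := \int[@volume R]_(x in @Omega R) `|v x|.

Lemma ip_expo_le v (a b r : R) : 0 <= a -> 0 <= b -> 0 <= r -> L2 v ->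
  `|ip v (expo (freq a b r))| <= expR (a + b + r) * L1norm v.
Proof.
move=> a0 b0 r0 Lv; have mO := @measurable_Omega R.
have ce : continuous (expo (freq a b r)).
  by case: (smoothP _ (smooth_expo (freq a b r))).
have iv := Lp2_integrable _ _ mO (@volume_Omega R) _ Lv.
have ie := ip_integrable v _ Lv (continuous_L2 _ ce).
have iav : (@volume R).-integrable (@Omega R) (EFin \o (fun x => `|v x|)).
  exact: (integrable_norm iv).
rewrite /ip /L1norm -RintegralZl//.
apply: le_trans (le_normr_Rintegral mO ie) _.
apply: le_Rintegral => //.
- exact: (integrable_norm ie).
- by have := integrableZl mO (expR (a + b + r)) iav.
move=> x Ox; rewrite normrM mulrC ler_wpM2r//.
rewrite expo_freq -!expRD ger0_norm ?expR_ge0// ler_expR.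
have /andP[_ /ltW x1] := Ox ord0; have /andP[_ /ltW x2] := Ox (lift ord0 ord0).
have /andP[_ /ltW x3] := Ox (lift ord0 (lift ord0 ord0)).
by rewrite !lerD// ler_piMr.
Qed.

(** The equal initial data make the difference start from rest; regularity in
    time is inherited from the continuity of the pairing. *)
Lemma rest_trajectory_pairing (T : R) u1 u2 g : 0 < T -> L2 g ->
  C2L2 T u1 -> C2L2 T u2 ->
  {ae @volume R, forall x, @Omega R x -> u1 0 x = u2 0 x} ->
  {ae @volume R, forall x, @Omega R x -> dt T u1 0 x = dt T u2 0 x} ->
  rest_trajectory T (fun t => ip (u1 t) g - ip (u2 t) g)
    (fun t => ip (dt T u1 t) g - ip (dt T u2 t) g)
    (fun t => ip (dt T (dt T u1) t) g - ip (dt T (dt T u2) t) g).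
Proof.
move=> T0 Lg [c1 d1 c1' d1' c1''] [c2 d2 c2' d2' c2''] u0 u0'.
have z0 : 0 <= (0 : R) <= T by rewrite lexx ltW.
have C (v w : R -> space3 R -> R) : C0L2 T v -> C0L2 T w ->
    {within `[0, T], continuous (fun t => ip (v t) g - ip (w t) g)}.
  move=> cv cw t.
  exact: (cvgB (C0L2_ip_continuous T g Lg v cv t) (C0L2_ip_continuous T g Lg w cw t)).
have dd (v v' w w' : R -> space3 R -> R) t : C0L2 T v -> C0L2 T w -> is_time_derivative T v v' ->
    is_time_derivative T w w' -> 0 < t < T ->
    is_derive t 1 (fun s => ip (v s) g - ip (w s) g) (ip (v' t) g - ip (w' t) g).
  move=> cv cw dv dw tT.
  exact: (is_deriveB (is_derive_ip T g Lg v v' cv dv t tT)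
    (is_derive_ip T g Lg w w' cw dw t tT)).
split; first by split; exact: C.
- exact: C.
- by move=> t; exact: dd.
- by move=> t; exact: dd.
- have E (v w : R -> space3 R -> R) : C0L2 T v -> C0L2 T w ->
      {ae @volume R, forall x, @Omega R x -> v 0 x = w 0 x} ->
      ip (v 0) g - ip (w 0) g = 0.
    move=> cv cw vw; apply/eqP; rewrite subr_eq0; apply/eqP.
    exact: (ip_ae _ _ _ (C0L2_L2 T v 0 cv z0) (C0L2_L2 T w 0 cw z0) Lg vw).
  by split; exact: E.
Qed.

End pairings_of_solutions.

Theorem theorem1 (R : realType) (T la mu : R)
  (phi : R -> R) (X : R -> vector_field R) (g h : vector_field R)
  (T_gt0 : 0 < T) (mu_gt0 : 0 < mu) (lamu_gt0 : 0 < la + 2 * mu)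
  (phi_L1 : Lp (@lebesgue_measure R) `]0, T[ 1%:E phi)
  (X_L1 : forall j, bochner (Lp (@surface R) (@boundary R) 1%:E)
     (Lpnorm (@surface R) (@boundary R) 1%:E) T 1%:E (fun t => X t j))
  (g_L2 : forall j, L2 (g j)) (h_L2 : forall j, L2 (h j))
  (phi_sign : exists L C : R, [/\ 0 < L < T, 0 < C &
     {ae @lebesgue_measure R, forall t, 0 < t < L -> C <= phi t} \/
     {ae @lebesgue_measure R, forall t, 0 < t < L -> phi t <= - C}])
  (T_large : 2 * Num.max (Num.sqrt mu)^-1 (Num.sqrt (la + 2 * mu))^-1 < T)
  (u1 u2 : R -> vector_field R) (f1 f2 : vector_field R) :
  lame_class T u1 f1 -> lame_solution la mu T phi X g h u1 f1 ->
  lame_class T u2 f2 -> lame_solution la mu T phi X g h u2 f2 ->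
  (forall t j, 0 <= t <= T ->
     {ae @volume R, forall x, @Omega R x -> u1 t j x = u2 t j x}) /\
  (forall j, {ae @volume R, forall x, @Omega R x -> f1 j x = f2 j x}).
Proof.
move=> cl1 sol1 cl2 sol2.
have [L [C [LT C0 phiC]]] := phi_sign.
have C1 j : C2L2 T (fun t => u1 t j) by have [] := cl1 j.
have C2 j : C2L2 T (fun t => u2 t j) by have [] := cl2 j.
have Lf1 j : L2 (f1 j) by have [] := cl1 j.
have Lf2 j : L2 (f2 j) by have [] := cl2 j.
have Lu (u : R -> vector_field R) j t : C2L2 T (fun t => u t j) -> 0 <= t <= T -> L2 (u t j).
  by case=> cu _ _ _ _ tT; exact: (C0L2_L2 T (fun t => u t j)).
have Ldu (u : R -> vector_field R) j t : C2L2 T (fun t => u t j) -> 0 <= t <= T ->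
    L2 (dt T (fun s => u s j) t).
  by case=> _ _ cu _ _ tT; exact: (C0L2_L2 T _ _ cu).
have Lddu (u : R -> vector_field R) j t : C2L2 T (fun t => u t j) -> 0 <= t <= T ->
    L2 (dt T (dt T (fun s => u s j)) t).
  by case=> _ _ _ _ cu tT; exact: (C0L2_L2 T _ _ cu).
have TT : 0 <= T <= T by rewrite lexx ltW.
have iphi : (@lebesgue_measure R).-integrable `]0, T[ (EFin \o phi).
  apply/integrable_mkcond => //; move/Lfun1_integrable: phi_L1.
  by congr (_.-integrable _ _); apply/funext => x; rewrite /= !patchE; case: ifP.
have u0 j : {ae @volume R, forall x, @Omega R x -> u1 0 j x = u2 0 j x}.
  have [_ /(_ j)[i1 _] _ _] := sol1; have [_ /(_ j)[i2 _] _ _] := sol2.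
  by apply: filterS2 i1 i2 => x h1 h2 Ox; rewrite h1// h2.
have du0 j : {ae @volume R, forall x, @Omega R x ->
    dt T (fun s => u1 s j) 0 x = dt T (fun s => u2 s j) 0 x}.
  have [_ /(_ j)[_ i1] _ _] := sol1; have [_ /(_ j)[_ i2] _ _] := sol2.
  by apply: filterS2 i1 i2 => x h1 h2 Ox; rewrite h1// h2.
have Le (eta : 'I_3 -> R) : L2 (expo eta).
  by apply: continuous_L2; case: (smoothP _ (smooth_expo eta)).
pose D eta k t := ip (u1 t k) (expo eta) - ip (u2 t k) (expo eta).
pose D1 eta k t := ip (dt T (fun s => u1 s k) t) (expo eta)
  - ip (dt T (fun s => u2 s k) t) (expo eta).
pose D2 eta k t := ip (dt T (dt T (fun s => u1 s k)) t) (expo eta)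
  - ip (dt T (dt T (fun s => u2 s k)) t) (expo eta).
pose F eta j := ip (f1 j) (expo eta) - ip (f2 j) (expo eta).
have DR eta k : rest_trajectory T (D eta k) (D1 eta k) (D2 eta k).
  exact: (rest_trajectory_pairing T (fun t => u1 t k) (fun t => u2 t k) _ T_gt0 (Le eta)
    (C1 k) (C2 k) (u0 k) (du0 k)).
have ode eta : {ae @lebesgue_measure R, forall t, 0 < t < T -> forall j,
    D2 eta j t = mu * (\sum_(k < 3) eta k ^+ 2) * D eta j t
      + (la + mu) * eta j * (\sum_(k < 3) eta k * D eta k t) + phi t * F eta j}.
  apply: filterS2 (ae_solves_at _ _ _ _ _ _ _ _ _ cl1 sol1)
    (ae_solves_at _ _ _ _ _ _ _ _ _ cl2 sol2) => t s1 s2 tT j.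
  have tT' : 0 <= t <= T by case/andP: tT => /ltW -> /ltW ->.
  exact: (pairing_equation la mu T phi X u1 u2 f1 f2 t eta j (s1 tT) (s2 tT) Lf1 Lf2
    (fun j => Lddu u1 j t (C1 j) tT') (fun j => Lddu u2 j t (C2 j) tT')).
have ipB v w (eta : 'I_3 -> R) : L2 v -> L2 w ->
    ip (v \- w) (expo eta) = ip v (expo eta) - ip w (expo eta).
  move=> Lv Lw; rewrite -mulN1r -(ipZ _ _ _ Lw (Le eta)) -ipD//; last exact: Lp2Z.
  by apply: eq_Rintegral => x _; rewrite mulN1r.
have N2E (a b r : R) : \sum_(k < 3) freq a b r k ^+ 2 = a ^+ 2 + b ^+ 2 + r ^+ 2.
  by rewrite !big_ord_recl big_ord0 addr0 addrA.
have N2_gt0 (a b : R) (r : nat) : (0 < r)%N -> 0 < \sum_(k < 3) freq a b r%:R k ^+ 2.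
  move=> r0; rewrite N2E; apply: ltr_wpDl; first by rewrite addr_ge0// sqr_ge0.
  by rewrite exprn_gt0// ltr0n.
have N_ge (a b : R) (r : nat) : r%:R <= Num.sqrt (\sum_(k < 3) freq a b r%:R k ^+ 2).
  rewrite N2E -[leLHS]ger0_norm// -sqrtr_sqr ler_wsqrtr// lerDr.
  by rewrite addr_ge0// sqr_ge0.
have fE j : {ae @volume R, forall x, @Omega R x -> f1 j x = f2 j x}.
  have [K [N0 [K0 bound]]] :=
    system_bound la mu T L C phi mu_gt0 lamu_gt0 LT C0 iphi phiC T_large.
  suff : {ae @volume R, forall x, @Omega R x -> (f1 j \- f2 j) x = 0}.
    by apply: filterS => x e Ox; apply/eqP; rewrite -subr_eq0; apply/eqP; exact: e.
  (* For fixed [a] and [b], the pairings with [f1 j - f2 j] are bounded in [r]. *)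
  apply: expo_complete; first exact: Lp2B.
  move=> a b.
  (* The third frequency [r] enters the bound of the pairings at time [T] only
     through [exp (a + b + r)], and [r <= |eta|]. *)
  pose b0 := \sum_(k < 3) ((L1norm (u1 T k) + L1norm (u2 T k)) +
    (L1norm (dt T (fun s => u1 s k) T) + L1norm (dt T (fun s => u2 s k) T))).
  exists (K * (expR (a%:R + b%:R) * b0)), (maxn 1 (Num.bound `|N0|)).
  move=> r; rewrite geq_max => /andP[r1 rN].
  set eta := freq _ _ _.
  have L1_ge0 (v : space3 R -> R) : 0 <= L1norm v by apply: Rintegral_ge0.
  have b0_ge k : (L1norm (u1 T k) + L1norm (u2 T k)) +
    (L1norm (dt T (fun s => u1 s k) T) + L1norm (dt T (fun s => u2 s k) T)) <= b0.
    by rewrite /b0 (bigD1 k)//= lerDl sumr_ge0// => i _; rewrite !addr_ge0.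
  have pair_le (v w : space3 R -> R) : L2 v -> L2 w -> `|ip v (expo eta) - ip w (expo eta)| <=
      expR (a%:R + b%:R + r%:R) * (L1norm v + L1norm w).
    move=> Lv Lw; apply: le_trans (ler_normB _ _) _; rewrite mulrDr.
    by apply: lerD; apply: ip_expo_le.
  have := bound eta (D eta) (D1 eta) (D2 eta) (F eta)
    (expR (a%:R + b%:R + r%:R) * b0) (N2_gt0 _ _ _ r1) _ (DR eta) (ode eta) _ _ j.
  rewrite ipB//; move=> Fb; apply: le_trans (Fb _ _ _) _.
  - apply: le_trans (N_ge _ _ _); apply: le_trans (ler_norm N0) _.
    by apply: ltW; apply: lt_le_trans (archi_boundP (normr_ge0 _)) _; rewrite ler_nat.
  - move=> k; apply: le_trans (pair_le _ _ (Lu u1 k T (C1 k) TT) (Lu u2 k T (C2 k) TT)) _.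
    rewrite ler_wpM2l ?expR_ge0//; apply: le_trans (b0_ge k); rewrite lerDl addr_ge0//.
  - move=> k; apply: le_trans (pair_le _ _ (Ldu u1 k T (C1 k) TT) (Ldu u2 k T (C2 k) TT)) _.
    rewrite ler_wpM2l ?expR_ge0//; apply: le_trans (b0_ge k); rewrite lerDr addr_ge0//.
  rewrite -mulrA ler_wpM2l// mulrA ler_wpM2r//.
    by apply: sumr_ge0 => k _; rewrite !addr_ge0.
  by rewrite -expRD ler_expR; have := N_ge a%:R b%:R r; rewrite -/eta; lra.
split => // t j /andP[+ tT]; rewrite le_eqVlt => /predU1P[<-//|t0].
suff : {ae @volume R, forall x, @Omega R x -> (u1 t j \- u2 t j) x = 0}.
  by apply: filterS => x e Ox; apply/eqP; rewrite -subr_eq0; apply/eqP; exact: e.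
have tT' : 0 <= t <= T by rewrite ltW.
have Lu1 := Lu u1 j t (C1 j) tT'; have Lu2 := Lu u2 j t (C2 j) tT'.
apply: expo_complete; first exact: Lp2B.
move=> a b; exists 0, 1%N => r r1; rewrite ipB//.
set eta := freq _ _ _.
(* With equal forces the pairings are those of a free system at rest. *)
have F0 k : F eta k = 0.
  by rewrite /F (ip_ae _ _ _ (Lf1 k) (Lf2 k) (Le eta) (fE k)) subrr.
have := system_free la mu T phi mu_gt0 lamu_gt0 eta (N2_gt0 _ _ _ r1) (D eta) (D1 eta)
  (D2 eta) (F eta) (DR eta) (ode eta) F0 t j.
by rewrite /D t0 tT => ->; rewrite ?normr0.
Qed.
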